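(* Let $X$ be a compact Hausdorff space and let $\mathcal{E}$ and $\mathcal{F}$ be two (F) Banach bundles over $X$, each of which is subhomogeneous, conditionally of finite type, and such that for every $d$ the set of points of $X$ over which its fiber has dimension $\le d$ is a $G_\delta$ subset of $X$. Then the canonical morphism of Banach $C(X)$-modules $$\Gamma(\mathcal{E})\,\widehat{\otimes}_{C(X)}\,\Gamma(\mathcal{F})\longrightarrow\Gamma(\mathcal{E}\,\widehat{\otimes}_X\,\mathcal{F})$$ is bijective.
   Context: An (H) Banach bundle over $X$ is a continuous open surjection $\pi:\mathcal{E}\to X$ whose fibers $\mathcal{E}_x:=\pi^{-1}(x)$ are complex Banach spaces, such that: scalar multiplication and fiberwise addition are continuous; the norm $\mathcal{E}\to\mathbb{R}$ is upper semicontinuous; and for every $x\in X$ the sets $\{s : \pi(s)\in U,\ \|s\|<\varepsilon\}$ ($U$ a neighborhood of $x$, $\varepsilon>0$) form a fundamental system of neighborhoods of $0_x\in\mathcal{E}_x$. It is (F) if moreover the norm is continuous. $\Gamma(\mathcal{E})$ is the Banach $C(X)$-module of continuous sections with the supremum norm. $\mathcal{E}$ is subhomogeneous if $\sup_x\dim\mathcal{E}_x<\infty$. Writing $X_d:=\{x : \dim\mathcal{E}_x=d\}$, a subhomogeneous $\mathcal{E}$ is conditionally of finite type if for each $d$ the space $X_d$ has a finite cover by (relatively) open sets $U$ over each of which $\mathcal{E}$ is trivial, i.e. $\mathcal{E}|_U\cong U\times E$ via a fiberwise linear homeomorphism over $U$, for a Banach space $E$. A $G_\delta$ set is a countable intersection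 of open sets. For Banach $C(X)$-modules $M,N$, $M\widehat{\otimes}_{C(X)}N$ is the quotient of the projective Banach-space tensor product $M\widehat{\otimes}N$ by the closed span of the elements $fm\otimes n-m\otimes fn$, $f\in C(X)$. $\mathcal{E}\widehat{\otimes}_X\mathcal{F}$ is the (H) bundle with fiber the projective tensor product $\mathcal{E}_x\widehat{\otimes}\mathcal{F}_x$ at $x$, topologized so that $x\mapsto\sigma(x)\otimes\tau(x)$ is a continuous section for all $\sigma\in\Gamma(\mathcal{E})$, $\tau\in\Gamma(\mathcal{F})$. The canonical morphism sends $\sigma\otimes\tau$ to $x\mapsto\sigma(x)\otimes\tau(x)$. *)

(* Defs.v *)
From HB Require Import structures.
From mathcomp Require Import all_boot all_order all_algebra.
From mathcomp Require Import all_classical all_reals all_analysis.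
From mathcomp Require Import complex generic_quotient ring lra.
Set Implicit Arguments. Unset Strict Implicit. Unset Printing Implicit Defensive.
Import Order.TTheory GRing.Theory Num.Theory.
Import numFieldNormedType.Exports.
Local Open Scope classical_set_scope.
Local Open Scope ring_scope.
Local Open Scope complex_scope.

Section RealNorm.
Variables (R : realType) (V : normedModType R[i]).
Implicit Types v w : V.

(* Norms over R[i] take values in R[i]; rnorm is the same norm, read in R. *)
Definition rnorm (v : V) : R := complex.Re `|v|.

Lemma rnormE v : `|v| = (rnorm v)%:C.
Proof.
rewrite /rnorm; have := ger0_Im (normr_ge0 v).
by case: `|v| => a b /= ->.
Qed.

Lemma rnorm_ge0 v : 0 <= rnorm v.
Proof. by have := normr_ge0 v; rewrite rnormE lecE /= => /andP[]. Qed.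

Lemma rnormD v w : rnorm (v + w) <= rnorm v + rnorm w.
Proof. by have := ler_normD v w; rewrite !rnormE lecE /= => /andP[]. Qed.

Lemma rnormZ (a : R[i]) v : rnorm (a *: v) = complex.Re `|a| * rnorm v.
Proof.
rewrite {1}/rnorm normrZ rnormE normc_def /=.
by rewrite mulr0 subr0.
Qed.

Lemma rnorm_eq0 v : rnorm v = 0 -> v = 0.
Proof. by move=> v0; apply/eqP; rewrite -normr_eq0 rnormE v0. Qed.

Lemma rnormB v w : rnorm (v - w) = rnorm (w - v).
Proof. by rewrite /rnorm distrC. Qed.

End RealNorm.

Lemma gt0_complexE (R : realType) (e : R[i]) :
  0 < e -> e = (complex.Re e)%:C /\ 0 < complex.Re e.
Proof. by case: e => a b; rewrite ltcE /= => /andP[/eqP-> ->]. Qed.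

Record seminorm (R : realType) (V : lmodType R[i]) := Seminorm {
  seminorm_fun :> V -> R;
  seminormD : forall u v, seminorm_fun (u + v) <= seminorm_fun u + seminorm_fun v;
  seminormZ : forall (a : R[i]) v,
    seminorm_fun (a *: v) = complex.Re `|a| * seminorm_fun v }.

Section Seminorm.
Variables (R : realType) (V : lmodType R[i]) (p : seminorm V).

Lemma seminorm0 : p 0 = 0.
Proof. by rewrite -(scale0r 0) seminormZ normr0 mul0r. Qed.

Lemma seminormN u : p (- u) = p u.
Proof. by rewrite -scaleN1r seminormZ normrN normr1 mul1r. Qed.

Lemma seminorm_ge0 u : 0 <= p u.
Proof.
have := seminormD p u (- u); rewrite subrr seminorm0 seminormN.
by rewrite -mulr2n pmulrn_lge0.
Qed.

Lemma seminormB u v : p (u - v) = p (v - u).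
Proof. by rewrite -seminormN opprB. Qed.

Lemma seminorm_dist u v : `|p u - p v| <= p (u - v).
Proof.
have := seminormD p (v - u) u; rewrite subrK -seminormB => h1.
have := seminormD p (u - v) v; rewrite subrK => h2.
by rewrite ler_norml; apply/andP; split; lra.
Qed.

Lemma seminorm_eq u v : p (u - v) = 0 -> p u = p v.
Proof.
move=> h; have := seminorm_dist u v; rewrite h normr_le0 subr_eq0.
by move/eqP.
Qed.

(* Hausdorff quotient V / p^-1(0), on which p induces a norm. *)
Definition sep_rel (u v : V) : bool := p (u - v) == 0.

Lemma sep_rel_equiv : equiv_class_of sep_rel.
Proof.
split=> [u|u v|v u w].
- by rewrite /sep_rel subrr seminorm0.
- by rewrite /sep_rel seminormB.
- rewrite /sep_rel => /eqP uv /eqP vw.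
  rewrite eq_le seminorm_ge0 andbT.
  by have := seminormD p (u - v) (v - w); rewrite addrA subrK uv vw addr0.
Qed.

Canonical sep_equivRel := EquivRelPack sep_rel_equiv.

Definition sep : Type := {eq_quot sep_rel}%qT.
HB.instance Definition _ := Choice.on sep.
HB.instance Definition _ := EqQuotient.on sep.

Definition sep_pi (v : V) : sep := (\pi_sep v)%qT.
Definition sep_repr (q : sep) : V := repr q.

Lemma sep_reprK q : sep_pi (sep_repr q) = q.
Proof. exact: reprK. Qed.

Lemma sep_piP u v : sep_pi u = sep_pi v <-> p (u - v) = 0.
Proof.
rewrite /sep_pi; split=> [/eqmodP|h]; first by move/eqP.
by apply/eqmodP; rewrite /= /sep_rel h.
Qed.

Lemma sep_ind (P : sep -> Prop) : (forall v, P (sep_pi v)) -> forall q, P q.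
Proof. by move=> h q; rewrite -(sep_reprK q). Qed.

Lemma sep_repr_pi v : p (sep_repr (sep_pi v) - v) = 0.
Proof. by apply/sep_piP; rewrite sep_reprK. Qed.

Definition sep_add q r := sep_pi (sep_repr q + sep_repr r).
Definition sep_opp q := sep_pi (- sep_repr q).
Definition sep_scale (a : R[i]) q := sep_pi (a *: sep_repr q).

Lemma sep_addE u v : sep_add (sep_pi u) (sep_pi v) = sep_pi (u + v).
Proof.
apply/sep_piP/eqP; rewrite eq_le seminorm_ge0 andbT opprD addrACA.
by apply: le_trans (seminormD _ _ _) _; rewrite !sep_repr_pi addr0.
Qed.

Lemma sep_oppE u : sep_opp (sep_pi u) = sep_pi (- u).
Proof. by apply/sep_piP; rewrite -opprD seminormN sep_repr_pi. Qed.

Lemma sep_scaleE a u : sep_scale a (sep_pi u) = sep_pi (a *: u).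
Proof. by apply/sep_piP; rewrite -scalerBr seminormZ sep_repr_pi mulr0. Qed.

Lemma sep_addA : associative sep_add.
Proof.
elim/sep_ind=> u; elim/sep_ind=> v; elim/sep_ind=> w.
by rewrite !sep_addE addrA.
Qed.
Lemma sep_addC : commutative sep_add.
Proof. by elim/sep_ind=> u; elim/sep_ind=> v; rewrite !sep_addE addrC. Qed.
Lemma sep_add0 : left_id (sep_pi 0) sep_add.
Proof. by elim/sep_ind=> u; rewrite sep_addE add0r. Qed.
Lemma sep_addN : left_inverse (sep_pi 0) sep_opp sep_add.
Proof. by elim/sep_ind=> u; rewrite sep_oppE sep_addE addNr. Qed.

HB.instance Definition _ :=
  GRing.isZmodule.Build sep sep_addA sep_addC sep_add0 sep_addN.

Lemma sep_piD u v : sep_pi (u + v) = sep_pi u + sep_pi v.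
Proof. by rewrite -sep_addE. Qed.

Lemma sep_scaleA a b q : sep_scale a (sep_scale b q) = sep_scale (a * b) q.
Proof. by elim/sep_ind: q => u; rewrite !sep_scaleE scalerA. Qed.
Lemma sep_scale1 : left_id 1 sep_scale.
Proof. by elim/sep_ind=> u; rewrite sep_scaleE scale1r. Qed.
Lemma sep_scaleDr : right_distributive sep_scale +%R.
Proof.
move=> a; elim/sep_ind=> u; elim/sep_ind=> v.
by rewrite -sep_piD !sep_scaleE -sep_piD scalerDr.
Qed.
Lemma sep_scaleDl q : {morph sep_scale^~ q : a b / a + b}.
Proof.
elim/sep_ind: q => u a b.
by rewrite !sep_scaleE -sep_piD scalerDl.
Qed.

HB.instance Definition _ := GRing.Zmodule_isLmodule.Build R[i] sep
  sep_scaleA sep_scale1 sep_scaleDr sep_scaleDl.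

Lemma sep_piZ (a : R[i]) u : sep_pi (a *: u) = a *: sep_pi u.
Proof. by rewrite -sep_scaleE. Qed.

Lemma sep_pi_is_linear : linear sep_pi.
Proof. by move=> a u v; rewrite sep_piD sep_piZ. Qed.
HB.instance Definition _ :=
  GRing.isLinear.Build R[i] V sep _ sep_pi sep_pi_is_linear.

Definition sep_norm (q : sep) : R[i] := (p (sep_repr q))%:C.

Lemma sep_normE u : sep_norm (sep_pi u) = (p u)%:C.
Proof. by rewrite /sep_norm (seminorm_eq (sep_repr_pi u)). Qed.

Lemma sep_normD q r : sep_norm (q + r) <= sep_norm q + sep_norm r.
Proof.
elim/sep_ind: q => u; elim/sep_ind: r => v.
by rewrite -sep_piD !sep_normE -rmorphD lecR seminormD.
Qed.

Lemma sep_normZ (a : R[i]) q : sep_norm (a *: q) = `|a| * sep_norm q.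
Proof.
elim/sep_ind: q => u; rewrite -sep_piZ !sep_normE seminormZ rmorphM.
by rewrite normc_def.
Qed.

Lemma sep_norm_eq0 q : sep_norm q = 0 -> q = 0.
Proof.
elim/sep_ind: q => u; rewrite sep_normE => /(congr1 (@complex.Re R)) /= pu0.
by apply/sep_piP; rewrite subr0.
Qed.

HB.instance Definition _ :=
  Lmodule_isNormed.Build R[i] sep sep_normD sep_normZ sep_norm_eq0.

Lemma rnorm_sep u : rnorm (sep_pi u) = p u.
Proof. by rewrite /rnorm [`|_|]sep_normE. Qed.

End Seminorm.

Section CauchySequences.
Variables (R : realType) (V : lmodType R[i]) (p : seminorm V).

Definition cauchy_seq (u : nat -> V) : Prop := forall e : R, 0 < e ->
  exists N, forall m n, (N <= m)%N -> (N <= n)%N -> p (u m - u n) < e.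

Definition cauchy_pred : {pred nat -> V} := fun u => `[< cauchy_seq u >].

Lemma cauchy_pred_submod : submod_closed cauchy_pred.
Proof.
split=> [|a u v /asboolP uC /asboolP vC].
  apply/asboolP => e e0; exists 0%N => m n _ _.
  by rewrite subrr seminorm0.
apply/asboolP => e e0.
have a0 : 0 < complex.Re `|a| + 1.
  have := normr_ge0 a; rewrite normc_def lecR /= => h; lra.
have [N uN] := uC (e / 2 / (complex.Re `|a| + 1)) ltac:(by rewrite !divr_gt0).
have [M vM] := vC (e / 2) ltac:(by rewrite divr_gt0).
exists (maxn N M) => m n; rewrite !geq_max => /andP[Nm Mm] /andP[Nn Mn].
rewrite /= [X in p X](_ : _ = a *: (u m - u n) + (v m - v n)); last first.
  by rewrite scalerBr addrACA -opprD.
apply: le_lt_trans (seminormD _ _ _) _.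
rewrite [ltRHS](_ : e = e / 2 + e / 2); last by field.
apply: ler_ltD; last exact: vM.
rewrite seminormZ.
apply: le_trans (_ : (complex.Re `|a| + 1) * p (u m - u n) <= _).
  by apply: ler_wpM2r; [exact: seminorm_ge0|lra].
by rewrite mulrC -ler_pdivlMr// ltW// uN.
Qed.

HB.instance Definition _ :=
  GRing.isSubmodClosed.Build R[i] (nat -> V) cauchy_pred cauchy_pred_submod.

Record cseq := CSeq { cseq_val :> nat -> V; _ : cseq_val \in cauchy_pred }.
HB.instance Definition _ := [isSub for cseq_val].
HB.instance Definition _ := [Choice of cseq by <:].
HB.instance Definition _ := [SubChoice_isSubLmodule of cseq by <:].

Lemma cseqP (u : cseq) : cauchy_seq u.
Proof. by apply/asboolP; case: u. Qed.

Definition mk_cseq u (h : cauchy_seq u) : cseq := CSeq (asboolT h).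

Lemma cseq_cvg (u : cseq) : cvgn (fun n => p (u n) : R^o).
Proof.
apply: cauchy_cvg; apply: cauchy_exP => e e0.
have [N uN] := cseqP u e0.
exists (p (u N)); exists N => // n /= Nn.
by apply: le_lt_trans (seminorm_dist _ _ _) _; apply: uN.
Qed.

Definition cseq_norm (u : cseq) : R := limn (fun n => p (u n) : R^o).

Lemma cseq_normD u v : cseq_norm (u + v) <= cseq_norm u + cseq_norm v.
Proof.
rewrite /cseq_norm -limD; [|exact: cseq_cvg..].
apply: ler_lim; [exact: cseq_cvg|apply: is_cvgD; exact: cseq_cvg|].
by apply: nearW => n; exact: seminormD.
Qed.

Lemma cseq_normZ (a : R[i]) u :
  cseq_norm (a *: u) = complex.Re `|a| * cseq_norm u.
Proof.
apply: cvg_lim => //.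
rewrite (_ : (fun n => _) = fun n => complex.Re `|a| * p (u n)); last first.
  by apply/funext => n; rewrite -seminormZ.
by apply: cvgMr; exact: cseq_cvg.
Qed.

Definition cseq_seminorm : seminorm cseq := Seminorm cseq_normD cseq_normZ.

Lemma cseq_norm_le (u : cseq) (b : R) N :
  (forall n, (N <= n)%N -> p (u n) <= b) -> cseq_norm u <= b.
Proof.
move=> h; apply: limr_le; first exact: cseq_cvg.
by exists N.
Qed.

Lemma cst_cauchy (v : V) : cauchy_seq (fun=> v).
Proof.
by move=> e e0; exists 0%N => m n _ _; rewrite subrr seminorm0.
Qed.

(* Cauchy sequences modulo null sequences, normed by u |-> lim p (u n). *)
Definition completion : Type := sep cseq_seminorm.
HB.instance Definition _ := NormedModule.on completion.

Definition to_completion (v : V) : completion :=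
  sep_pi cseq_seminorm (mk_cseq (cst_cauchy v)).

Lemma to_completion_is_linear : linear to_completion.
Proof.
move=> a u v; rewrite /to_completion -[RHS]linearP; congr sep_pi.
exact/val_inj.
Qed.
HB.instance Definition _ := GRing.isLinear.Build R[i] V completion _
  to_completion to_completion_is_linear.

Lemma rnorm_to_completion v : rnorm (to_completion v) = p v.
Proof.
rewrite rnorm_sep -[LHS]/(limn (fun n : nat => p v : R^o)).
by apply: lim_cst; exact: norm_hausdorff.
Qed.

Lemma completion_tail (u : cseq) (e : R) : 0 < e -> exists N, forall n,
  (N <= n)%N -> rnorm (sep_pi cseq_seminorm u - to_completion (u n)) <= e.
Proof.
move=> e0; have [N uN] := cseqP u e0; exists N => n Nn.
rewrite -linearB rnorm_sep; apply: (@cseq_norm_le _ _ N) => m Nm.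
exact/ltW/uN.
Qed.

Lemma completion_dense (q : completion) (e : R) : 0 < e ->
  exists v, rnorm (q - to_completion v) <= e.
Proof.
move=> e0; elim/sep_ind: q => u; have [N uN] := completion_tail u e0.
by exists (u N); exact: uN.
Qed.

Lemma completion_complete (F : set_system completion) :
  ProperFilter F -> cauchy F -> cvg F.
Proof.
move=> FF /cauchyP Fc.
pose e n : R := n.+1%:R^-1.
have e0 n : 0 < e n by rewrite invr_gt0.
have eC n : 0 < (e n)%:C by rewrite ltcR.
have /choice[q Fq] n : exists q : completion, F (ball q (e n)%:C) by exact: Fc.
have /choice[w qw] n : exists v, rnorm (q n - to_completion v) <= e n.
  exact: completion_dense.
have wC : cauchy_seq w.
  move=> d d0.
  have d8 : 0 < d / 8 by rewrite divr_gt0.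
  have [N _ eN] := @near_infty_natSinv_lt R (PosNum d8).
  exists N => m n Nm Nn; rewrite -rnorm_to_completion linearB /=.
  have [y [ym yn]] := @filter_ex _ F FF _ (filterI (Fq m) (Fq n)).
  have qm : rnorm (q m - y) <= e m.
    by move: ym; rewrite -ball_normE /= rnormE ltcR => /ltW.
  have qn : rnorm (y - q n) <= e n.
    by move: yn; rewrite -ball_normE /= distrC rnormE ltcR => /ltW.
  have wm : rnorm (to_completion (w m) - q m) <= e m by rewrite rnormB.
  have em : e m < d / 8 by exact: eN.
  have en : e n < d / 8 by exact: eN.
  rewrite (_ : _ - _ = (to_completion (w m) - q m) + (q m - y) +
     ((y - q n) + (q n - to_completion (w n)))); last first.
    by rewrite !addrA !subrK.
  have h1 := rnormD ((to_completion (w m) - q m) + (q m - y))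
     ((y - q n) + (q n - to_completion (w n))).
  have h2 := rnormD (to_completion (w m) - q m) (q m - y).
  have h3 := rnormD (y - q n) (q n - to_completion (w n)).
  have h4 := qw n.
  lra.
apply/cvg_ex; exists (sep_pi cseq_seminorm (mk_cseq wC)).
apply/cvg_ballP => eps /gt0_complexE[-> d0].
set d := complex.Re eps in d0 *.
have d8 : 0 < d / 8 by rewrite divr_gt0.
have [N _ eN] := @near_infty_natSinv_lt R (PosNum d8).
have [M wM] := completion_tail (mk_cseq wC) d8.
have h1 := wM _ (leq_maxr N M).
have h2 : e (maxn N M) < d / 8 by apply: eN => /=; exact: leq_maxl.
have h3 := qw (maxn N M).
apply: filterS (Fq (maxn N M)) => y; rewrite -!ball_normE /= !rnormE !ltcR => h4.
set l := sep_pi _ _ in h1 *; set n := maxn N M in h1 h2 h3 h4.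
rewrite (_ : l - y = (l - to_completion (w n)) +
  ((to_completion (w n) - q n) + (q n - y))); last by rewrite !addrA !subrK.
have h5 := rnormD (l - to_completion (w n))
  ((to_completion (w n) - q n) + (q n - y)).
have h6 := rnormD (to_completion (w n) - q n) (q n - y).
rewrite rnormB in h3.
rewrite /= in h1.
lra.
Qed.

HB.instance Definition _ := Uniform_isComplete.Build completion
  completion_complete.

End CauchySequences.

Section ProjectiveTensor.
Variables (R : realType) (M N : normedModType R[i]).

(* The algebraic tensor product is realised inside the dual of the space of all
   (not necessarily bounded) bilinear forms: m (x) n is evaluation at (m, n),
   and the tensors are the finite sums of such evaluations. *)
Definition bilform : Type := {bilinear M -> N -> R[i] | *%R & *%R}.

Definition alg_tensor (m : M) (n : N) : bilform -> R[i]^o := fun b => b m n.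

Definition tensor_sum (s : seq (M * N)) : bilform -> R[i]^o :=
  \sum_(z <- s) alg_tensor z.1 z.2.

Definition atensor_pred : {pred bilform -> R[i]^o} :=
  fun u => `[< exists s, u = tensor_sum s >].

Lemma alg_tensorZ a m n : alg_tensor (a *: m) n = a *: alg_tensor m n.
Proof. by apply/funext => b; rewrite /alg_tensor linearZl_LR. Qed.

Lemma tensor_sumZ a s :
  tensor_sum [seq (a *: z.1, z.2) | z <- s] = a *: tensor_sum s.
Proof.
rewrite /tensor_sum big_map scaler_sumr.
by apply: eq_bigr => z _; rewrite alg_tensorZ.
Qed.

Lemma tensor_sum_cat s t : tensor_sum (s ++ t) = tensor_sum s + tensor_sum t.
Proof. exact: big_cat. Qed.

Lemma atensor_submod : submod_closed atensor_pred.
Proof.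
split=> [|a u v /asboolP[s ->] /asboolP[t ->]].
  by apply/asboolP; exists [::]; rewrite /tensor_sum big_nil.
apply/asboolP; exists ([seq (a *: z.1, z.2) | z <- s] ++ t).
by rewrite tensor_sum_cat tensor_sumZ.
Qed.

HB.instance Definition _ := GRing.isSubmodClosed.Build R[i] (bilform -> R[i]^o)
  atensor_pred atensor_submod.

Record atensor :=
  ATensor { atensor_val :> bilform -> R[i]^o; _ : atensor_val \in atensor_pred }.
HB.instance Definition _ := [isSub for atensor_val].
HB.instance Definition _ := [Choice of atensor by <:].
HB.instance Definition _ := [SubChoice_isSubLmodule of atensor by <:].

Lemma tensor_sum_in s : tensor_sum s \in atensor_pred.
Proof. by apply/asboolP; exists s. Qed.

Definition atensor_of (s : seq (M * N)) : atensor := ATensor (tensor_sum_in s).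

Lemma atensor_of_sum (s : seq (M * N)) :
  atensor_of s = \sum_(z <- s) atensor_of [:: z].
Proof.
elim: s => [|z s IH].
  by apply/val_inj; rewrite big_nil /= /tensor_sum big_nil.
rewrite big_cons -IH; apply/val_inj.
by rewrite /= /tensor_sum big_cons big_seq1.
Qed.

Definition proj_sum (s : seq (M * N)) : R :=
  \sum_(z <- s) rnorm z.1 * rnorm z.2.

(* Projective norm: the infimum over all representations of u. *)
Definition proj_costs (u : atensor) : set R :=
  [set proj_sum s | s in [set s | u = atensor_of s]].

Definition proj_norm (u : atensor) : R := inf (proj_costs u).

Lemma proj_sum_ge0 s : 0 <= proj_sum s.
Proof. by apply: sumr_ge0 => z _; rewrite mulr_ge0 ?rnorm_ge0. Qed.

Lemma proj_costs_inf u : has_inf (proj_costs u).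
Proof.
split; last by exists 0 => _ [s _ <-]; exact: proj_sum_ge0.
case: u => u; move: (u) => _ /[dup] /asboolP[s ->] us.
by exists (proj_sum s), s => //; exact/val_inj.
Qed.

Lemma proj_norm_le s : proj_norm (atensor_of s) <= proj_sum s.
Proof. by apply: ge_inf; [case: (proj_costs_inf (atensor_of s))|exists s]. Qed.

Lemma proj_norm_approx u (e : R) : 0 < e ->
  exists2 s, u = atensor_of s & proj_sum s < proj_norm u + e.
Proof.
by move=> e0; have [_ [s us <-] h] := inf_adherent e0 (proj_costs_inf u);
  exists s.
Qed.

Lemma proj_normD u v : proj_norm (u + v) <= proj_norm u + proj_norm v.
Proof.
apply/ler_addgt0Pl => e e0.
have e2 : 0 < e / 2 by rewrite divr_gt0.
have [s -> hs] := proj_norm_approx u e2; have [t -> ht] := proj_norm_approx v e2.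
have -> : atensor_of s + atensor_of t = atensor_of (s ++ t).
  by apply/val_inj; rewrite /= tensor_sum_cat.
have := proj_norm_le (s ++ t); rewrite /proj_sum big_cat /= -!/(proj_sum _).
lra.
Qed.

Lemma proj_normZ_le a u : proj_norm (a *: u) <= complex.Re `|a| * proj_norm u.
Proof.
have a0 : 0 <= complex.Re `|a| by exact: (@rnorm_ge0 R R[i]^o).
apply/ler_addgt0Pl => e e0.
have d0 : 0 < e / (complex.Re `|a| + 1) by rewrite divr_gt0 ?ltr_wpDl.
have [s -> hs] := proj_norm_approx u d0.
have -> : a *: atensor_of s = atensor_of [seq (a *: z.1, z.2) | z <- s].
  by apply/val_inj; rewrite /= tensor_sumZ.
apply: le_trans (proj_norm_le _) _.
have -> : proj_sum [seq (a *: z.1, z.2) | z <- s] = complex.Re `|a| * proj_sum s.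
  rewrite /proj_sum big_map mulr_sumr; apply: eq_bigr => z _.
  by rewrite rnormZ mulrA.
apply: le_trans (ler_wpM2l a0 (ltW hs)) _.
rewrite mulrDr addrC lerD2r mulrCA ler_piMr ?ltW//.
by rewrite ltr_pdivrMr ?ltr_wpDl// mul1r ltrDl.
Qed.

Lemma proj_norm_ge0 u : 0 <= proj_norm u.
Proof.
apply: lb_le_inf; first by case: (proj_costs_inf u).
by move=> _ [s _ <-]; exact: proj_sum_ge0.
Qed.

Lemma proj_normZ (a : R[i]) u : proj_norm (a *: u) = complex.Re `|a| * proj_norm u.
Proof.
apply/eqP; rewrite eq_le proj_normZ_le andTb.
have [->|a0] := eqVneq a 0; first by rewrite normr0 mul0r proj_norm_ge0.
have na0 : 0 < complex.Re `|a|.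
  by have := normr_gt0 a; rewrite a0 normc_def ltcE /= => /andP[].
have := proj_normZ_le a^-1 (a *: u); rewrite scalerA mulVf// scale1r.
have -> : complex.Re `|a^-1| = (complex.Re `|a|)^-1.
  by rewrite normfV normc_def -fmorphV.
by rewrite mulrC ler_pdivlMr// mulrC.
Qed.

Definition proj_seminorm : seminorm atensor := Seminorm proj_normD proj_normZ.

Definition ptensor : completeNormedModType R[i] := completion proj_seminorm.

Definition tensor (m : M) (n : N) : ptensor :=
  to_completion proj_seminorm (atensor_of [:: (m, n)]).

End ProjectiveTensor.

Section Bundles.
Variables (R : realType) (X : topologicalType).

(* total is the total space, identified as a set with the disjoint union of the
   fibers E x through point and coord; its topology is arbitrary. *)
Record fibered_space (E : X -> completeNormedModType R[i]) := FiberedSpace {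
  total :> topologicalType;
  point : {x : X & E x} -> total;
  coord : total -> {x : X & E x};
  pointK : cancel point coord;
  coordK : cancel coord point }.

Section Operations.
Variables (E : X -> completeNormedModType R[i]) (b : fibered_space E).

Definition proj (p : b) : X := tag (coord p).

Definition bnorm (p : b) : R := rnorm (tagged (coord p)).

Definition bscale (a : R[i]) (p : b) : b :=
  point b (Tagged E (a *: tagged (coord p))).

(* Meaningful only when proj p = proj q. *)
Definition badd (p q : b) : b :=
  point b (Tagged E (tagged (coord p) + tagged_as (coord p) (coord q))).

Definition bzero (x : X) : b := point b (Tagged E (0 : E x)).

Definition tube (U : set X) (e : R) : set b :=
  [set p | U (proj p) /\ bnorm p < e].

(* Surjectivity of proj is automatic, the fibers E x being nonempty. *)
Record is_hbundle : Prop := IsHBundle {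
  proj_continuous : continuous proj;
  proj_open : forall A : set b, open A -> open (proj @` A);
  bscale_continuous : continuous (fun z : R[i]^o * b => bscale z.1 z.2);
  badd_continuous : {within [set z : b * b | proj z.1 = proj z.2],
    continuous (fun z => badd z.1 z.2)};
  bnorm_usc : forall c : R, open [set p | bnorm p < c];
  nbhs_bzero : forall (x : X) (W : set b), nbhs (bzero x) W <->
    exists (U : set X) (e : R), [/\ nbhs x U, 0 < e & tube U e `<=` W] }.

Definition continuous_section (s : forall x, E x) : Prop :=
  continuous (fun x => point b (Tagged E (s x))).

End Operations.

Record hbundle (E : X -> completeNormedModType R[i]) := HBundle {
  hbundle_space :> fibered_space E;
  hbundleP : is_hbundle hbundle_space }.

(* An (H) bundle is (F) when its norm is continuous. *)
Definition is_fbundle (E : X -> completeNormedModType R[i]) (b : hbundle E) :=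
  continuous (@bnorm E b).

End Bundles.

Section Sections.
Variables (R : realType) (X : topologicalType) (cX : compact [set: X]).
Variables (E : X -> completeNormedModType R[i]) (b : hbundle E).

(* The (phantom) compactness of X makes the supremum norm finite. *)
Record Gamma (cX : compact [set: X]) := GammaSection {
  gamma_val :> forall x, E x;
  gamma_continuous : continuous_section b gamma_val }.

Local Notation gamma := (Gamma cX).

Lemma gammaP (s t : gamma) : (forall x, s x = t x) -> s = t.
Proof.
case: s t => [s sc] [t tc] /= h.
have st : s = t by exact: functional_extensionality_dep.
by move: tc; rewrite -st => tc; congr GammaSection; exact: Prop_irrelevance.
Qed.

HB.instance Definition _ := gen_eqMixin (Gamma cX).
HB.instance Definition _ := gen_choiceMixin (Gamma cX).

Lemma section0 : continuous_section b (fun x => 0).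
Proof.
move=> x A /(nbhs_bzero (hbundleP b)) [U [e [xU e0 UA]]].
apply: filterS xU => y Uy; apply: UA; split; first by rewrite /proj pointK.
by rewrite /bnorm pointK /= /rnorm normr0.
Qed.

Lemma baddE x (v w : E x) : badd (point b (Tagged E v)) (point b (Tagged E w)) =
  point b (Tagged E (v + w)).
Proof. by rewrite /badd !pointK tagged_asE. Qed.

Lemma badd_near x (v w : E x) (W : set b) : nbhs (point b (Tagged E (v + w))) W ->
  \forall z \near (point b (Tagged E v), point b (Tagged E w)),
    proj z.1 = proj z.2 -> W (badd z.1 z.2).
Proof.
have /subspace_continuousP := badd_continuous (hbundleP b).
move=> /(_ (point b (Tagged E v), point b (Tagged E w))).
rewrite /= /proj !pointK => /(_ erefl) h; rewrite -baddE => WW.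
exact: (h W WW).
Qed.

Lemma sectionD (s t : gamma) : continuous_section b (fun x => s x + t x).
Proof.
move=> x A /badd_near hA.
pose g y : b * b := (point b (Tagged E (s y)), point b (Tagged E (t y))).
have h : \forall y \near x, proj (g y).1 = proj (g y).2 -> A (badd (g y).1 (g y).2).
  exact: (cvg_pair (@gamma_continuous _ s x) (@gamma_continuous _ t x) hA).
apply: filterS h => y /=.
by rewrite baddE; apply; rewrite /proj !pointK.
Qed.

Lemma section_mul (f : X -> R[i]^o) (s : gamma) : continuous f ->
  continuous_section b (fun x => (f x : R[i]) *: s x).
Proof.
move=> fc x.
move=> A; have E1 : bscale (f x) (point b (Tagged E (s x))) =
  point b (Tagged E ((f x : R[i]) *: s x)) by rewrite /bscale pointK.
rewrite /= -E1 => hA.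
have {}hA := @bscale_continuous _ _ _ _ (hbundleP b)
  (f x : R[i]^o, point b (Tagged E (s x))) _ hA.
have h' : \forall y \near x, A (bscale (f y) (point b (Tagged E (s y)))).
  exact: (cvg_pair (fc x) (@gamma_continuous _ s x) hA).
by apply: filterS h' => y /=; rewrite /bscale pointK.
Qed.

Lemma sectionZ (a : R[i]) (s : gamma) : continuous_section b (fun x => a *: s x).
Proof. by apply: (@section_mul (fun=> a)) => x; exact: cvg_cst. Qed.

Lemma sectionN (s : gamma) : continuous_section b (fun x => - s x).
Proof.
rewrite (_ : (fun x => _) = fun x => (-1) *: s x); first exact: sectionZ.
by apply/functional_extensionality_dep => x; rewrite scaleN1r.
Qed.

Definition gamma0 : gamma := GammaSection cX section0.
Definition gammaD s t : gamma := GammaSection cX (@sectionD s t).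
Definition gammaN s : gamma := GammaSection cX (@sectionN s).
Definition gammaZ a s : gamma := GammaSection cX (@sectionZ a s).

Lemma gammaDA : associative gammaD.
Proof. by move=> s t u; apply: gammaP => x; exact: addrA. Qed.
Lemma gammaDC : commutative gammaD.
Proof. by move=> s t; apply: gammaP => x; exact: addrC. Qed.
Lemma gamma0D : left_id gamma0 gammaD.
Proof. by move=> s; apply: gammaP => x; exact: add0r. Qed.
Lemma gammaND : left_inverse gamma0 gammaN gammaD.
Proof. by move=> s; apply: gammaP => x; exact: addNr. Qed.
HB.instance Definition _ :=
  GRing.isZmodule.Build (Gamma cX) gammaDA gammaDC gamma0D gammaND.

Lemma gammaZA a c s : gammaZ a (gammaZ c s) = gammaZ (a * c) s.
Proof. by apply: gammaP => x; exact: scalerA. Qed.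
Lemma gamma1Z : left_id 1 gammaZ.
Proof. by move=> s; apply: gammaP => x; exact: scale1r. Qed.
Lemma gammaZDr : right_distributive gammaZ +%R.
Proof. by move=> a s t; apply: gammaP => x; exact: scalerDr. Qed.
Lemma gammaZDl s : {morph gammaZ^~ s : a c / a + c}.
Proof. by move=> a c; apply: gammaP => x; exact: scalerDl. Qed.
HB.instance Definition _ := GRing.Zmodule_isLmodule.Build R[i] (Gamma cX)
  gammaZA gamma1Z gammaZDr gammaZDl.

Definition gamma_sup (s : gamma) : R := sup (range (fun x => rnorm (s x))).

Lemma gamma_has_ub (s : gamma) : has_ubound (range (fun x => rnorm (s x))).
Proof.
have /compact_near_coveringP h := cX.
have {h} := h nat \oo (fun n x => rnorm (s x) < n%:R) _ _.
move=> [x _|n _ /(_ n (leqnn n)) hn]; last first.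
  by exists n%:R => _ [x _ <-]; apply/ltW/hn.
pose c := rnorm (s x) + 1.
have cO := bnorm_usc (hbundleP b) c.
have : nbhs (point b (Tagged E (s x))) [set p : b | bnorm p < c].
  by apply: open_nbhs_nbhs; split => //; rewrite /= /bnorm pointK /= ltrDl.
move=> pU; have sU : \forall y \near x, bnorm (point b (Tagged E (s y))) < c.
  exact: (@gamma_continuous _ s x _ pU).
have [N _ hN] := nbhs_infty_ger c.
exists ([set y | rnorm (s y) < c], [set n | c <= n%:R]) => /=.
  split; last by exists N.
  by apply: filterS sU => y /=; rewrite /bnorm pointK.
by case=> y n [/= h1 h2]; exact: lt_le_trans h1 h2.
Qed.

Lemma gamma_sup_ge (s : gamma) x : rnorm (s x) <= gamma_sup s.
Proof.
apply: sup_upper_bound; last by exists x.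
by split; [exists (rnorm (s x)), x|exact: gamma_has_ub].
Qed.

Lemma gamma_sup_le (s : gamma) c :
  0 <= c -> (forall x, rnorm (s x) <= c) -> gamma_sup s <= c.
Proof.
move=> c0 h; rewrite /gamma_sup.
have [->|/set0P[_ [x _ _]]] := eqVneq (range (fun x => rnorm (s x))) set0.
  by rewrite sup0.
apply: ge_sup => [|_ [y _ <-]]; last exact: h.
by exists (rnorm (s x)), x.
Qed.

Lemma gamma_sup_ge0 (s : gamma) : 0 <= gamma_sup s.
Proof.
have [h|/set0P[_ [x _ _]]] := eqVneq (range (fun x => rnorm (s x))) set0.
  by rewrite /gamma_sup h sup0.
by apply: le_trans (gamma_sup_ge s x); exact: rnorm_ge0.
Qed.

Lemma gamma_supD (s t : gamma) : gamma_sup (s + t) <= gamma_sup s + gamma_sup t.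
Proof.
apply: gamma_sup_le => [|x]; first by rewrite addr_ge0 ?gamma_sup_ge0.
by apply: le_trans (rnormD _ _) _; rewrite lerD ?gamma_sup_ge.
Qed.

Lemma gamma_supZ_le (a : R[i]) (s : gamma) :
  gamma_sup (a *: s) <= complex.Re `|a| * gamma_sup s.
Proof.
have a0 := @rnorm_ge0 R R[i]^o a.
apply: gamma_sup_le => [|x]; first by rewrite mulr_ge0 ?gamma_sup_ge0.
by rewrite rnormZ ler_wpM2l ?gamma_sup_ge.
Qed.

Definition gamma_norm (s : gamma) : R[i] := (gamma_sup s)%:C.

Lemma gamma_normD s t : gamma_norm (s + t) <= gamma_norm s + gamma_norm t.
Proof. by rewrite /gamma_norm -rmorphD lecR gamma_supD. Qed.

Lemma gamma_normZ_le (a : R[i]) s : gamma_norm (a *: s) <= `|a| * gamma_norm s.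
Proof.
rewrite normc_def /gamma_norm -rmorphM lecR.
by apply: le_trans (gamma_supZ_le _ _) _; rewrite normc_def.
Qed.

Lemma gamma_norm_ge0 s : 0 <= gamma_norm s.
Proof. by rewrite /gamma_norm lecR gamma_sup_ge0. Qed.

Lemma gamma_normZ (a : R[i]) s : gamma_norm (a *: s) = `|a| * gamma_norm s.
Proof.
apply/eqP; rewrite eq_le gamma_normZ_le andTb.
have [->|a0] := eqVneq a 0; first by rewrite normr0 mul0r gamma_norm_ge0.
have := gamma_normZ_le a^-1 (a *: s).
by rewrite scalerA mulVf// scale1r normfV ler_pdivlMl ?normr_gt0.
Qed.

Lemma gamma_norm_eq0 s : gamma_norm s = 0 -> s = 0.
Proof.
move=> /(congr1 (@complex.Re R)) /= s0; apply: gammaP => x.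
apply: rnorm_eq0; apply/eqP; rewrite eq_le rnorm_ge0 andbT.
by rewrite -s0 gamma_sup_ge.
Qed.

HB.instance Definition _ := Lmodule_isNormed.Build R[i] (Gamma cX)
  gamma_normD gamma_normZ gamma_norm_eq0.

End Sections.

Section FiniteType.
Variables (R : realType) (X : topologicalType).

Definition has_dim (V : lmodType R[i]) (d : nat) : Prop :=
  exists f : {linear V -> 'rV[R[i]]_d}, bijective f.

Variable E : X -> completeNormedModType R[i].

Definition stratum (d : nat) : set X := [set x | has_dim (E x) d].

Definition dim_le (d : nat) : set X :=
  [set x | exists2 k, (k <= d)%N & has_dim (E x) k].

Definition subhomogeneous : Prop := exists d, dim_le d = [set: X].

Variable b : hbundle E.

(* phi x and psi x are relevant only for x in U. *)
Definition trivial_over (U : set X) : Prop :=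
  exists (V : completeNormedModType R[i])
    (phi : forall x, {linear E x -> V}) (psi : forall x, V -> E x),
    [/\ forall x, U x -> cancel (phi x) (psi x) /\ cancel (psi x) (phi x),
        {within @proj _ _ _ b @^-1` U, continuous (fun p : b =>
          (proj p, phi (proj p) (tagged (coord p))) : X * V)}
      & {within U `*` [set: V], continuous (fun z : X * V =>
          point b (Tagged E (psi z.1 z.2)))}].

Definition conditionally_finite_type : Prop :=
  forall d, exists (n : nat) (U : 'I_n -> set X),
    [/\ forall i, exists2 O, open O & U i = stratum d `&` O,
        stratum d = \bigcup_i U i
      & forall i, trivial_over (U i)].

End FiniteType.

Section BoundedMaps.
Variables (R : realType) (V W : lmodType R[i]).
Variables (p : seminorm V) (q : seminorm W) (h : {linear V -> W}).

Definition seminorm_bounded : Prop :=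
  exists2 c : R, 0 <= c & forall v, q (h v) <= c * p v.

Hypothesis hb : seminorm_bounded.

Definition sep_map (x : sep p) : sep q := sep_pi q (h (sep_repr x)).

Lemma sep_mapE v : sep_map (sep_pi p v) = sep_pi q (h v).
Proof.
case: hb => c c0 hc; apply/sep_piP; rewrite -linearB.
apply/eqP; rewrite eq_le seminorm_ge0 andbT.
by apply: le_trans (hc _) _; rewrite sep_repr_pi mulr0.
Qed.

Lemma sep_map_is_linear : linear sep_map.
Proof.
move=> a; elim/sep_ind=> u; elim/sep_ind=> v.
by rewrite -linearP !sep_mapE !linearP.
Qed.

Lemma cauchy_seq_map (u : cseq p) : cauchy_seq q (fun n => h (u n)).
Proof.
case: hb => c c0 hc e e0.
have c1 : 0 < c + 1 by rewrite ltr_wpDl.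
have [N uN] := cseqP u (divr_gt0 e0 c1).
exists N => m n Nm Nn; rewrite -linearB.
apply: le_lt_trans (hc _) _.
apply: (@le_lt_trans _ _ ((c + 1) * p (u m - u n))).
  by rewrite ler_wpM2r ?seminorm_ge0 ?lerDl.
by rewrite mulrC -ltr_pdivlMr// uN.
Qed.

Definition cseq_map (u : cseq p) : cseq q := mk_cseq (cauchy_seq_map u).

Lemma cseq_map_is_linear : linear cseq_map.
Proof. by move=> a u v; apply/val_inj/funext => n; rewrite /= linearP. Qed.
HB.instance Definition _ := GRing.isLinear.Build R[i] (cseq p) (cseq q) _
  cseq_map cseq_map_is_linear.

End BoundedMaps.

Section CompletionMap.
Variables (R : realType) (V W : lmodType R[i]).
Variables (p : seminorm V) (q : seminorm W) (h : {linear V -> W}).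
Hypothesis hb : seminorm_bounded p q h.

Lemma cseq_map_bounded :
  seminorm_bounded (cseq_seminorm p) (cseq_seminorm q) (cseq_map hb).
Proof.
case: (hb) => c c0 hc; exists c => // u.
rewrite /= /cseq_norm.
have -> : c * limn (fun n => p (u n) : R^o) = limn (fun n => c * p (u n) : R^o).
  apply/esym/cvg_lim; first exact: norm_hausdorff.
  by apply: cvgMr; exact: cseq_cvg.
apply: ler_lim; [exact: cseq_cvg|apply: is_cvgMr; exact: cseq_cvg|].
by apply: nearW => n /=.
Qed.

Definition completion_map : completion p -> completion q :=
  @sep_map _ _ _ (cseq_seminorm p) (cseq_seminorm q) (cseq_map hb).

Lemma completion_map_is_linear : linear completion_map.
Proof. exact: (sep_map_is_linear cseq_map_bounded). Qed.
HB.instance Definition _ := GRing.isLinear.Build R[i] (completion p)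
  (completion q) _ completion_map completion_map_is_linear.

Lemma completion_mapE v :
  completion_map (to_completion p v) = to_completion q (h v).
Proof.
rewrite /completion_map (sep_mapE cseq_map_bounded); congr sep_pi.
exact/val_inj.
Qed.

Lemma rnorm_completion_map c : 0 <= c -> (forall v, q (h v) <= c * p v) ->
  forall x, rnorm (completion_map x) <= c * rnorm x.
Proof.
move=> c0 hc; elim/sep_ind=> u.
rewrite /completion_map (sep_mapE cseq_map_bounded) !rnorm_sep.
rewrite /= /cseq_norm.
have -> : c * limn (fun n => p (u n) : R^o) = limn (fun n => c * p (u n) : R^o).
  apply/esym/cvg_lim; first exact: norm_hausdorff.
  by apply: cvgMr; exact: cseq_cvg.
apply: ler_lim; [exact: cseq_cvg|apply: is_cvgMr; exact: cseq_cvg|].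
by apply: nearW => n /=.
Qed.

End CompletionMap.

Section TensorMap.
Variables (R : realType) (M N M' N' : normedModType R[i]).
Variables (f : {linear M -> M'}) (g : {linear N -> N'}).

Definition bilform_comp (B : bilform M' N') (m : M) (n : N) : R[i] :=
  B (f m) (g n).

Lemma bilform_comp_bilinear (B : bilform M' N') :
  bilinear_for *%R *%R (bilform_comp B).
Proof.
split=> [n a m1 m2|m a n1 n2]; rewrite /bilform_comp linearP.
  by rewrite linearPl.
by rewrite linearPr.
Qed.
HB.instance Definition _ (B : bilform M' N') :=
  bilinear_isBilinear.Build R[i] M N R[i] *%R *%R (bilform_comp B)
    (bilform_comp_bilinear B).

Definition atensor_map_fun (u : bilform M N -> R[i]^o) : bilform M' N' -> R[i]^o :=
  fun B => u (bilform_comp B).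

Definition map_pairs (s : seq (M * N)) := [seq (f z.1, g z.2) | z <- s].

Lemma tensor_sum_map s :
  atensor_map_fun (tensor_sum s) = tensor_sum (map_pairs s).
Proof.
apply/funext => B; rewrite /atensor_map_fun /tensor_sum big_map !fct_sumE.
by apply: eq_bigr.
Qed.

Lemma atensor_map_in (u : atensor M N) :
  atensor_map_fun u \in @atensor_pred R M' N'.
Proof.
case: u => u /= /asboolP[s ->]; rewrite tensor_sum_map; exact: tensor_sum_in.
Qed.

Definition atensor_map (u : atensor M N) : atensor M' N' :=
  ATensor (atensor_map_in u).

Lemma atensor_map_is_linear : linear atensor_map.
Proof. by move=> a u v; apply/val_inj/funext => B. Qed.
HB.instance Definition _ := GRing.isLinear.Build R[i] (atensor M N)
  (atensor M' N') _ atensor_map atensor_map_is_linear.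

Lemma atensor_mapE s : atensor_map (atensor_of s) = atensor_of (map_pairs s).
Proof. by apply/val_inj; rewrite /= tensor_sum_map. Qed.

Definition rnorm_bounded (V W : normedModType R[i]) (h : V -> W) : Prop :=
  exists2 c : R, 0 <= c & forall v, rnorm (h v) <= c * rnorm v.

Lemma atensor_map_le c d : 0 <= c -> 0 <= d ->
  (forall m, rnorm (f m) <= c * rnorm m) ->
  (forall n, rnorm (g n) <= d * rnorm n) ->
  forall u, proj_norm (atensor_map u) <= c * d * proj_norm u.
Proof.
move=> c0 d0 hc hd u; apply/ler_addgt0Pl => e e0.
have cd1 : 0 < c * d + 1 by rewrite ltr_wpDl ?mulr_ge0.
have [s -> hs] := proj_norm_approx u (divr_gt0 e0 cd1).
rewrite atensor_mapE; apply: le_trans (proj_norm_le _) _.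
apply: (@le_trans _ _ (c * d * proj_sum s)).
  rewrite /proj_sum big_map mulr_sumr; apply: ler_sum => z _ /=.
  by rewrite mulrACA; apply: ler_pM => //; exact: rnorm_ge0.
apply: le_trans (ler_wpM2l (mulr_ge0 c0 d0) (ltW hs)) _.
rewrite mulrDr addrC lerD2r mulrCA ler_piMr ?ltW//.
by rewrite ltr_pdivrMr// mul1r ltrDl.
Qed.

Hypothesis (fb : rnorm_bounded f) (gb : rnorm_bounded g).

Lemma atensor_map_bounded :
  seminorm_bounded (proj_seminorm M N) (proj_seminorm M' N') atensor_map.
Proof.
case: fb gb => c c0 hc [d d0 hd]; exists (c * d); first exact: mulr_ge0.
exact: atensor_map_le.
Qed.

Definition ptensor_map : ptensor M N -> ptensor M' N' :=
  completion_map atensor_map_bounded.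
HB.instance Definition _ := GRing.Linear.on ptensor_map.

Lemma ptensor_mapE m n : ptensor_map (tensor m n) = tensor (f m) (g n).
Proof.
rewrite /ptensor_map completion_mapE; congr to_completion.
exact: (atensor_mapE [:: (m, n)]).
Qed.

Lemma rnorm_ptensor_map c d : 0 <= c -> 0 <= d ->
  (forall m, rnorm (f m) <= c * rnorm m) ->
  (forall n, rnorm (g n) <= d * rnorm n) ->
  forall u, rnorm (ptensor_map u) <= c * d * rnorm u.
Proof.
move=> c0 d0 hc hd; apply: rnorm_completion_map; first exact: mulr_ge0.
exact: atensor_map_le.
Qed.

Lemma ptensor_map_bounded : rnorm_bounded ptensor_map.
Proof.
case: fb gb => c c0 hc [d d0 hd]; exists (c * d); first exact: mulr_ge0.
exact: rnorm_ptensor_map.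
Qed.

End TensorMap.

Section ClosedSpan.
Variables (R : realType) (V : normedModType R[i]) (S : set V).

Definition lspan : set V := [set v | exists s : seq (R[i] * V),
  (forall z, z \in s -> S z.2) /\ v = \sum_(z <- s) z.1 *: z.2].

Definition cspan : set V := closure lspan.

Lemma cspanP v : cspan v <->
  forall e : R, 0 < e -> exists2 w, lspan w & rnorm (v - w) < e.
Proof.
split=> [h e e0|h B].
  have [|w [Sw vw]] := h (ball v e%:C); first by apply: nbhsx_ballx; rewrite ltcR.
  by exists w => //; move: vw; rewrite -ball_normE /= rnormE ltcR.
move=> /nbhs_ballP[e /= /gt0_complexE[-> e0] eB].
have [w Sw vw] := h _ e0; exists w; split => //; apply: eB.
by rewrite -ball_normE /= rnormE ltcR.
Qed.

Lemma lspan0 : lspan 0.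
Proof. by exists [::]; split => //; rewrite big_nil. Qed.

Lemma lspanD v w : lspan v -> lspan w -> lspan (v + w).
Proof.
move=> [s [sS ->]] [t [tS ->]]; exists (s ++ t); split; last by rewrite big_cat.
by move=> z; rewrite mem_cat => /orP[/sS|/tS].
Qed.

Lemma lspanZ a v : lspan v -> lspan (a *: v).
Proof.
move=> [s [sS ->]]; exists [seq (a * z.1, z.2) | z <- s]; split.
  by move=> _ /mapP[z /sS zS ->].
by rewrite big_map scaler_sumr; apply: eq_bigr => z _; rewrite scalerA.
Qed.

Lemma sub_cspan : S `<=` cspan.
Proof.
move=> v Sv; apply: subset_closure; exists [:: (1, v)]; split.
  by move=> z; rewrite inE => /eqP ->.
by rewrite big_seq1 scale1r.
Qed.

Lemma cspan0 : cspan 0.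
Proof. exact/subset_closure/lspan0. Qed.

Lemma cspanD v w : cspan v -> cspan w -> cspan (v + w).
Proof.
move=> /cspanP vS /cspanP wS; apply/cspanP => e e0.
have e2 : 0 < e / 2 by rewrite divr_gt0.
have [v' Sv' hv] := vS _ e2; have [w' Sw' hw] := wS _ e2.
exists (v' + w'); first exact: lspanD.
have := rnormD (v - v') (w - w'); rewrite addrACA -opprD; lra.
Qed.

Lemma cspanZ a v : cspan v -> cspan (a *: v).
Proof.
move=> /cspanP vS; apply/cspanP => e e0.
have a0 := @rnorm_ge0 R R[i]^o a; rewrite /rnorm in a0.
have a1 : 0 < complex.Re `|a| + 1 by exact: ltr_wpDl.
have [w Sw hw] := vS _ (divr_gt0 e0 a1); exists (a *: w); first exact: lspanZ.
rewrite -scalerBr rnormZ.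
apply: (@le_lt_trans _ _ ((complex.Re `|a| + 1) * rnorm (v - w))).
  by rewrite ler_wpM2r ?rnorm_ge0 ?lerDl.
by rewrite mulrC -ltr_pdivlMr.
Qed.

Definition cspan_dists (v : V) : set R := [set rnorm (v - w) | w in cspan].

Definition cspan_dist (v : V) : R := inf (cspan_dists v).

Lemma cspan_dists_inf v : has_inf (cspan_dists v).
Proof.
split; first by exists (rnorm (v - 0)), 0 => //; exact: cspan0.
by exists 0 => _ [w _ <-]; exact: rnorm_ge0.
Qed.

Lemma cspan_dist_le v w : cspan w -> cspan_dist v <= rnorm (v - w).
Proof. by move=> Sw; apply: ge_inf; [case: (cspan_dists_inf v)|exists w]. Qed.

Lemma cspan_dist_approx v (e : R) : 0 < e ->
  exists2 w, cspan w & rnorm (v - w) < cspan_dist v + e.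
Proof.
by move=> e0; have [_ [w Sw <-] h] := inf_adherent e0 (cspan_dists_inf v);
  exists w.
Qed.

Lemma cspan_dist_ge0 v : 0 <= cspan_dist v.
Proof.
apply: lb_le_inf; first by case: (cspan_dists_inf v).
by move=> _ [w _ <-]; exact: rnorm_ge0.
Qed.

Lemma cspan_distD v w : cspan_dist (v + w) <= cspan_dist v + cspan_dist w.
Proof.
apply/ler_addgt0Pl => e e0.
have e2 : 0 < e / 2 by rewrite divr_gt0.
have [v' Sv hv] := cspan_dist_approx v e2.
have [w' Sw hw] := cspan_dist_approx w e2.
have := cspan_dist_le (v + w) (cspanD Sv Sw).
have := rnormD (v - v') (w - w'); rewrite addrACA -opprD; lra.
Qed.

Lemma cspan_distZ_le a v : cspan_dist (a *: v) <= complex.Re `|a| * cspan_dist v.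
Proof.
have a0 : 0 <= complex.Re `|a| by exact: (@rnorm_ge0 R R[i]^o).
apply/ler_addgt0Pl => e e0.
have a1 : 0 < complex.Re `|a| + 1 by exact: ltr_wpDl.
have [w Sw hw] := cspan_dist_approx v (divr_gt0 e0 a1).
have h1 := cspan_dist_le (a *: v) (@cspanZ a _ Sw).
apply: le_trans h1 _; rewrite -scalerBr rnormZ.
apply: le_trans (ler_wpM2l a0 (ltW hw)) _.
rewrite mulrDr addrC lerD2r mulrCA ler_piMr ?ltW//.
by rewrite ltr_pdivrMr// mul1r ltrDl.
Qed.

Lemma cspan_distZ (a : R[i]) v :
  cspan_dist (a *: v) = complex.Re `|a| * cspan_dist v.
Proof.
apply/eqP; rewrite eq_le cspan_distZ_le andTb.
have [->|a0] := eqVneq a 0; first by rewrite normr0 mul0r cspan_dist_ge0.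
have na0 : 0 < complex.Re `|a|.
  by have := normr_gt0 a; rewrite a0 normc_def ltcE /= => /andP[].
have := cspan_distZ_le a^-1 (a *: v); rewrite scalerA mulVf// scale1r.
have -> : complex.Re `|a^-1| = (complex.Re `|a|)^-1.
  by rewrite normfV normc_def -fmorphV.
by rewrite mulrC ler_pdivlMr// mulrC.
Qed.

Definition cspan_seminorm : seminorm V := Seminorm cspan_distD cspan_distZ.

(* V modulo the closed linear span of S, with the quotient norm. *)
Definition cspan_quot : normedModType R[i] := sep cspan_seminorm.

Definition cspan_pi (v : V) : cspan_quot := sep_pi cspan_seminorm v.
Lemma cspan_pi_is_linear : linear cspan_pi.
Proof. exact: (@sep_pi_is_linear R V cspan_seminorm). Qed.
HB.instance Definition _ :=
  GRing.isLinear.Build R[i] V cspan_quot _ cspan_pi cspan_pi_is_linear.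

Lemma cspan_pi_eq0 v : cspan_pi v = 0 <-> cspan v.
Proof.
rewrite -[0]/(sep_pi cspan_seminorm 0) /cspan_pi; split.
  move=> /sep_piP; rewrite subr0 => v0; apply/cspanP => e e0.
  have e2 : 0 < e / 2 by rewrite divr_gt0.
  have [w /cspanP Sw] := cspan_dist_approx v e2.
  rewrite [cspan_dist v]v0 => hw; have [u Su hu] := Sw _ e2.
  exists u => //; have := rnormD (v - w) (w - u); rewrite addrA subrK; lra.
move=> Sv; apply/sep_piP; rewrite subr0; apply/eqP.
rewrite eq_le seminorm_ge0 andbT.
by apply: le_trans (cspan_dist_le v Sv) _; rewrite subrr /rnorm normr0.
Qed.

Section Lift.
Variables (W : normedModType R[i]) (h : {linear V -> W}).
Hypotheses (hb : rnorm_bounded h) (hS : forall v, S v -> h v = 0).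

Lemma cspan_ker v : cspan v -> h v = 0.
Proof.
case: hb => c c0 hc /cspanP Sv; apply: rnorm_eq0; apply/eqP.
rewrite eq_le rnorm_ge0 andbT; apply/ler_addgt0Pl => e e0; rewrite addr0.
have c1 : 0 < c + 1 by rewrite ltr_wpDl.
have [w [s [sS ->]] hw] := Sv _ (divr_gt0 e0 c1).
rewrite -[v](subrK (\sum_(z <- s) z.1 *: z.2)) linearD [X in _ + X](_ : _ = 0).
  rewrite addr0; apply: le_trans (hc _) _.
  apply: (@le_trans _ _ ((c + 1) * (e / (c + 1)))).
    by apply: ler_pM => //; [exact: rnorm_ge0|rewrite lerDl|exact: ltW].
  by rewrite mulrC divfK ?gt_eqF.
rewrite linear_sum big_seq big1// => z /sS /hS hz.
by rewrite linearZ /= hz scaler0.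
Qed.

Definition cspan_lift (q : cspan_quot) : W := h (sep_repr q).

Lemma cspan_liftE v : cspan_lift (cspan_pi v) = h v.
Proof.
apply/eqP; rewrite -subr_eq0 -linearB; apply/eqP/cspan_ker/cspan_pi_eq0.
by rewrite linearB /= /cspan_pi sep_reprK subrr.
Qed.

Lemma cspan_lift_is_linear : linear cspan_lift.
Proof.
move=> a; elim/sep_ind=> u; elim/sep_ind=> v.
by rewrite -linearP -!/(cspan_pi _) !cspan_liftE linearP.
Qed.

Lemma cspan_lift_le c : 0 <= c -> (forall v, rnorm (h v) <= c * rnorm v) ->
  forall q, rnorm (cspan_lift q) <= c * rnorm q.
Proof.
move=> c0 hc; elim/sep_ind=> v; rewrite -/(cspan_pi v) cspan_liftE rnorm_sep.
apply/ler_addgt0Pl => e e0.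
have c1 : 0 < c + 1 by rewrite ltr_wpDl.
have [w Sw hw] := cspan_dist_approx v (divr_gt0 e0 c1).
have -> : h v = h (v - w) by rewrite linearB (cspan_ker Sw) subr0.
apply: le_trans (hc _) _; apply: le_trans (ler_wpM2l c0 (ltW hw)) _.
rewrite mulrDr addrC lerD2r mulrCA ler_piMr ?ltW//.
by rewrite ltr_pdivrMr// mul1r ltrDl.
Qed.

End Lift.

End ClosedSpan.

Section UniformLimit.
Variables (R : realType) (X : topologicalType) (E : X -> completeNormedModType R[i]).
Variable b : hbundle E.

Lemma tube_nbhs x (v : E x) (W : set b) : nbhs (point b (Tagged E v)) W ->
  exists A U e, [/\ nbhs (point b (Tagged E v)) A, nbhs x U, 0 < e &
    forall y (w h : E y), A (point b (Tagged E w)) -> U y -> rnorm h < e ->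
      W (point b (Tagged E (w + h)))].
Proof.
move=> vW; have := @badd_near _ _ _ b x v 0 W; rewrite addr0.
move=> /(_ vW)[[A B] /= [vA xB] AB].
have [U [e [xU e0 UB]]] := (nbhs_bzero (hbundleP b) x B).1 xB.
exists A, U, e; split => // y w h Aw Uy he.
rewrite -baddE; apply: (AB (_, _)) => /=; last by rewrite /proj !pointK.
by split => //; apply: UB; rewrite /tube /= /proj /bnorm pointK.
Qed.

Lemma continuous_section_limit (s : forall x, E x) :
  (forall e : R, 0 < e -> exists2 t, continuous_section b t &
     forall x, rnorm (s x - t x) <= e) -> continuous_section b s.
Proof.
move=> st x W /tube_nbhs[A [U [e [xA xU e0 AUW]]]].
have [A' [U' [e' [xA' xU' e'0 AUA]]]] := tube_nbhs (nbhs_interior xA).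
pose d := Num.min e e' / 2.
have m0 : 0 < Num.min e e' by rewrite lt_min e0 e'0.
have d0 : 0 < d by rewrite divr_gt0.
have de : d < Num.min e e' by rewrite ltr_pdivrMr// ltr_pMr// ltr1n.
have {de}[de de'] : d < e /\ d < e' by move: de; rewrite lt_min => /andP[].
have [t tc std] := st d d0.
have tA : nbhs (point b (Tagged E (t x))) A.
  rewrite -[t x](subrK (s x)) addrC; apply: AUA.
  - exact: nbhs_singleton.
  - exact: nbhs_singleton.
  - by rewrite rnormB; exact: le_lt_trans (std x) de'.
have tA' : \forall y \near x, A (point b (Tagged E (t y))) by exact: (tc x A).
suff : \forall y \near x, W (point b (Tagged E (s y))) by [].
apply: filterS2 tA' xU => y Aty Uy.
rewrite -[s y](subrK (t y)) addrC; apply: AUW => //.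
exact: le_lt_trans (std y) de.
Qed.

End UniformLimit.

Section BalancedTensor.
Variables (R : realType) (A : Type) (M N : normedModType R[i]).
Variables (actM : A -> M -> M) (actN : A -> N -> N).

(* M (x)_A N: the projective tensor product modulo the closed span of the
   elements fm (x) n - m (x) fn. *)
Definition balancing_relations : set (ptensor M N) :=
  [set u | exists f m n, u = tensor (actM f m) n - tensor m (actN f n)].

Definition balanced_tensor : normedModType R[i] :=
  cspan_quot balancing_relations.

Definition balanced_of (m : M) (n : N) : balanced_tensor :=
  cspan_pi balancing_relations (tensor m n).

Lemma balanced_dense (q : balanced_tensor) (e : R) : 0 < e ->
  exists l : seq (M * N), rnorm (q - \sum_(z <- l) balanced_of z.1 z.2) <= e.
Proof.
move=> e0; elim/sep_ind: q => w; rewrite -/(cspan_pi _ w).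
have [u wu] := completion_dense w e0.
case: u wu => u' u'P; have /asboolP[l ul] := u'P.
rewrite (_ : ATensor u'P = atensor_of l); last exact: val_inj.
move=> wl; exists l.
have -> : \sum_(z <- l) balanced_of z.1 z.2 =
    cspan_pi balancing_relations (to_completion (proj_seminorm M N) (atensor_of l)).
  rewrite atensor_of_sum !linear_sum.
  by apply: eq_bigr => -[m n] _.
rewrite -linearB; apply: le_trans wl.
rewrite rnorm_sep; apply: le_trans (cspan_dist_le _ (cspan0 _)) _.
by rewrite subr0.
Qed.

End BalancedTensor.

Section Canonical.
Variables (R : realType) (X : topologicalType) (cX : compact [set: X]).

Definition CX : Type := continuousType X R[i]^o.

Definition Gamma_mul (E : X -> completeNormedModType R[i]) (b : hbundle E)
    (f : CX) (s : Gamma b cX) : Gamma b cX :=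
  GammaSection cX (@section_mul _ _ cX _ b f s (@cts_fun _ _ f)).

Lemma Gamma_eval_is_linear (E : X -> completeNormedModType R[i]) (b : hbundle E)
  (x : X) : linear (fun s : Gamma b cX => s x).
Proof. by []. Qed.

Definition Gamma_eval (E : X -> completeNormedModType R[i]) (b : hbundle E)
  (x : X) (s : Gamma b cX) : E x := s x.
HB.instance Definition _ (E : X -> completeNormedModType R[i]) (b : hbundle E)
  (x : X) := GRing.isLinear.Build R[i] (Gamma b cX) (E x) _ (@Gamma_eval E b x)
  (@Gamma_eval_is_linear E b x).

Lemma rnorm_Gamma (E : X -> completeNormedModType R[i]) (b : hbundle E)
  (s : Gamma b cX) : rnorm s = gamma_sup s.
Proof. by []. Qed.

Lemma Gamma_eval_le (E : X -> completeNormedModType R[i]) (b : hbundle E) x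
  (s : Gamma b cX) : rnorm (Gamma_eval x s) <= 1 * rnorm s.
Proof. by rewrite mul1r rnorm_Gamma; exact: gamma_sup_ge. Qed.

Lemma Gamma_eval_bounded (E : X -> completeNormedModType R[i]) (b : hbundle E) x :
  rnorm_bounded (@Gamma_eval E b x).
Proof. by exists 1 => //; exact: Gamma_eval_le. Qed.

Variables (E F : X -> completeNormedModType R[i]) (bE : hbundle E) (bF : hbundle F).

Definition Gamma_tensor : normedModType R[i] :=
  balanced_tensor (@Gamma_mul E bE) (@Gamma_mul F bF).

Definition Gamma_tensor_of (s : Gamma bE cX) (t : Gamma bF cX) : Gamma_tensor :=
  balanced_of (@Gamma_mul E bE) (@Gamma_mul F bF) s t.

Definition tensor_eval (x : X) : ptensor (Gamma bE cX) (Gamma bF cX) ->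
    ptensor (E x) (F x) :=
  ptensor_map (@Gamma_eval_bounded E bE x) (@Gamma_eval_bounded F bF x).

HB.instance Definition _ x := GRing.Linear.on (tensor_eval x).

Lemma tensor_evalE x (s : Gamma bE cX) (t : Gamma bF cX) :
  tensor_eval x (tensor s t) = tensor (s x) (t x).
Proof. exact: ptensor_mapE. Qed.

Lemma tensor_eval_le x u : rnorm (tensor_eval x u) <= 1 * rnorm u.
Proof.
rewrite -[X in X * _](mulr1 1).
apply: rnorm_ptensor_map => //; exact: Gamma_eval_le.
Qed.

Lemma tensor_eval_bounded x : rnorm_bounded (tensor_eval x).
Proof. by exists 1 => //; exact: tensor_eval_le. Qed.

Lemma tensor_eval_relations x u :
  balancing_relations (@Gamma_mul E bE) (@Gamma_mul F bF) u -> tensor_eval x u = 0.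
Proof.
move=> [f [s [t ->]]]; rewrite linearB /= !tensor_evalE; apply/eqP.
rewrite subr_eq0 /tensor; apply/eqP; congr to_completion; apply/val_inj => /=.
rewrite /tensor_sum !big_seq1; apply/funext => B; rewrite /alg_tensor /=.
by rewrite linearZl_LR linearZr.
Qed.

(* The map induced at x by s (x) t |-> s x (x) t x. *)
Definition Gamma_tensor_eval (x : X) : Gamma_tensor -> ptensor (E x) (F x) :=
  @cspan_lift R (ptensor (Gamma bE cX) (Gamma bF cX))
    (balancing_relations (@Gamma_mul E bE) (@Gamma_mul F bF))
    (ptensor (E x) (F x)) (tensor_eval x : {linear _ -> _}).

Lemma Gamma_tensor_evalE x (s : Gamma bE cX) (t : Gamma bF cX) :
  Gamma_tensor_eval x (Gamma_tensor_of s t) = tensor (s x) (t x).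
Proof.
rewrite -tensor_evalE; apply: cspan_liftE; first exact: tensor_eval_bounded.
exact: tensor_eval_relations.
Qed.

Lemma Gamma_tensor_eval_is_linear x : linear (Gamma_tensor_eval x).
Proof.
apply: cspan_lift_is_linear; first exact: tensor_eval_bounded.
exact: tensor_eval_relations.
Qed.
HB.instance Definition _ x := GRing.isLinear.Build R[i] Gamma_tensor
  (ptensor (E x) (F x)) _ (Gamma_tensor_eval x) (Gamma_tensor_eval_is_linear x).

Lemma Gamma_tensor_eval_le x q : rnorm (Gamma_tensor_eval x q) <= rnorm q.
Proof.
rewrite -[leRHS]mul1r; apply: cspan_lift_le => //; first exact: tensor_eval_bounded.
  exact: tensor_eval_relations.
exact: tensor_eval_le.
Qed.

(* The fibers, with their norms, are fixed by the type of G; the condition is on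
   the topology of G, which it determines, the axioms of an (H) bundle being
   part of hbundle. *)
Definition is_tensor_bundle (G : hbundle (fun x => ptensor (E x) (F x))) : Prop :=
  forall s t, continuous_section bE s -> continuous_section bF t ->
    continuous_section G (fun x => tensor (s x) (t x)).

Variable G : hbundle (fun x => ptensor (E x) (F x)).
Hypothesis tG : is_tensor_bundle G.

Lemma Gamma_tensor_eval_continuous q :
  continuous_section G (fun x => Gamma_tensor_eval x q).
Proof.
apply: continuous_section_limit => e e0.
have [l ql] := balanced_dense q e0.
exists (fun x => Gamma_tensor_eval x (\sum_(z <- l) Gamma_tensor_of z.1 z.2)).
  elim: l {ql} => [|[s t] l IH].
    rewrite big_nil.
    rewrite (_ : (fun x => _) = fun x => 0); first exact: section0.
    by apply/functional_extensionality_dep => x; rewrite linear0.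
  pose a : Gamma G cX := GammaSection cX (tG (@gamma_continuous _ _ _ _ _ s)
    (@gamma_continuous _ _ _ _ _ t)).
  pose c : Gamma G cX := GammaSection cX IH.
  rewrite (_ : (fun x => _) = fun x => a x + c x); first exact: sectionD.
  apply/functional_extensionality_dep => x.
  rewrite big_cons linearD; congr (_ + _); exact: Gamma_tensor_evalE.
move=> x; rewrite -linearB.
exact: le_trans (Gamma_tensor_eval_le _ _) ql.
Qed.

Definition canonical_morphism (q : Gamma_tensor) : Gamma G cX :=
  GammaSection cX (@Gamma_tensor_eval_continuous q).

Lemma canonical_morphismE s t x :
  canonical_morphism (Gamma_tensor_of s t) x = tensor (s x) (t x).
Proof. exact: Gamma_tensor_evalE. Qed.

Lemma canonical_morphism_is_linear : linear canonical_morphism.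
Proof. by move=> a q r; apply: gammaP => x; exact: linearP. Qed.

Lemma canonical_morphism_le q : rnorm (canonical_morphism q) <= rnorm q.
Proof.
rewrite rnorm_Gamma; apply: gamma_sup_le; first exact: rnorm_ge0.
by move=> x; exact: Gamma_tensor_eval_le.
Qed.

End Canonical.

Arguments canonical_morphism {R X} cX {E F bE bF G} tG q.

(* Main.v *)
(* The canonical map is contractive and its range is dense (a partition of unity
   glues finite tensors of sections, of which there are enough), so everything
   rests on a bound |u| <= C sup_x |u(x)| for finite tensors u = sum s_i (x) t_i,
   with C independent of u.  The bound is proved by induction on the closed sets
   {x : dim E_x < n}.  Off any neighborhood of it, {dim E_x = n} is compact
   and covered by finitely many open sets over which E is trivial, their number
   depending only on n; on each of them a continuous version of the Gram-Schmidt
   process yields sections e_1, ..., e_n of norm at most 1 whose coordinate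
   functionals are bounded by 3^n.  Writing s_i = sum_j c_ij e_j turns u into
   sum_j e_j (x) (sum_i c_ij t_i) up to a small error, and the norm of
   sum_i c_ij(x) t_i(x), a slice of u(x), is at most 3^n |u(x)|.
   The existence of enough sections is the theorem of Douady and dal
   Soglio-Herault, proved by correcting "almost continuous" sections.
   The map is injective by the bound, and surjective because the balanced tensor
   product is complete. *)

From HB Require Import structures.
From mathcomp Require Import all_boot all_order all_algebra.
From mathcomp Require Import all_classical all_reals all_analysis.
From mathcomp Require Import borel_hierarchy complex ring lra.
Require Import Defs.
Set Implicit Arguments. Unset Strict Implicit. Unset Printing Implicit Defensive.
Import Order.TTheory GRing.Theory Num.Theory.
Import numFieldNormedType.Exports.
Local Open Scope classical_set_scope.
Local Open Scope ring_scope.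
Local Open Scope complex_scope.

(** * Norms and limits *)

(** The norm of the balanced tensor product is an infimum over representations, and no fibrewise
    quantity visibly controls it. It is bounded here by exhibiting a representation whose number of
    terms does not depend on the length of the given sum. Two obstacles shape the argument.
    Trivializations may degenerate towards the boundary of a stratum, so the bases they provide
    carry no uniform bounds; orthogonalising them against the fibre norms restores bounds that
    depend on the dimension alone. And estimates known on a closed set are needed on an open set,
    where they can be multiplied by cutoffs: there the continuity of the norm enters, a strict bound
    on the norm of a section being an open condition. The open set so obtained depends on u while
    the constant must not, whence the order of the quantifiers in [bounded_near]. The factors enter
    differently: E is expanded in frames, and the coefficients of the expansion are slices with
    values in F. *)

Lemma rnorm0 (R : realType) (V : normedModType R[i]) : rnorm (0 : V) = 0.
Proof. by rewrite /rnorm normr0. Qed.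

Lemma rnormZr (R : realType) (V : normedModType R[i]) (r : R) (v : V) : 0 <= r ->
  rnorm (r%:C *: v) = r * rnorm v.
Proof. by move=> r0; rewrite rnormZ ger0_norm ?lecR. Qed.

Lemma rnorm_sum (R : realType) (V : normedModType R[i]) (I : Type) (l : seq I) (f : I -> V) :
  rnorm (\sum_(i <- l) f i) <= \sum_(i <- l) rnorm (f i).
Proof.
elim: l => [|i l IH]; first by rewrite !big_nil rnorm0.
by rewrite !big_cons; apply: le_trans (rnormD _ _) _; rewrite lerD2l.
Qed.

(** Since the weights sum to 1, s is the same convex combination of copies of itself. Only indices
    of nonzero weight are constrained, because in a partition of unity [t i] is controlled only
    where [h i] does not vanish. *)
Lemma convex_dist (R : realType) (V : normedModType R[i]) n (h : 'I_n -> R) (t : 'I_n -> V)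
    (s : V) (e : R) : (forall i, 0 <= h i) -> \sum_i h i = 1 ->
  (forall i, h i != 0 -> rnorm (s - t i) <= e) ->
  rnorm (s - \sum_i (h i)%:C *: t i) <= e.
Proof.
move=> h0 h1 hst.
have -> : s - \sum_i (h i)%:C *: t i = \sum_i (h i)%:C *: (s - t i).
  under [in RHS]eq_bigr do rewrite scalerBr.
  by rewrite sumrB -scaler_suml -rmorph_sum h1 scale1r.
apply: le_trans (rnorm_sum _ _) _.
rewrite -[leRHS]mul1r -h1 mulr_suml; apply: ler_sum => i _.
rewrite rnormZr//; have [->|hi] := eqVneq (h i) 0; first by rewrite !mul0r.
by rewrite ler_wpM2l ?hst.
Qed.

Lemma rnorm_dist (R : realType) (V : normedModType R[i]) (u v : V) :
  `|rnorm u - rnorm v| <= rnorm (u - v).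
Proof.
have h1 := rnormD (u - v) v; have h2 := rnormD (v - u) u.
rewrite !subrK in h1 h2; rewrite (rnormB v u) in h2.
by rewrite ler_norml; apply/andP; split; lra.
Qed.

Lemma realC_continuous (R : realType) :
  continuous ((fun r : R => r%:C) : R -> R[i]^o).
Proof.
move=> r; apply/cvg_ballP => e /gt0_complexE[-> e0]; rewrite /=.
have : \forall s \near r, `|r - s| < complex.Re e.
  by apply: (@cvgr_dist_lt _ _ _ (nbhs r) _ id r) => //; exact: cvg_id.
apply: filterS => s rs; rewrite -ball_normE /=.
by rewrite -rmorphB normc_def /= expr0n addr0 sqrtr_sqr ltcR.
Qed.

Lemma realC_comp_continuous (R : realType) (X : topologicalType) (h : X -> R) :
  continuous h -> continuous ((fun x => (h x)%:C) : X -> R[i]^o).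
Proof.
move=> hc x; apply: (@cvg_comp _ _ _ h (fun r : R => r%:C : R[i]^o)); first exact: hc.
exact: realC_continuous.
Qed.

Lemma rnorm_tri (R : realType) (V : normedModType R[i]) (u v w : V) :
  rnorm (u - w) <= rnorm (u - v) + rnorm (v - w).
Proof. by have := rnormD (u - v) (v - w); rewrite addrA subrK. Qed.

Lemma rnorm_limit (R : realType) (V : completeNormedModType R[i]) (u : nat -> V)
    (r : nat -> R) : (forall n k, rnorm (u n - u (n + k)%N) <= r n) ->
  (forall e : R, 0 < e -> exists n, r n < e) ->
  exists l, forall n, rnorm (u n - l) <= r n.
Proof.
move=> ur re.
have cu : cvgn u.
  apply: cauchy_cvg; apply: cauchy_exP => e /gt0_complexE[-> e0].
  have [N rN] := re _ e0; exists (u N); exists N => // n /= Nn.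
  rewrite -ball_normE /= rnormE ltcR -(subnKC Nn).
  exact: le_lt_trans (ur _ _) rN.
have [l ul] := (cvg_ex _).1 cu; exists l => n.
apply/ler_addgt0Pl => e e0.
have : \forall m \near \oo, ball l e%:C (u m).
  by apply: ul; apply: nbhsx_ballx; rewrite ltcR.
move=> [N _ /(_ (n + N)%N (leq_addl _ _))].
rewrite -ball_normE /= rnormE ltcR => h.
rewrite -[u n](subrK (u (n + N)%N)) -addrA; apply: le_trans (rnormD _ _) _.
have := ur n N; have := rnormB l (u (n + N)%N); lra.
Qed.

Lemma geometric_small (R : realType) (M e : R) : 0 < e -> exists n, M / 2 ^+ n < e.
Proof.
move=> e0; have M0 : 0 < `|M| + 1 by rewrite ltr_wpDl.
have Me : 0 < e / (`|M| + 1) by rewrite divr_gt0.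
have [N _ hN] := @near_infty_natSinv_lt R (PosNum Me).
have := hN N (leqnn N); rewrite /= => h; exists N.
have N2 : (N.+1%:R : R) <= 2 ^+ N.
  elim: (N) => [|n IH]; first by rewrite expr0.
  by rewrite exprS -[n.+2]addn1 natrD; have : (1 : R) <= n.+1%:R; [rewrite ler1n|lra].
have p0 : 0 < (2 : R) ^+ N by rewrite exprn_gt0.
apply: (@le_lt_trans _ _ ((`|M| + 1) / 2 ^+ N)).
  by rewrite ler_pM2r ?invr_gt0//; have := ler_norm M; lra.
move: h; rewrite ltr_pdivlMr// mulrC; apply: le_lt_trans.
by rewrite ler_pM2l// lef_pV2 ?posrE.
Qed.

Lemma geometric_limit (R : realType) (V : completeNormedModType R[i]) (u : nat -> V)
    (M : R) : 0 < M -> (forall n, rnorm (u n - u n.+1) <= M / 2 ^+ n) ->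
  exists l, forall n, rnorm (u n - l) <= 2 * (M / 2 ^+ n).
Proof.
move=> M0 uS; pose r n : R := M / 2 ^+ n.
have r0 n : 0 < r n by rewrite divr_gt0// exprn_gt0.
have rS n : r n = 2 * r n.+1 by rewrite /r exprS invfM; field.
(* The geometric tail telescopes because [r n = 2 * r n.+1]. *)
have uD n k : rnorm (u n - u (n + k)%N) <= 2 * r n - 2 * r (n + k)%N.
  elim: k => [|k IH]; first by rewrite addn0 !subrr rnorm0.
  rewrite addnS; have := rnorm_tri (u n) (u (n + k)%N) (u (n + k).+1).
  by have := uS (n + k)%N; rewrite -/(r _); have := rS (n + k)%N; lra.
apply: rnorm_limit => [n k|e e0].
  by apply: le_trans (uD n k) _; rewrite gerBl mulr_ge0// ltW.
have e2 : 0 < e / 2 by rewrite divr_gt0.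
by have [n hn] := geometric_small M e2; exists n; lra.
Qed.

Lemma near_all (T : eqType) (X : topologicalType) (l : seq T) (x : X) (P : T -> X -> Prop) :
  (forall z, z \in l -> \forall y \near x, P z y) ->
  \forall y \near x, forall z, z \in l -> P z y.
Proof.
elim: l => [|z l IH] h; first exact: nearW.
have h1 := h z (mem_head _ _).
have h2 := IH (fun u ul => h u (mem_behead (s := z :: l) ul)).
by apply: filterS2 h1 h2 => y Pz Pl u; rewrite inE => /orP[/eqP->|/Pl].
Qed.

(** * Partitions of unity *)

Section PartitionOfUnity.
Variables (R : realType) (X : topologicalType).
Hypotheses (cX : compact [set: X]) (hX : hausdorff_space X).

Lemma continuous_fsum (n : nat) (V : normedModType R) (f : 'I_n -> X -> V) :
  (forall i, continuous (f i)) -> continuous (fun x => \sum_(i < n) f i x).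
Proof.
move=> fc; elim: n f fc => [|n IH] f fc.
  rewrite (_ : (fun x => _) = fun=> 0); first by move=> x; exact: cvg_cst.
  by apply/funext => x; rewrite big_ord0.
rewrite (_ : (fun x => _) =
    (fun x => \sum_(i < n) f (widen_ord (leqnSn n) i) x) \+ f ord_max).
  by move=> x; apply: cvgD; [apply: IH|exact: fc].
by apply/funext => x; rewrite big_ord_recr.
Qed.

(** Near-covering compactness is applied to the filter on lists generated by the families of all
    lists containing a given one; being covered by the members of a list is then an eventual
    property. *)
Lemma finite_subcover (U : X -> set X) : (forall x, nbhs x (U x)) ->
  exists l : seq X, forall y, exists2 x, x \in l & U x y.
Proof.
move=> Un.
pose F : set_system (seq X) :=
  fun S => exists l0 : seq X, forall l : seq X, {subset l0 <= l} -> S l.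
have FF : Filter F.
  split.
  - by exists [::].
  - move=> S T [s hs] [t ht]; exists (s ++ t) => l stl; split.
      by apply: hs => x xs; apply: stl; rewrite mem_cat xs.
    by apply: ht => x xt; apply: stl; rewrite mem_cat xt orbT.
  - by move=> S T ST [s hs]; exists s => l /hs /ST.
have /compact_near_coveringP := cX.
move=> /(_ (seq X) F (fun l y => exists2 x, x \in l & U x y) FF) [].
  move=> x _; exists (U x, [set l : seq X | x \in l]) => /=.
    by split; [exact: Un|exists [:: x] => l; apply; rewrite inE].
  by move=> [y l] /= [Uxy xl]; exists x.
by move=> l /(_ l (fun _ h => h)) h; exists l => y; exact: h.
Qed.

Lemma urysohn_sep (A B : set X) : closed A -> closed B -> A `&` B = set0 ->
  exists f : X -> R, [/\ continuous f, forall x, 0 <= f x <= 1,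
    forall x, A x -> f x = 0 & forall x, B x -> f x = 1].
Proof.
move=> cA cB AB; have /(@normal_separatorP R) := compact_normal hX cX.
move=> /(_ _ _ cA cB AB) /(@uniform_separatorP _ R)[f [fc f01 fA fB]].
exists f; split=> // x.
- by have := f01 (f x) (ex_intro2 _ _ x I erefl); rewrite /= in_itv.
- by move=> Ax; apply: fA; exists x.
- by move=> Bx; apply: fB; exists x.
Qed.

(** Truncating an Urysohn function at 1/2 makes the bump vanish on a neighborhood of each point
    outside U, and not merely at that point. *)
Lemma bump (x : X) (U : set X) : nbhs x U -> exists h : X -> R,
  [/\ continuous h, forall y, 0 <= h y, 0 < h x &
      forall y, ~ U y -> \forall z \near y, h z = 0].
Proof.
move=> Ux.
have [||f [fc f01 f0 f1]] := @urysohn_sep [set x] (~` U°) _ (open_closedC (@open_interior _ U)).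
- exact: (accessible_closed_set1 (hausdorff_accessible hX)).
- by apply/seteqP; split=> y //= [-> /(_ Ux)].
exists (fun y => Num.max 0 (2^-1 - f y)); split.
- move=> y; apply: (@continuous_max R X (fun=> 0) (fun y => 2^-1 - f y) y).
    exact: cvg_cst.
  by apply: cvgB; [exact: cvg_cst|exact: fc].
- by move=> y; rewrite le_max lexx.
- by rewrite f0// subr0 lt_max invr_gt0 ltr0n orbT.
- move=> y nUy; have f1y : f y = 1 by apply: f1 => /interior_subset.
  have : \forall z \near y, 2^-1 < f z.
    by apply: (cvgr_gt (f y) (fc y)); rewrite f1y; lra.
  by apply: filterS => z hz; apply/max_idPl; lra.
Qed.

(** Bumps on a finite subcover are divided by their positive sum. Local vanishing off [U (c i)] is
    kept so that a product with [h i] behaves well even where the other factor is uncontrolled. *)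
Lemma partition_of_unity (U : X -> set X) : (forall x, nbhs x (U x)) ->
  exists (n : nat) (c : 'I_n -> X) (h : 'I_n -> X -> R),
  [/\ forall i, continuous (h i), forall i y, 0 <= h i y,
      forall y, \sum_(i < n) h i y = 1 &
      forall i y, ~ U (c i) y -> \forall z \near y, h i z = 0].
Proof.
move=> Un.
have /choice[g gP] x : exists h : X -> R,
  [/\ continuous h, forall y, 0 <= h y, 0 < h x &
      forall y, ~ U x y -> \forall z \near y, h z = 0] by exact: bump.
have [x|l lP] := @finite_subcover (fun x => [set y | 0 < g x y]).
  have [gc _ gx _] := gP x.
  by have := cvgr_gt (g x x) (gc x) _ gx; apply.
pose c (i : 'I_(size l)) := tnth (in_tuple l) i.
pose S y := \sum_(i < size l) g (c i) y.
have S0 y : 0 < S y.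
  have [x xl gxy] := lP y; have [i xi] : exists i, x = c i.
    by apply/tnthP.
  rewrite /S (bigD1 i)//= -xi ltr_pwDl//.
  by apply: sumr_ge0 => j _; have [] := gP (c j).
have Sc : continuous S.
  by apply: (@continuous_fsum _ R^o) => i; have [] := gP (c i).
exists (size l), c, (fun i y => g (c i) y / S y); split.
- move=> i y; apply: cvgM; first by have [gc _ _ _] := gP (c i); exact: gc.
  by apply: cvgV; [rewrite gt_eqF// (S0 y)|exact: Sc].
- move=> i y; rewrite divr_ge0 ?(ltW (S0 y))//.
  by have [_ g0 _ _] := gP (c i); exact: g0.
- by move=> y; rewrite -mulr_suml mulfV// gt_eqF// (S0 y).
- move=> i y nU; have [_ _ _ h] := gP (c i).
  by apply: filterS (h _ nU) => z ->; rewrite mul0r.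
Qed.

End PartitionOfUnity.

(** * Gluing local approximations *)

Section Glue.
Variables (R : realType) (X : topologicalType).
Hypotheses (cX : compact [set: X]) (hX : hausdorff_space X).

(** Being within [e y] of [s y] is a convex condition in each fibre, so a partition of unity
    preserves it; e therefore needs no regularity. L is left abstract to serve for sections, scalar
    functions, combinations of a frame and finite tensors alike. *)
Lemma approx_glue (T : X -> normedModType R[i]) (L : set (forall x, T x))
    (s : forall x, T x) (A : set X) (e : X -> R) :
  L (fun x => 0) ->
  (forall t u, L t -> L u -> L (fun x => t x + u x)) ->
  (forall (h : X -> R) t, continuous h -> L t -> L (fun x => (h x)%:C *: t x)) ->
  (forall x : X, exists2 t, L t &
     \forall y \near x, A y -> rnorm (s y - t y) <= e y) ->
  exists2 t, L t & forall y, A y -> rnorm (s y - t y) <= e y.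
Proof.
move=> L0 LD LM loc.
have /choice[t tP] (x : X) : exists t, L t /\
    \forall y \near x, A y -> rnorm (s y - t y) <= e y.
  by have [t] := loc x; exists t.
have Lt x : L (t x) by case: (tP x).
have st x := (tP x).2.
have [n [c [h [hc h0 h1 hU]]]] := @partition_of_unity R X cX hX
  (fun x y => A y -> rnorm (s y - t x y) <= e y) st.
exists (fun y => \sum_(i < n) (h i y)%:C *: t (c i) y).
  (* Membership in L is proved for arbitrary nonnegative weights: dropping the last one destroys the
     sum 1. *)
  clear h1 hU; elim: n c h hc h0 => [|n IH] c h hc h0.
    rewrite (_ : (fun y => _) = fun=> 0)//.
    by apply/functional_extensionality_dep => x; rewrite big_ord0.
  rewrite (_ : (fun y => _) = fun y =>
      (\sum_(i < n) (h (widen_ord (leqnSn n) i) y)%:C *: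
         t (c (widen_ord (leqnSn n) i)) y) +
         (h ord_max y)%:C *: t (c ord_max) y).
    apply: LD; last by apply: LM.
    exact: (IH (fun i => c (widen_ord (leqnSn n) i))
               (fun i => h (widen_ord (leqnSn n) i))).
  by apply/functional_extensionality_dep => x; rewrite big_ord_recr.
move=> y Ay; apply: convex_dist => // i hi.
have : (fun y => A y -> rnorm (s y - t (c i) y) <= e y) y; last exact.
apply: contrapT => nU; have /nbhs_singleton h0y := hU i y nU.
by rewrite h0y eqxx in hi.
Qed.

End Glue.

(** * Enough continuous sections *)

Section EnoughSections.
Variables (R : realType) (X : topologicalType).
Hypotheses (cX : compact [set: X]) (hX : hausdorff_space X).
Variables (E : X -> completeNormedModType R[i]) (b : hbundle E).

Local Notation pt v := (point b (Tagged E v)).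

Lemma proj_pt x (v : E x) : proj (pt v) = x.
Proof. by rewrite /proj pointK. Qed.

Lemma bnorm_pt x (v : E x) : bnorm (pt v) = rnorm v.
Proof. by rewrite /bnorm pointK. Qed.

Lemma bscale_pt a x (v : E x) : bscale a (pt v) = pt (a *: v).
Proof. by rewrite /bscale pointK. Qed.

Lemma pt_coord (p : b) : pt (tagged (coord p)) = p.
Proof. by rewrite -[RHS]coordK; case: (coord p). Qed.

(** The projection is open, so the image of a neighborhood of a point meets all nearby fibres. *)
Lemma near_fiber x (v : E x) W : nbhs (pt v) W ->
  \forall y \near x, exists w : E y, W (pt w).
Proof.
move=> vW; have oW := @proj_open _ _ _ _ (hbundleP b) _ (@open_interior _ W).
have : nbhs x (@proj _ _ _ b @` W°).
  apply: open_nbhs_nbhs; split => //; exists (pt v); last exact: proj_pt.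
  exact: nbhs_singleton (nbhs_interior vW).
apply: filterS => y [p /interior_subset Wp <-].
by exists (tagged (coord p)); rewrite pt_coord.
Qed.

Lemma bscale_near (a : R[i]^o) x (v : E x) W : nbhs (pt (a *: v)) W ->
  \forall z \near (a, pt v), W (bscale z.1 z.2).
Proof.
rewrite -bscale_pt => aW.
exact: (@bscale_continuous _ _ _ _ (hbundleP b) (a, pt v) _ aW).
Qed.

Lemma bnorm_near x (v : E x) (c : R) : rnorm v < c ->
  nbhs (pt v) [set p : b | bnorm p < c].
Proof.
move=> vc; apply: open_nbhs_nbhs; split; first exact: (bnorm_usc (hbundleP b)).
by rewrite /= bnorm_pt.
Qed.

(** Subtraction is continuous on pairs in a common fibre and the norm is upper semicontinuous, so a
    strict upper bound on a difference is an open condition. *)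
Lemma near_sub x (v w : E x) (e : R) : rnorm (v - w) < e ->
  exists A B, [/\ nbhs (pt v) A, nbhs (pt w) B & forall y (v' w' : E y),
    A (pt v') -> B (pt w') -> rnorm (v' - w') < e].
Proof.
move=> /bnorm_near /badd_near[[A B] /= [vA wB] AB].
move: wB; rewrite -scaleN1r => /bscale_near[[C D] /= [NC wD] CD].
exists A, D; split => // y v' w' Av' Dw'.
have Bw' : B (pt (- w')).
  rewrite -scaleN1r -bscale_pt; apply: (CD (-1, pt w')); split => //=.
  exact: nbhs_singleton.
have := AB (pt v', pt (- w')) (conj Av' Bw').
by rewrite !proj_pt baddE /= bnorm_pt; apply.
Qed.

Lemma thin_nbhs x (v : E x) (e : R) : 0 < e -> exists2 W, nbhs (pt v) W &
  forall y (w w' : E y), W (pt w) -> W (pt w') -> rnorm (w - w') < e.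
Proof.
move=> e0; have [|A [B [vA vB AB]]] := @near_sub x v v e.
  by rewrite subrr rnorm0.
by exists (A `&` B); [exact: filterI|move=> y w w' [Aw _] [_ Bw']; exact: AB].
Qed.

(* g is within r of being continuous at x, with value w there. *)
Definition almost_continuous (r : X -> R) (g : forall x, E x) x (w : E x) :=
  forall W, nbhs (pt w) W -> \forall y \near x,
    exists2 w' : E y, W (pt w') & rnorm (g y - w') <= r y.
Local Notation almost := almost_continuous.

Lemma almost_eq r r' g g' x (w w' : E x) : r = r' -> g = g' -> w = w' ->
  almost r g w -> almost r' g' w'.
Proof. by move=> -> -> ->. Qed.

Lemma almost_add r r' g g' x (w w' : E x) : almost r g w -> almost r' g' w' ->
  almost (fun y => r y + r' y) (fun y => g y + g' y) (w + w').
Proof.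
move=> gw gw' W /badd_near[[A B] /= [wA wB] AB].
apply: filterS2 (gw _ wA) (gw' _ wB) => y [v Av gv] [v' Bv' gv'].
exists (v + v').
  by rewrite -baddE; apply: (AB (pt v, pt v')) => //; rewrite !proj_pt.
rewrite opprD addrACA; apply: le_trans (rnormD _ _) _; exact: lerD.
Qed.

Lemma almost_scale (h : X -> R) r g x (w : E x) : {for x, continuous h} ->
  (forall y, 0 <= h y) -> almost r g w ->
  almost (fun y => h y * r y) (fun y => (h y)%:C *: g y) ((h x)%:C *: w).
Proof.
move=> hc h0 gw W /bscale_near[[C D] /= [hC wD] CD].
have hC' : \forall y \near x, C (h y)%:C.
  exact: (hc _ (@realC_continuous R (h x) C hC)).
apply: filterS2 hC' (gw _ wD) => y Chy [v Dv gv]; exists ((h y)%:C *: v).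
  by rewrite -bscale_pt; exact: (CD ((h y)%:C, pt v)).
by rewrite -scalerBr rnormZr// ler_wpM2l.
Qed.

Lemma almost_zero r g x : (\forall y \near x, g y = 0 /\ 0 <= r y) ->
  almost r g (0 : E x).
Proof.
move=> g0 W xW.
have W0 : \forall y \near x, W (pt (0 : E y)) by exact: (@section0 _ _ _ b x _ xW).
apply: filterS2 g0 W0 => y [gy ry] W0; exists 0 => //.
by rewrite gy subrr rnorm0.
Qed.

(** [near_fiber] puts points close to the new centre in every nearby fibre, and [near_sub] keeps
    them within e of the points close to the old one. *)
Lemma almost_recenter r g x (w w' : E x) (e : R) : almost r g w ->
  rnorm (w - w') < e -> almost (fun y => r y + e) g w'.
Proof.
move=> gw /near_sub[A [B [wA wB AB]]] W wW.
apply: filterS2 (gw _ wA) (near_fiber (filterI wW wB)) => y [v Av gv] [v' [Wv' Bv']].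
exists v' => //; rewrite -[g y](subrK v) -addrA.
by apply: le_trans (rnormD _ _) _; rewrite lerD// ltW// AB.
Qed.

Lemma almost_shift r g g' x (w : E x) (e : R) : almost r g w ->
  (forall y, rnorm (g' y - g y) <= e) -> almost (fun y => r y + e) g' w.
Proof.
move=> gw gg W /gw; apply: filterS => y [v Wv gv]; exists v => //.
rewrite -[g' y](subrK (g y)) -addrA addrC.
by apply: le_trans (rnormD _ _) _; rewrite lerD.
Qed.

Lemma almost_center r g x (w : E x) : almost (fun=> r) g w -> rnorm (g x - w) <= r.
Proof.
move=> gw; apply/ler_addgt0Pl => e e0.
have [W wW Wthin] := thin_nbhs w e0.
have /nbhs_singleton[w' Ww' gw'] := gw _ wW.
rewrite -[g x](subrK w') -addrA addrC; apply: le_trans (rnormD _ _) _.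
by rewrite lerD// ltW// Wthin//; exact: nbhs_singleton.
Qed.

Lemma almost_continuous_section g : (forall e : R, 0 < e -> forall x, almost (fun=> e) g (g x)) ->
  continuous_section b g.
Proof.
move=> gg x W /tube_nbhs[A [U [e [xA xU e0 AUW]]]].
have e2 : 0 < e / 2 by rewrite divr_gt0.
apply: filterS2 (gg _ e2 x _ xA) xU => y [w' Aw' gw'] Uy; rewrite /= -[g y](subrK w') addrC.
by apply: AUW => //; apply: le_lt_trans gw' _; lra.
Qed.

(** The errors carry the weights [h i], so that they add up to r, and not to n times r, for a
    partition of unity. *)
Lemma almost_sum n (h : 'I_n -> X -> R) (g : 'I_n -> forall x, E x) (r : R)
    x (w : 'I_n -> E x) :
  (forall i, almost (fun y => h i y * r) (fun y => (h i y)%:C *: g i y)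
    ((h i x)%:C *: w i)) ->
  almost (fun y => \sum_i h i y * r) (fun y => \sum_i (h i y)%:C *: g i y)
    (\sum_i (h i x)%:C *: w i).
Proof.
elim: n h g w => [|n IH] h g w hg.
  rewrite big_ord0; apply: almost_zero; apply: nearW => y.
  by rewrite !big_ord0.
pose wi := widen_ord (leqnSn n).
have := almost_add (IH (fun i => h (wi i)) (fun i => g (wi i)) (fun i => w (wi i))
  (fun i => hg _)) (hg ord_max).
apply: almost_eq; first by apply/funext => y; rewrite big_ord_recr.
  by apply/functional_extensionality_dep => y; rewrite big_ord_recr.
by rewrite big_ord_recr.
Qed.

Variables (z : X) (s0 : forall x, E x).

(* The condition at z makes every limit of almost sections take the value s0 z. *)
Definition almost_section (r : R) (g : forall x, E x) := forall x : X,
  exists w : E x, (x = z -> w = s0 x) /\ almost (fun=> r) g w.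

(** By upper semicontinuity and openness of the projection, fibres near z contain points close to
    [s0 z] of norm below [rnorm (s0 z) + 1]; this is the error of the zero section. *)
Lemma almost_section0 : almost_section (rnorm (s0 z) + 1) (fun x => 0).
Proof.
move=> x; have [->|xz] := eqVneq x z; last first.
  exists 0; split=> [xz'|]; first by rewrite xz' eqxx in xz.
  apply: almost_zero; apply: nearW => y; split => //.
  by apply: addr_ge0 => //; exact: rnorm_ge0.
exists (s0 z); split => // W zW.
have zn : nbhs (pt (s0 z)) [set p : b | bnorm p < rnorm (s0 z) + 1].
  by apply: bnorm_near; rewrite ltrDl.
apply: filterS (near_fiber (filterI zW zn)) => y [w [Ww]] /=.
by rewrite bnorm_pt => wz; exists w => //; rewrite sub0r -sub0r rnormB subr0 ltW.
Qed.

(** Points are chosen fibre by fibre in a thin neighborhood W of the centre, as close to g as g is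
    to being continuous. However discontinuous the choice, any two points of W in one fibre differ
    by less than r', so the choice is r'-almost continuous. At z the centre [s0 z] is allowed
    because it too lies in W. *)
Lemma almost_section_refine_local r g (r' : R) (x : X) : 0 < r' -> almost_section r g ->
  exists g' : forall x, E x, \forall y \near x, rnorm (g y - g' y) <= r /\
    almost (fun=> r') g' (if y == z then s0 y else g' y).
Proof.
move=> r'0 /(_ x)[w [wz gw]].
have [W wW Wthin] := thin_nbhs w r'0.
pose P y (v : E y) := W° (pt v) /\ rnorm (g y - v) <= r.
pose g' y : E y :=
  if pselect (exists v : E y, P y v) is left h then projT1 (cid h) else 0.
have g'P y : (exists v : E y, P y v) -> P y (g' y).
  by rewrite /g'; case: pselect => // h _; exact: (projT2 (cid h)).
exists g'.
have h1 : \forall y \near x, exists v : E y, P y v.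
  by apply: filterS (gw _ (nbhs_interior wW)) => y [v Wv gv]; exists v.
(* Away from z a neighborhood avoiding z makes this vacuous; at z the centre is [s0 z] itself. *)
have h2 : \forall y \near x, y = z -> W° (pt (s0 y)).
  have [xz|xz] := eqVneq x z.
    have W0 : W° (pt (s0 x)) by rewrite -wz//; exact: nbhs_singleton (nbhs_interior wW).
    have : \forall y \near x, x = y \/ y <> x.
      by apply: nearW => y; have [->|/eqP] := eqVneq y x; [left|right].
    by apply: filterS => y [<- //|yx yz]; case: yx; rewrite xz.
  have : \forall y \near x, y != z.
    have cz : closed [set z].
      exact: (accessible_closed_set1 (hausdorff_accessible hX)).
    have : nbhs x (~` [set z]).
      by apply: open_nbhs_nbhs; split; [exact: closed_openC|exact/eqP].
    by apply: filterS => y /eqP.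
  by apply: filterS => y /eqP yz /yz.
have h : \forall y \near x, (exists v : E y, P y v) /\ (y = z -> W° (pt (s0 y))).
  exact: filterI h1 h2.
(* Almost continuity at y involves fibres around y, so y must be interior to the set where h
   holds. *)
have /= := nbhs_interior h; apply: filterS => y /[dup] hy /interior_subset[hPy hzy].
split; first by have [] := g'P y hPy.
have Wc : W° (pt (if y == z then s0 y else g' y)).
  by case: eqP => [/hzy//|_]; have [] := g'P y hPy.
move=> W' cW'.
have WW : nbhs (pt (if y == z then s0 y else g' y)) (W' `&` W°).
  by apply: filterI => //; apply: open_nbhs_nbhs; split => //; exact: open_interior.
apply: filterS2 (near_fiber WW) hy => u [v [W'v Wv]] [hPu _].
exists v => //; apply/ltW/Wthin; last exact: interior_subset.
by have [/interior_subset] := g'P u hPu.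
Qed.

Lemma almost_section_refine r g (r' : R) : 0 < r' -> almost_section r g ->
  exists g' : forall x, E x, (forall y, rnorm (g y - g' y) <= r) /\ almost_section r' g'.
Proof.
move=> r'0 hg.
have /choice[t tP] (x : X) : exists g' : forall x, E x, \forall y \near x,
    rnorm (g y - g' y) <= r /\ almost (fun=> r') g' (if y == z then s0 y else g' y).
  exact: almost_section_refine_local.
have [n [c [h [hc h0 h1 hU]]]] := @partition_of_unity R X cX hX _ tP.
exists (fun y => \sum_(i < n) (h i y)%:C *: t (c i) y); split=> [y|y].
  apply: convex_dist => // i hi; apply: contrapT => ny.
  have /nbhs_singleton h0y := hU i y (fun h => ny h.1).
  by rewrite h0y eqxx in hi.
(* At z all local centres coincide with [s0 z], hence so does their convex combination. *)
pose q i := if y == z then s0 y else t (c i) y.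
exists (\sum_i (h i y)%:C *: q i); split.
  move=> yz; under eq_bigr do rewrite /q (introT eqP yz).
  by rewrite -scaler_suml -rmorph_sum h1 scale1r.
have gs : almost (fun u => \sum_i h i u * r')
    (fun u => \sum_i (h i u)%:C *: t (c i) u) (\sum_i (h i y)%:C *: q i).
  apply: almost_sum => i.
  have [[_ gi]|ny] := pselect (rnorm (g y - t (c i) y) <= r /\ almost (fun=> r') (t (c i)) (q i)).
    by apply: almost_scale => //; exact: hc.
  (* Where the local property fails, the weight vanishes on a whole neighborhood and the term is
     locally zero. *)
  have hi0 := hU i y ny; rewrite (nbhs_singleton hi0) scale0r.
  by apply: almost_zero; apply: filterS hi0 => u ->; rewrite scale0r mul0r.
apply: almost_eq gs => //.
by apply/funext => u; rewrite -mulr_suml h1 mul1r.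
Qed.

(** A refinement moves the section by at most the current error, whatever the next error is; halving
    the errors therefore gives a uniformly convergent sequence. *)
Lemma enough_sections : exists2 s, continuous_section b s & s z = s0 z.
Proof.
pose M := rnorm (s0 z) + 1; pose r n : R := M / 2 ^+ n.
have M0 : 0 < M by rewrite ltr_wpDl ?rnorm_ge0.
have r0 n : 0 < r n by rewrite divr_gt0// exprn_gt0.
pose T := {ng : nat * (forall x, E x) | almost_section (r ng.1) ng.2}.
have step (p : T) : {q : T | (sval q).1 = (sval p).1.+1 /\
    forall y, rnorm ((sval p).2 y - (sval q).2 y) <= r (sval p).1}.
  apply: cid; case: p => -[n g] /= hg.
  have [g' [gg' hg']] := almost_section_refine (r0 n.+1) hg.
  by exists (exist _ (n.+1, g') hg').
have start : almost_section (r 0%N) (fun x => 0).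
  by rewrite /r expr0 divr1; exact: almost_section0.
have [f [f0 fS]] := dependent_choice step (exist _ (0%N, fun x => 0) start).
pose g n := (sval (f n)).2.
have f1 n : (sval (f n)).1 = n by elim: n => [|n IH]; [rewrite f0|rewrite (fS n).1 IH].
have hg n : almost_section (r n) (g n) by have := svalP (f n); rewrite /= f1.
have gS n y : rnorm (g n y - g n.+1 y) <= r n by have := (fS n).2 y; rewrite f1.
have lim y : {l : E y | forall n, rnorm (g n y - l) <= 2 * r n}.
  by apply: cid; apply: geometric_limit => // n; exact: gS.
pose s y := sval (lim y).
have sg n y : rnorm (s y - g n y) <= 2 * r n by rewrite rnormB; exact: (svalP (lim y)).
(* The 3 is 2 for the distance from the limit to [g n] plus 1 for the error of [g n]. *)
have sc n x : exists w : E x, [/\ x = z -> w = s0 x, rnorm (s x - w) <= 3 * r n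
    & almost (fun=> 3 * r n) s w].
  have [w [wz gw]] := hg n x; exists w; split=> //.
    by have := almost_center gw; have := sg n x; have := rnorm_tri (s x) (g n x) w; lra.
  apply: almost_eq (almost_shift gw (sg n)) => //.
  by apply/funext => _; lra.
exists s.
  apply: almost_continuous_section => e e0 x.
  have [|n hn] := geometric_small M (e := e / 8); first by rewrite divr_gt0.
  rewrite -/(r n) in hn.
  have [w [_ sw gw]] := sc n x.
  (* Recentring from w to [s x] costs 4 more, total 7, whence the choice of e / 8. *)
  have wx : rnorm (w - s x) < 4 * r n by rewrite rnormB; have := r0 n; lra.
  move=> W /(almost_recenter gw wx); apply: filterS => y [v Wv gv]; exists v => //.
  by apply: le_trans gv _; have := r0 n; lra.
apply/eqP; rewrite -subr_eq0; apply/eqP/rnorm_eq0/eqP.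
rewrite eq_le rnorm_ge0 andbT; apply/ler_addgt0Pl => e e0; rewrite addr0.
have [|n hn] := geometric_small M (e := e / 8); first by rewrite divr_gt0.
rewrite -/(r n) in hn.
have [w [wz sw _]] := sc n z; rewrite -wz//.
by apply: le_trans sw _; have := r0 n; lra.
Qed.
End EnoughSections.

(** * Frames *)

Section Combinations.
Variable R : realType.
Local Notation nrm a := (rnorm (a : R[i]^o)).

Definition lincomb (V : lmodType R[i]) k (c : nat -> R[i]) (v : nat -> V) : V :=
  \sum_(i < k) c i *: v i.

Definition independent (V : lmodType R[i]) k (v : nat -> V) :=
  forall c, lincomb k c v = 0 -> forall i, (i < k)%N -> c i = 0.

Lemma lincomb_recr (V : lmodType R[i]) k c (v : nat -> V) :
  lincomb k.+1 c v = lincomb k c v + c k *: v k.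
Proof. exact: big_ord_recr. Qed.

Lemma lincombB (V : lmodType R[i]) k c c' (v : nat -> V) :
  lincomb k c v - lincomb k c' v = lincomb k (fun i => c i - c' i) v.
Proof.
by rewrite /lincomb -sumrB; apply: eq_bigr => i _; rewrite scalerBl.
Qed.

Lemma lincombD (V : lmodType R[i]) k c c' (v : nat -> V) :
  lincomb k c v + lincomb k c' v = lincomb k (fun i => c i + c' i) v.
Proof.
by rewrite /lincomb -big_split; apply: eq_bigr => i _; rewrite scalerDl.
Qed.

Lemma lincombZ (V : lmodType R[i]) k a c (v : nat -> V) :
  lincomb k (fun i => a * c i) v = a *: lincomb k c v.
Proof.
by rewrite /lincomb scaler_sumr; apply: eq_bigr => i _; rewrite scalerA.
Qed.

Lemma eq_lincomb (V : lmodType R[i]) k c c' (v v' : nat -> V) :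
  (forall i, (i < k)%N -> c i = c' i /\ v i = v' i) -> lincomb k c v = lincomb k c' v'.
Proof. by move=> h; apply: eq_bigr => i _; have [-> ->] := h i (ltn_ord i). Qed.

Lemma rnorm_lincomb (V : normedModType R[i]) k c (v : nat -> V) :
  rnorm (lincomb k c v) <= \sum_(i < k) nrm (c i) * rnorm (v i).
Proof.
apply: le_trans (rnorm_sum _ _) _; apply: ler_sum => i _.
by rewrite rnormZ.
Qed.

(** Families are indexed by [nat], which makes appending a vector painless; rows carry the topology
    needed for compactness, and this function passes from rows to families. *)
Definition row_ext k (c : 'rV[R[i]^o]_k) (i : nat) : R[i] :=
  if insub i is Some j then c ord0 j else 0.

Lemma row_extE k (c : 'rV[R[i]^o]_k) (i : 'I_k) : row_ext c i = c ord0 i.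
Proof. by rewrite /row_ext valK. Qed.

(** A square instead of a disc: it contains the closed unit disc and is the image of a product of
    two segments, hence compact. *)
Definition csquare : set R[i]^o := [set a +i* b | a in `[-1, 1] & b in `[-1, 1]].

Lemma csquare_compact : compact csquare.
Proof.
have -> : csquare = [set (p.1%:C + 'i * p.2%:C : R[i]^o) |
    p in (`[-1, 1] `*` `[-1, 1] : set (R * R))].
  rewrite /csquare; apply/seteqP; split=> [_ [a ha] [b hb] <-|_ [[a b] /= [ha hb] <-]].
    by exists (a, b) => //=; apply/eqP; rewrite eq_complex /=; apply/andP; split; apply/eqP; ring.
  exists a => //; exists b => //.
  by apply/eqP; rewrite eq_complex /=; apply/andP; split; apply/eqP; ring.
apply: continuous_compact; last by apply: compact_setX; exact: segment_compact.
apply: continuous_subspaceT => -[a b].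
apply: cvgD.
  apply: (@cvg_comp _ _ _ (fun p : R * R => p.1) (fun r : R => r%:C : R[i]^o)).
    exact: cvg_fst.
  exact: realC_continuous.
apply: cvgM; first exact: cvg_cst.
apply: (@cvg_comp _ _ _ (fun p : R * R => p.2) (fun r : R => r%:C : R[i]^o)).
  exact: cvg_snd.
exact: realC_continuous.
Qed.

Lemma csquareP (z : R[i]) : nrm z <= 1 -> csquare z.
Proof.
case: z => a b; rewrite /rnorm normc_def /= => h.
have h2 : a ^+ 2 + b ^+ 2 <= 1.
  by rewrite -(expr1n _ 2) -[leLHS]sqr_sqrtr ?addr_ge0 ?sqr_ge0// lerXn2r ?nnegrE ?sqrtr_ge0.
have ha := sqr_ge0 a; have hb := sqr_ge0 b.
exists a; first by rewrite /= in_itv /=; apply/andP; split; nra.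
by exists b => //; rewrite /= in_itv /=; apply/andP; split; nra.
Qed.

Definition cbox k := [set c : 'rV[R[i]^o]_k | forall j, csquare (c ord0 j)].

Lemma cbox_compact k : compact (@cbox k).
Proof. by apply: (@rV_compact R[i]^o k (fun=> csquare)) => _; exact: csquare_compact. Qed.

Lemma near_coord k (c : 'rV[R[i]^o]_k) (e : R) : 0 < e ->
  nbhs c [set c' : 'rV[R[i]^o]_k | forall j, nrm (c ord0 j - c' ord0 j) < e].
Proof.
move=> e0; exists (fun i j => ball (c i j) e%:C).
  by move=> i j; apply: nbhsx_ballx; rewrite ltcR.
by move=> c' /= h j; have := h ord0 j; rewrite -ball_normE /= rnormE ltcR.
Qed.

Lemma csum_ge0 k (c : nat -> R[i]) : 0 <= \sum_(i < k) nrm (c i).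
Proof. by apply: sumr_ge0 => i _; exact: rnorm_ge0. Qed.

Lemma csum_normalize k (c : nat -> R[i]) (M := \sum_(i < k) nrm (c i)) :
  0 < M -> exists c' : 'rV[R[i]^o]_k,
    [/\ cbox c', \sum_(i < k) nrm (row_ext c' i) = 1 &
        forall i, (i < k)%N -> c i = M%:C * row_ext c' i].
Proof.
move=> M0; have MC : M%:C != 0 by rewrite eq_complex /= negb_and gt_eqF.
pose c' : 'rV[R[i]^o]_k := \row_i (M^-1%:C * c i); exists c'.
have nc' (i : 'I_k) : nrm (M^-1%:C * c i) = M^-1 * nrm (c i).
  by rewrite -[_ * c i]/(M^-1%:C *: (c i : R[i]^o)) rnormZr// invr_ge0 ltW.
split.
- move=> j; rewrite mxE; apply: csquareP; rewrite nc' mulrC ler_pdivrMr// mul1r.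
  by rewrite /M (bigD1 j)//= lerDl; apply: sumr_ge0 => i _; exact: rnorm_ge0.
- under eq_bigr do rewrite row_extE mxE nc'.
  by rewrite -mulr_sumr mulVf// gt_eqF.
- move=> i ik; rewrite (row_extE c' (Ordinal ik)) mxE /= mulrA -rmorphM mulfV ?gt_eqF//.
  by rewrite mul1r.
Qed.

(** Equivalence of norms in finite dimension, in quantitative form. *)
Lemma independent_lower_bound (V : normedModType R[i]) k (v : nat -> V) :
  independent k v -> exists2 kappa : R, 0 < kappa &
    forall c : nat -> R[i], kappa * \sum_(i < k) nrm (c i) <= rnorm (lincomb k c v).
Proof.
move=> iv.
(* The penalty makes phi positive on the whole compact box; where the absolute values of the
   coefficients sum to 1, phi is the norm of the combination. *)
pose phi (c : 'rV[R[i]^o]_k) := rnorm (lincomb k (row_ext c) v) +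
  `|\sum_(i < k) nrm (row_ext c i) - 1|.
have phi0 c : 0 < phi c.
  rewrite lt_neqAle addr_ge0 ?rnorm_ge0// andbT; apply/negP => /eqP/esym/eqP.
  rewrite paddr_eq0 ?rnorm_ge0// normr_eq0 => /andP[/eqP/rnorm_eq0/iv h].
  by rewrite big1 ?sub0r ?oppr_eq0 ?oner_eq0// => i _; rewrite h// rnorm0.
pose B := \sum_(i < k) (rnorm (v i) + 1) + 1.
have B0 : 0 < B by rewrite ltr_wpDl// sumr_ge0// => i _; rewrite addr_ge0 ?rnorm_ge0.
have phiL (c c' : 'rV[R[i]^o]_k) d : (forall j, nrm (c ord0 j - c' ord0 j) < d) ->
    0 < d -> phi c - phi c' <= d * B.
  move=> h d0.
  have h1 : rnorm (lincomb k (row_ext c) v) - rnorm (lincomb k (row_ext c') v) <=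
      \sum_(i < k) d * rnorm (v i).
    apply: le_trans (ler_norm _) _; apply: le_trans (rnorm_dist _ _) _.
    rewrite lincombB; apply: le_trans (rnorm_lincomb _ _ _) _.
    by apply: ler_sum => i _; rewrite ler_wpM2r ?rnorm_ge0// !row_extE ltW.
  have h2 : `|\sum_(i < k) nrm (row_ext c i) - 1| - `|\sum_(i < k) nrm (row_ext c' i) - 1| <=
      \sum_(i < k) d.
    apply: le_trans (ler_norm _) _; apply: le_trans (ler_dist_dist _ _) _.
    rewrite opprB addrA subrK -sumrB; apply: le_trans (ler_norm_sum _ _ _) _.
    apply: ler_sum => i _; apply: le_trans (rnorm_dist _ _) _.
    by rewrite !row_extE ltW.
  rewrite /phi /B mulrDr mulr1 mulr_sumr.
  under [X in _ <= X + _]eq_bigr do rewrite mulrDr mulr1.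
  by rewrite big_split /=; lra.
(* Compactness along r tending to 0 from the right: phi varies by at most [phi c / 2] on a ball of
   radius [phi c / (2 * B)], which leaves [phi c / 2] as a local lower bound. *)
have hr : \forall r \near (0 : R)^'+, forall c, @cbox k c -> r <= phi c.
  have /compact_near_coveringP := @cbox_compact k.
  apply=> c _.
  have e0 : 0 < phi c / (2 * B) by rewrite divr_gt0// mulr_gt0.
  have p2 : 0 < phi c / 2 by rewrite divr_gt0.
  exists ([set c' : 'rV[R[i]^o]_k | forall j, nrm (c ord0 j - c' ord0 j) < phi c / (2 * B)],
          [set r | r < phi c / 2]) => /=.
    by split; [exact: near_coord|exact: nbhs_right_lt].
  move=> [c' r] /= [hc hr]; have := phiL c c' _ hc e0.
  rewrite [_ / _ * B](_ : _ = phi c / 2); last by field; rewrite gt_eqF.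
  lra.
have [r [/= r0 hrc]] := filter_ex (filterI (nbhs_right_gt (0 : R)) hr).
exists r => // c; set M := \sum_(i < k) _.
have := csum_ge0 k c; rewrite le_eqVlt -/M => /orP[/eqP<-|M0].
  by rewrite mulr0 rnorm_ge0.
have [c' [c'B c'1 cc']] := csum_normalize M0.
rewrite (@eq_lincomb _ _ _ (fun i => M%:C * row_ext c' i) v v); last first.
  by move=> i /cc'.
rewrite lincombZ rnormZr ?(ltW M0)// mulrC ler_pM2l//.
by have := hrc _ c'B; rewrite /phi c'1 subrr normr0 addr0.
Qed.

End Combinations.

(** * Sections continuous relative to a subset *)

Section Approximable.
Variables (R : realType) (X : topologicalType).
Hypotheses (cX : compact [set: X]) (hX : hausdorff_space X).
Variables (E : X -> completeNormedModType R[i]) (b : hbundle E).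
Hypothesis fE : is_fbundle b.

Local Notation nrm a := (rnorm (a : R[i]^o)).
Local Notation pt v := (point b (Tagged E v)).
Local Notation cs := (continuous_section b).

Lemma cs_add s t : cs s -> cs t -> cs (fun x => s x + t x).
Proof. by move=> sc tc; exact (@sectionD R X cX E b (GammaSection cX sc) (GammaSection cX tc)). Qed.

Lemma cs_mul (f : X -> R[i]^o) s : continuous f -> cs s ->
  cs (fun x => (f x : R[i]) *: s x).
Proof. by move=> fc sc; exact (@section_mul R X cX E b f (GammaSection cX sc) fc). Qed.

Lemma cs_scale (a : R[i]) s : cs s -> cs (fun x => a *: s x).
Proof. by move=> sc; apply: (cs_mul (f := fun=> a)) => // x; exact: cvg_cst. Qed.

Lemma cs_realmul (h : X -> R) s : continuous h -> cs s ->
  cs (fun x => (h x)%:C *: s x).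
Proof.
move=> hc; apply: (cs_mul (f := fun x => (h x)%:C)) => x.
exact: (realC_comp_continuous hc).
Qed.

Lemma cs_rnorm s : cs s -> continuous (fun x => rnorm (s x)).
Proof.
move=> sc; rewrite (_ : (fun x => _) = @bnorm _ _ E b \o (fun x => pt (s x))).
  by move=> x; apply: continuous_comp; [exact: sc|exact: fE].
by apply/funext => x; rewrite /= bnorm_pt.
Qed.

(* Continuity of s relative to A, tested on global sections instead of the
   topology of the total space. *)
Definition approximable (A : set X) (s : forall x, E x) := forall x : X, A x ->
  forall e : R, 0 < e -> exists2 t, cs t &
    \forall y \near x, A y -> rnorm (s y - t y) <= e.

Definition rel_continuous (A : set X) (f : X -> R[i]) := forall x : X, A x ->
  forall e : R, 0 < e -> \forall y \near x, A y -> nrm (f y - f x) <= e.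

Lemma approximable_cs A s : cs s -> approximable A s.
Proof.
move=> sc x _ e e0; exists s => //; apply: nearW => y _.
by rewrite subrr rnorm0 ltW.
Qed.

Lemma approximable_eq (A : set X) s t : (forall x, A x -> s x = t x) ->
  approximable A s -> approximable A t.
Proof.
move=> st sA x Ax e e0; have [u uc su] := sA x Ax e e0; exists u => //.
by apply: filterS su => y h Ay; rewrite -st//; exact: h.
Qed.

Lemma approximable_add A s t : approximable A s -> approximable A t ->
  approximable A (fun x => s x + t x).
Proof.
move=> sA tA x Ax e e0; have e2 : 0 < e / 2 by rewrite divr_gt0.
have [u uc su] := sA x Ax _ e2; have [v vc tv] := tA x Ax _ e2.
exists (fun x => u x + v x); first exact: cs_add.
apply: filterS2 su tv => y h1 h2 Ay; rewrite opprD addrACA.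
apply: le_trans (rnormD _ _) _; have := h1 Ay; have := h2 Ay; lra.
Qed.

Lemma approximable_norm A s x (e : R) : approximable A s -> A x -> 0 < e ->
  \forall y \near x, A y -> `|rnorm (s y) - rnorm (s x)| <= e.
Proof.
move=> sA Ax e0; have e3 : 0 < e / 3 by rewrite divr_gt0.
have [t tc st] := sA x Ax _ e3.
have /cvgrPdist_lt/(_ _ e3) tn := @cs_rnorm t tc x.
have h3 := nbhs_singleton st Ax.
apply: filterS2 st tn => y h1 h2 Ay; have := h1 Ay.
have := rnorm_dist (s y) (t y); have := rnorm_dist (s x) (t x).
move: h2 h3; rewrite !ler_norml !ltr_norml => /andP[? ?] ? /andP[? ?] /andP[? ?] ?.
by apply/andP; split; lra.
Qed.

Lemma approximable_mul A f s : rel_continuous A f -> approximable A s ->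
  approximable A (fun x => f x *: s x).
Proof.
move=> fA sA x Ax e e0.
have M0 : 0 < rnorm (s x) + 1 by rewrite ltr_wpDl ?rnorm_ge0.
have N0 : 0 < nrm (f x) + 1 by rewrite ltr_wpDl ?rnorm_ge0.
have e1 : 0 < e / 2 / (rnorm (s x) + 1) by rewrite !divr_gt0.
have e2 : 0 < e / 2 / (nrm (f x) + 1) by rewrite !divr_gt0.
have [t tc st] := sA x Ax _ e2.
(* The scalar is frozen at x, so the approximant stays a global section; the variation of f is
   absorbed by a local bound on [s]. *)
exists (fun y => f x *: t y); first exact: cs_scale.
have sn := approximable_norm sA Ax ltr01.
near=> y => Ay.
have -> : f y *: s y - f x *: t y = (f y - f x) *: s y + f x *: (s y - t y).
  by rewrite scalerBl scalerBr addrA subrK.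
apply: le_trans (rnormD _ _) _; rewrite !rnormZ.
have h1 : nrm (f y - f x) <= e / 2 / (rnorm (s x) + 1).
  by move: Ay; near: y; exact: fA.
have h2 : rnorm (s y - t y) <= e / 2 / (nrm (f x) + 1) by move: Ay; near: y.
have h3 : `|rnorm (s y) - rnorm (s x)| <= 1 by move: Ay; near: y.
rewrite [leRHS](_ : e = e / 2 / (rnorm (s x) + 1) * (rnorm (s x) + 1) +
   (nrm (f x) + 1) * (e / 2 / (nrm (f x) + 1))); last first.
  by field; rewrite !gt_eqF.
apply: lerD.
  apply: ler_pM => //; [exact: (@rnorm_ge0 R R[i]^o)|exact: rnorm_ge0|].
  by move: h3; rewrite ler_norml => /andP[_ ?]; lra.
apply: ler_pM => //; [exact: (@rnorm_ge0 R R[i]^o)|exact: rnorm_ge0|].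
by rewrite lerDl.
Unshelve. all: by end_near. Qed.

Lemma approximable_global A s (e : R) : closed A -> approximable A s -> 0 < e ->
  exists2 t, cs t & forall y, A y -> rnorm (s y - t y) <= e.
Proof.
move=> cA sA e0.
apply: (@approx_glue R X cX hX E cs s A (fun=> e)).
- by move=> x; exact: (@section0 _ _ _ b x).
- exact: cs_add.
- exact: cs_realmul.
- move=> x; have [Ax|nAx] := pselect (A x); first exact: sA.
  exists (fun=> 0); first by move=> y; exact: (@section0 _ _ _ b y).
  have : nbhs x (~` A) by apply: open_nbhs_nbhs; split => //; exact: closed_openC.
  by apply: filterS => y.
Qed.

Lemma rel_continuous_cst A a : rel_continuous A (fun=> a).
Proof. by move=> x _ e e0; apply: nearW => y _; rewrite subrr rnorm0 ltW. Qed.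

Lemma rel_continuous_cts A (f : X -> R[i]^o) : continuous f -> rel_continuous A f.
Proof.
move=> fc x _ e e0.
have eC : 0 < e%:C by rewrite ltcR.
have /cvgrPdist_lt/(_ _ eC) := fc x.
by apply: filterS => y; rewrite rnormE ltcR rnormB => /ltW.
Qed.

Lemma approximable_lincomb A k (c : nat -> X -> R[i]) (v : nat -> forall x, E x) :
  (forall i, (i < k)%N -> rel_continuous A (c i)) ->
  (forall i, (i < k)%N -> approximable A (v i)) ->
  approximable A (fun x => lincomb k (c ^~ x) (v ^~ x)).
Proof.
elim: k => [|k IH] cc vv.
  apply: (@approximable_eq _ (fun=> 0)); first by move=> x _; rewrite /lincomb big_ord0.
  by apply: approximable_cs => x; exact: (@section0 _ _ _ b x).
apply: (@approximable_eq _ (fun x => lincomb k (c ^~ x) (v ^~ x) + c k x *: v k x)).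
  by move=> x _; rewrite lincomb_recr.
apply: approximable_add; last by apply: approximable_mul; [exact: cc|exact: vv].
by apply: IH => i ik; [apply: cc|apply: vv]; exact: ltnW.
Qed.

(** For fixed coefficients this is continuity of the norm. The norms at x and at nearby y are
    Lipschitz in the coefficients with the common constant B, so compactness of the box gives a
    single neighborhood, and homogeneity covers all other coefficients. *)
Lemma near_lincomb_dist A k (v : nat -> forall x, E x) x (eta : R) :
  (forall i, (i < k)%N -> approximable A (v i)) -> A x -> 0 < eta ->
  \forall y \near x, A y -> forall c : nat -> R[i],
    `|rnorm (lincomb k c (v ^~ y)) - rnorm (lincomb k c (v ^~ x))| <=
      eta * \sum_(i < k) nrm (c i).
Proof.
move=> vA Ax eta0.
pose B := \sum_(i < k) (rnorm (v i x) + 1) + 1.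
have B0 : 0 < B by rewrite ltr_wpDl// sumr_ge0// => i _; rewrite addr_ge0 ?rnorm_ge0.
pose N y (c : 'rV[R[i]^o]_k) := rnorm (lincomb k (row_ext c) (v ^~ y)).
have NL y (c c' : 'rV[R[i]^o]_k) d : (forall j, nrm (c ord0 j - c' ord0 j) < d) ->
    0 < d -> (forall i : 'I_k, rnorm (v i y) <= rnorm (v i x) + 1) ->
    `|N y c - N y c'| <= d * B.
  move=> h d0 hb; apply: le_trans (rnorm_dist _ _) _.
  rewrite lincombB; apply: le_trans (rnorm_lincomb _ _ _) _.
  rewrite /B mulrDr mulr1 mulr_sumr; apply: le_trans (_ : _ <= \sum_(i < k) d * (rnorm (v i x) + 1)) _.
    by apply: ler_sum => i _; apply: ler_pM; rewrite ?rnorm_ge0// !row_extE ltW.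
  by rewrite lerDl ltW.
have bnd : \forall y \near x, A y -> forall i : 'I_k, rnorm (v i y) <= rnorm (v i x) + 1.
  have : \forall y \near x, forall i : 'I_k, A y -> `|rnorm (v i y) - rnorm (v i x)| <= 1.
    by apply: filter_forall => i; apply: approximable_norm => //; exact: vA.
  apply: filterS => y h Ay i; have := h i Ay.
  by rewrite ler_norml => /andP[_ ?]; lra.
have box : \forall y \near x, forall c, @cbox R k c -> A y -> `|N y c - N x c| <= eta.
  have /compact_near_coveringP := @cbox_compact R k.
  apply=> c _.
  have e0 : 0 < eta / (3 * B) by rewrite divr_gt0// mulr_gt0.
  have e3 : 0 < eta / 3 by rewrite divr_gt0.
  have lc : approximable A (fun y => lincomb k (row_ext c) (v ^~ y)).
    by apply: (approximable_lincomb (c := fun i _ => row_ext c i)) => // i _; exact: rel_continuous_cst.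
  exists ([set c' : 'rV[R[i]^o]_k | forall j, nrm (c ord0 j - c' ord0 j) < eta / (3 * B)],
     [set y | (A y -> forall i : 'I_k, rnorm (v i y) <= rnorm (v i x) + 1) /\
        (A y -> `|N y c - N x c| <= eta / 3)]) => /=.
    by split; [exact: near_coord|apply: filterI bnd _; exact: (approximable_norm lc)].
  move=> [c' y] /= [hc [hb hn]] Ay.
  have h1 := NL y c c' _ hc e0 (hb Ay).
  have h2 := NL x c c' _ hc e0 (fun i => ler_wpDr ler01 (lexx _)).
  have := hn Ay.
  have E3 : eta / (3 * B) * B = eta / 3 by field; rewrite gt_eqF.
  move: h1 h2; rewrite E3 !ler_norml => /andP[? ?] /andP[? ?] /andP[? ?].
  by apply/andP; split; lra.
apply: filterS box => y h Ay c; set M := \sum_(i < k) _.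
have := csum_ge0 k c; rewrite le_eqVlt -/M => /orP[/eqP M0|M0].
  have c0 i : (i < k)%N -> c i = 0.
    move=> ik; apply: (@rnorm_eq0 _ R[i]^o); apply/eqP; rewrite eq_le rnorm_ge0 andbT M0.
    rewrite /M (bigD1 (Ordinal ik))//= lerDl.
    by apply: sumr_ge0 => j _; exact: rnorm_ge0.
  have z y' : lincomb k c (v ^~ y') = 0.
    by rewrite /lincomb big1// => i _; rewrite c0// scale0r.
  by rewrite !z !rnorm0 subrr normr0 -M0 mulr0.
have [c' [c'B _ cc']] := csum_normalize M0.
have z y' : lincomb k c (v ^~ y') = M%:C *: lincomb k (row_ext c') (v ^~ y').
  by rewrite -lincombZ; apply: eq_lincomb => i /cc'.
rewrite !z !rnormZr ?(ltW M0)// -mulrBr normrM (ger0_norm (ltW M0)) mulrC.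
by rewrite ler_pM2r//; exact: h.
Qed.

(** The lower bound kap at x survives nearby with half its value. *)
Lemma near_independent A k (v : nat -> forall x, E x) (x : X) :
  (forall i, (i < k)%N -> approximable A (v i)) -> A x -> independent k (v ^~ x) ->
  \forall y \near x, A y -> independent k (v ^~ y).
Proof.
move=> vA Ax /independent_lower_bound[kap kap0 hk].
have kap2 : 0 < kap / 2 by rewrite divr_gt0.
apply: filterS (near_lincomb_dist vA Ax kap2) => y h Ay c c0 i ik.
have := h Ay c; rewrite c0 rnorm0 sub0r normrN ger0_norm ?rnorm_ge0// => h1.
have := hk c; have := csum_ge0 k c; set M := \sum_(i < k) _ in h1 * => M0 h2.
have Mz : M = 0 by nra.
apply: (@rnorm_eq0 _ R[i]^o); apply/eqP; rewrite eq_le rnorm_ge0 andbT -Mz.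
rewrite /M (bigD1 (Ordinal ik))//= lerDl.
by apply: sumr_ge0 => j _; exact: rnorm_ge0.
Qed.

End Approximable.

(** * Distances to spans and orthogonalisation *)

Section Frames.
Variables (R : realType) (X : topologicalType).
Hypotheses (cX : compact [set: X]) (hX : hausdorff_space X).
Variables (E : X -> completeNormedModType R[i]) (b : hbundle E).
Hypothesis fE : is_fbundle b.

Local Notation nrm a := (rnorm (a : R[i]^o)).
Local Notation cs := (continuous_section b).
Local Notation approximable := (approximable b).

Definition snoc (V : Type) k (e : nat -> V) (v : V) (i : nat) : V :=
  if i == k then v else e i.

Lemma lincomb_snoc (V : lmodType R[i]) k c (e : nat -> V) v :
  lincomb k.+1 c (snoc k e v) = lincomb k c e + c k *: v.
Proof.
rewrite lincomb_recr {2}/snoc eqxx; congr (_ + _); apply: eq_lincomb => i ik.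
by rewrite /snoc ltn_eqF.
Qed.

(** A residual is a combination with last coefficient 1, so the estimates uniform in all
    combinations apply to distances to a span. *)
Lemma snoc_residual (V : lmodType R[i]) k c (e : nat -> V) v :
  lincomb k.+1 (snoc k (fun i => - c i) 1) (snoc k e v) = v - lincomb k c e.
Proof.
rewrite lincomb_snoc {2}/snoc eqxx scale1r addrC; congr (_ + _).
rewrite -scaleN1r -lincombZ; apply: eq_lincomb => i ik.
by rewrite /snoc ltn_eqF// mulN1r.
Qed.

Lemma csum_snoc k (c : nat -> R[i]) :
  \sum_(i < k.+1) nrm (snoc k (fun i => - c i) 1 i) = \sum_(i < k) nrm (c i) + 1.
Proof.
rewrite big_ord_recr /=; congr (_ + _); last first.
  by rewrite /snoc eqxx /rnorm normr1.
by apply: eq_bigr => i _; rewrite /snoc /= ltn_eqF// /rnorm normrN.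
Qed.

Definition gap (V : normedModType R[i]) k (e : nat -> V) (v : V) : R :=
  inf [set rnorm (v - lincomb k c e) | c in [set: nat -> R[i]]].

Lemma gap_has_inf (V : normedModType R[i]) k (e : nat -> V) (v : V) :
  has_inf [set rnorm (v - lincomb k c e) | c in [set: nat -> R[i]]].
Proof.
split; first by exists (rnorm (v - lincomb k (fun=> 0) e)), (fun=> 0).
by exists 0 => _ [c _ <-]; exact: rnorm_ge0.
Qed.

Lemma gap_le (V : normedModType R[i]) k (e : nat -> V) (v : V) c :
  gap k e v <= rnorm (v - lincomb k c e).
Proof. by apply: ge_inf; [case: (gap_has_inf k e v)|exists c]. Qed.

Lemma le_gap (V : normedModType R[i]) k (e : nat -> V) (v : V) r :
  (forall c, r <= rnorm (v - lincomb k c e)) -> r <= gap k e v.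
Proof.
by move=> h; apply: lb_le_inf; [case: (gap_has_inf k e v)|move=> _ [c _ <-]].
Qed.

(* A nearly best approximation of v by the e_i at one point remains one nearby,
   and nearly best approximations form a convex set. *)
Lemma continuous_projection A k (e : nat -> forall x, E x) v : closed A ->
  (forall i, (i < k)%N -> approximable A (e i)) -> approximable A v ->
  (forall x, A x -> independent k.+1 (snoc k (e ^~ x) (v x))) ->
  exists2 g : nat -> X -> R[i]^o, (forall i, continuous (g i)) &
    forall y, A y -> rnorm (v y - lincomb k (g ^~ y) (e ^~ y)) <=
      2 * gap k (e ^~ y) (v y).
Proof.
move=> cA eA vA ind.
(* The class asks for continuous coefficients rather than continuous sections, so gluing produces
   the coefficients g directly. *)
pose L : set (forall x, E x) := fun t =>
  exists2 g : nat -> X -> R[i]^o, (forall i, continuous (g i)) &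
    t = fun y => lincomb k (g ^~ y) (e ^~ y).
have L0 c : L (fun y => lincomb k c (e ^~ y)).
  by exists (fun i _ => c i) => // i x; exact: cvg_cst.
have [] := @approx_glue R X cX hX E L v A (fun y => 2 * gap k (e ^~ y) (v y)).
- exists (fun i _ => 0); first by move=> i x; exact: cvg_cst.
  apply/functional_extensionality_dep => y.
  by rewrite /lincomb big1// => i _; rewrite scale0r.
- move=> _ _ [g gc ->] [g' gc' ->]; exists (fun i y => g i y + g' i y).
    by move=> i x; apply: cvgD; [exact: gc|exact: gc'].
  by apply/functional_extensionality_dep => y; rewrite lincombD.
- move=> h _ hc [g gc ->]; exists (fun i y => (h y)%:C * g i y).
    move=> i x; apply: cvgM; last exact: gc.
    exact: (realC_comp_continuous hc).
  by apply/functional_extensionality_dep => y; rewrite lincombZ.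
- move=> x; have [Ax|nAx] := pselect (A x); last first.
    exists (fun y => lincomb k (fun=> 0) (e ^~ y)); first exact: L0.
    have : nbhs x (~` A) by apply: open_nbhs_nbhs; split => //; exact: closed_openC.
    by apply: filterS => y.
  have [kap kap0 hk] := independent_lower_bound (ind x Ax).
  have kap_res (c : nat -> R[i]) : kap * (\sum_(i < k) nrm (c i) + 1) <=
      rnorm (v x - lincomb k c (e ^~ x)).
    by rewrite -csum_snoc -snoc_residual.
  pose d := gap k (e ^~ x) (v x).
  have d0 : 0 < d.
    apply: (lt_le_trans kap0); apply: le_gap => c.
    by apply: le_trans (kap_res c); have := csum_ge0 k c; nra.
  have d2 : 0 < d / 2 by rewrite divr_gt0.
  have [_ [c0 _ <-] hc0] := inf_adherent d2 (gap_has_inf k (e ^~ x) (v x)).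
  rewrite -/(gap _ _ _) -/d in hc0.
  exists (fun y => lincomb k c0 (e ^~ y)); first exact: L0.
  pose S := \sum_(i < k) nrm (c0 i) + 1.
  have S0 : 0 < S by rewrite ltr_wpDl ?csum_ge0.
  (* At x the residual of c0 is below 3d/2, and near x it grows by at most [eta * S <= d / 4], hence
     stays below 7d/4. Since [eta <= kap / 8], every residual loses at most an eighth, so the gap
     near x is at least 7d/8, half of that. *)
  pose eta := Num.min (kap / 8) (d / (4 * S)).
  have eta0 : 0 < eta by rewrite lt_min !divr_gt0// mulr_gt0.
  have etak : eta <= kap / 8 by rewrite ge_min lexx.
  have etaS : eta * S <= d / 4.
    have h : eta <= d / (4 * S) by rewrite ge_min lexx orbT.
    apply: le_trans (ler_wpM2r (ltW S0) h) _.
    by rewrite le_eqVlt; apply/orP; left; apply/eqP; field; rewrite gt_eqF.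
  have wA i : (i < k.+1)%N -> approximable A (fun y => snoc k (e ^~ y) (v y) i).
    rewrite /snoc ltnS leq_eqVlt => /orP[/eqP->|ik]; first by rewrite eqxx.
    by rewrite ltn_eqF//; exact: eA.
  apply: filterS (near_lincomb_dist cX fE
    (v := fun i y => snoc k (e ^~ y) (v y) i) wA Ax eta0) => y h Ay.
  have {}h (c : nat -> R[i]) : `|rnorm (v y - lincomb k c (e ^~ y)) - rnorm (v x - lincomb k c (e ^~ x))|
      <= eta * (\sum_(i < k) nrm (c i) + 1).
    have := h Ay (snoc k (fun i => - c i) 1); rewrite csum_snoc.
    by rewrite !(snoc_residual k c).
  have h1 := h c0; rewrite -/S in h1.
  have h2 : d * (7 / 8) <= gap k (e ^~ y) (v y).
    apply: le_gap => c; have := h c; have := kap_res c.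
    have := gap_le k (e ^~ x) (v x) c; rewrite -/d.
    have := csum_ge0 k c; set M := \sum_(i < k) _ => M0 g1 g2.
    rewrite ler_norml => /andP[g3 _].
    have : eta * (M + 1) <= kap / 8 * (M + 1) by rewrite ler_wpM2r// addr_ge0.
    by lra.
  by move: h1; rewrite ler_norml => /andP[_ ?]; lra.
by move=> t [g gc ->] ht; exists g.
Qed.

Definition is_frame k (C : R) (V : normedModType R[i]) (e : nat -> V) :=
  (forall i, (i < k)%N -> rnorm (e i) <= 1) /\
  forall (c : nat -> R[i]) j, (j < k)%N -> nrm (c j) <= C * rnorm (lincomb k c e).

Lemma is_frame_independent k C (V : normedModType R[i]) (e : nat -> V) :
  is_frame k C e -> independent k e.
Proof.
move=> [_ h] c c0 i ik; have := h c i ik; rewrite c0 rnorm0 mulr0 => c1.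
by apply: (@rnorm_eq0 _ R[i]^o); apply/eqP; rewrite eq_le rnorm_ge0 andbT.
Qed.

(** The new unit vector f is at distance at least 1/2 from the span of the old ones, so its
    coefficient in a vector w is at most [2 * rnorm w]. Removing that term leaves a vector of norm
    at most [3 * rnorm w], which is the factor 3. *)
Lemma is_frame_snoc k C (V : normedModType R[i]) (e : nat -> V) v g (r : R) : 1 <= C ->
  is_frame k C e -> 0 < rnorm (v - lincomb k g e) ->
  rnorm (v - lincomb k g e) <= 2 * gap k e v ->
  r = rnorm (v - lincomb k g e) ->
  is_frame k.+1 (3 * C) (snoc k e (r^-1%:C *: (v - lincomb k g e))).
Proof.
move=> C1 [e1 eC] u0 ug ->.
set u := v - _ in u0 ug *; set f := _ *: u.
have f1 : rnorm f = 1 by rewrite rnormZr ?invr_ge0 ?(ltW u0)// mulVf// gt_eqF.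
have key (c : nat -> R[i]) : nrm (c k) <= 2 * rnorm (lincomb k.+1 c (snoc k e f)).
  rewrite lincomb_snoc; have [->|ck] := eqVneq (c k) 0.
    by rewrite rnorm0 mulr_ge0 ?rnorm_ge0.
  pose a := c k * (rnorm u)^-1%:C.
  have a0 : a != 0.
    by rewrite mulf_neq0// eq_complex /= negb_and invr_eq0 gt_eqF.
  (* A combination with nonzero last coefficient is a multiple of some residual of v, and [gap]
     bounds it from below. *)
  have -> : lincomb k c e + c k *: f =
      a *: (v - lincomb k (fun i => g i - a^-1 * c i) e).
    rewrite -lincombB lincombZ opprB addrCA [RHS]scalerDr [a *: (_ *: _)]scalerA.
    by rewrite mulfV// scale1r /f scalerA.
  have := gap_le k e v (fun i => g i - a^-1 * c i); rewrite rnormZ.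
  have -> : complex.Re `|a| = nrm (c k) / rnorm u.
    rewrite /a -[complex.Re _]/(nrm (c k * (rnorm u)^-1%:C)) mulrC.
    by rewrite -[_ * c k]/((rnorm u)^-1%:C *: (c k : R[i]^o)) rnormZr ?invr_ge0 ?(ltW u0)// mulrC.
  set N := rnorm (v - _) => gN.
  have ck0 : 0 <= nrm (c k) by exact: rnorm_ge0.
  have : nrm (c k) / rnorm u * rnorm u <= nrm (c k) / rnorm u * (2 * N).
    by rewrite ler_wpM2l ?divr_ge0 ?rnorm_ge0//; lra.
  by rewrite divfK ?gt_eqF//; lra.
split=> [i|c j].
  rewrite ltnS leq_eqVlt /snoc => /orP[/eqP->|ik]; first by rewrite eqxx f1.
  by rewrite ltn_eqF// e1.
have hN := rnorm_ge0 (lincomb k.+1 c (snoc k e f)).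
rewrite ltnS leq_eqVlt => /orP[/eqP->|jk].
  by apply: le_trans (key c) _; rewrite ler_wpM2r//; lra.
apply: le_trans (eC c j jk) _; rewrite -mulrA mulrCA ler_wpM2l//; first lra.
have -> : lincomb k c e = lincomb k.+1 c (snoc k e f) - c k *: f.
  by rewrite lincomb_snoc addrK.
have := key c; have := rnormD (lincomb k.+1 c (snoc k e f)) (- (c k *: f)).
by rewrite -scaleNr rnormZ f1 normrN -[complex.Re _]/(nrm (c k)); lra.
Qed.

End Frames.

Section FrameExistence.
Variables (R : realType) (X : topologicalType).
Hypotheses (cX : compact [set: X]) (hX : hausdorff_space X).
Variables (E : X -> completeNormedModType R[i]) (b : hbundle E).
Hypothesis fE : is_fbundle b.

Local Notation nrm a := (rnorm (a : R[i]^o)).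
Local Notation approximable := (approximable b).

Lemma rel_continuous_inv_norm A s : approximable A s ->
  (forall x, A x -> 0 < rnorm (s x)) ->
  rel_continuous A (fun x => (rnorm (s x))^-1%:C).
Proof.
move=> sA s0 x Ax e e0; set r := rnorm (s x).
have r0 : 0 < r by exact: s0.
(* The first bound keeps the denominator of the difference of inverses above r^2 / 2, the second its
   numerator below e r^2 / 2. *)
have d0 : 0 < Num.min (r / 2) (e * r ^+ 2 / 2).
  by rewrite lt_min !divr_gt0// mulr_gt0// exprn_gt0.
apply: filterS (approximable_norm fE sA Ax d0) => y h Ay; have := h Ay.
rewrite le_min -/r => /andP[h1 h2].
have ry : r / 2 <= rnorm (s y) by move: h1; rewrite ler_norml => /andP[? _]; lra.
have y0 : 0 < rnorm (s y) by exact: s0.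
rewrite -rmorphB /rnorm normc_def /= expr0n addr0 sqrtr_sqr -/(rnorm (s y)).
rewrite (_ : _ - _ = (r - rnorm (s y)) / (rnorm (s y) * r)); last first.
  by field; rewrite !gt_eqF.
rewrite normrM distrC normfV (gtr0_norm (mulr_gt0 y0 r0)) ler_pdivrMr ?mulr_gt0//.
apply: le_trans h2 _.
have : e * r * (r / 2) <= e * r * rnorm (s y) by rewrite ler_wpM2l// mulr_ge0// ltW.
by lra.
Qed.

(** The inclusion of spans carries the induction: it keeps [v k] outside the span of the first k
    frame vectors, so that the residual to be normalised never vanishes on A. *)
Lemma exists_frame A k (v : nat -> forall x, E x) : closed A ->
  (forall i, (i < k)%N -> approximable A (v i)) ->
  (forall x, A x -> independent k (v ^~ x)) ->
  exists e : nat -> forall x, E x,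
    (forall i, (i < k)%N -> approximable A (e i)) /\
    forall x, A x -> is_frame k (3 ^+ k) (e ^~ x) /\
      forall c, exists c', lincomb k c (e ^~ x) = lincomb k c' (v ^~ x).
Proof.
move=> cA; elim: k => [|k IH] vA vind.
  by exists v; split=> // x Ax; split=> [|c]; [split|exists c].
have [||e [eA eP]] := IH.
- by move=> i ik; apply: vA; exact: ltnW.
- move=> x Ax c c0 i ik.
  have := vind x Ax (snoc k c 0); rewrite lincomb_recr {2}/snoc eqxx scale0r addr0.
  rewrite (@eq_lincomb _ _ _ _ c (v ^~ x) (v ^~ x)) => [/(_ c0 i (ltnW ik))|j jk].
    by rewrite /snoc ltn_eqF.
  by rewrite /snoc ltn_eqF.
have ind x : A x -> independent k.+1 (snoc k (e ^~ x) (v k x)).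
  move=> Ax c; rewrite lincomb_snoc; have [fr sp] := eP x Ax.
  have [c' cc'] := sp c; rewrite cc' => h.
  have ck : c k = 0.
    have := vind x Ax (snoc k c' (c k)); rewrite lincomb_recr {2}/snoc eqxx.
    rewrite (@eq_lincomb _ _ _ _ c' (v ^~ x) (v ^~ x)) => [/(_ h k (ltnSn k))|j jk].
      by rewrite /snoc eqxx.
    by rewrite /snoc ltn_eqF.
  move=> i; rewrite ltnS leq_eqVlt => /orP[/eqP->//|ik].
  apply: (is_frame_independent fr) => //.
  by rewrite cc'; move: h; rewrite ck scale0r addr0.
have vkA : approximable A (v k) by exact: vA.
have [g gc gP] := continuous_projection cX hX fE cA eA vkA ind.
pose u x := v k x - lincomb k (g ^~ x) (e ^~ x).
have uE x : u x = lincomb k.+1 (snoc k (fun i => - g i x) 1) (snoc k (e ^~ x) (v k x)).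
  by rewrite (snoc_residual k (g ^~ x)).
have u0 x : A x -> 0 < rnorm (u x).
  move=> Ax; rewrite lt_neqAle rnorm_ge0 andbT; apply/eqP => /esym/rnorm_eq0.
  rewrite uE => /(ind x Ax)/(_ k (ltnSn k)) /eqP.
  by rewrite /snoc eqxx oner_eq0.
have uA : approximable A u.
  apply: (approximable_eq (s := fun x => lincomb k.+1
      (snoc k (fun i => - g i x) 1) (snoc k (e ^~ x) (v k x)))).
    by move=> x _; rewrite uE.
  apply: (approximable_lincomb cX fE
    (c := fun i x => snoc k (fun i => - g i x) 1 i)
    (v := fun i x => snoc k (e ^~ x) (v k x) i)) => i.
    rewrite /snoc; case: eqP => _ _; first exact: rel_continuous_cst.
    by apply: rel_continuous_cts => x; apply: cvgN; exact: gc.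
  rewrite ltnS leq_eqVlt /snoc => /orP[/eqP->|ik]; first by rewrite eqxx.
  by rewrite ltn_eqF//; exact: eA.
pose f x : E x := (rnorm (u x))^-1%:C *: u x.
exists (fun i x => snoc k (e ^~ x) (f x) i); split=> [i|x Ax].
  rewrite ltnS leq_eqVlt /snoc => /orP[/eqP->|ik]; last by rewrite ltn_eqF//; exact: eA.
  rewrite eqxx; apply: (approximable_mul cX fE (f := fun x => (rnorm (u x))^-1%:C)) => //.
  exact: rel_continuous_inv_norm.
have [fr sp] := eP x Ax; split.
  rewrite exprS; apply: is_frame_snoc => //.
  - by rewrite exprn_ege1// ler1n.
  - exact: (u0 x Ax).
  - exact: gP.
move=> c; pose r := c k * (rnorm (u x))^-1%:C.
have [c' cc'] := sp (fun i => c i - r * g i x).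
exists (snoc k c' r); rewrite (lincomb_snoc k c) lincomb_recr {2}/snoc eqxx.
rewrite (@eq_lincomb _ _ _ _ c' (v ^~ x) (v ^~ x)); last first.
  by move=> j jk; rewrite /snoc ltn_eqF.
rewrite -cc' -lincombB lincombZ /f scalerA -/r /u scalerBr.
by rewrite addrAC addrA.
Qed.

End FrameExistence.

(** * Coordinates in finite dimension *)

Section Coordinates.
Variables (R : realType) (V : lmodType R[i]).

Definition row_coord d (f : {linear V -> 'rV[R[i]]_d}) (M : 'M[R[i]]_d) (j : nat)
    (w : V) : R[i]^o :=
  if insub j is Some j' then (f w *m M) ord0 j' else 0.

Lemma row_coord_is_linear d f M j : linear (@row_coord d f M j).
Proof.
move=> a u v; rewrite /row_coord; case: insub => [j'|]; last by rewrite scaler0 addr0.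
by rewrite linearP mulmxDl -scalemxAl !mxE.
Qed.
HB.instance Definition _ d f M j := GRing.isLinear.Build R[i] V R[i]^o _
  (@row_coord d f M j) (@row_coord_is_linear d f M j).

Lemma linear_lincomb (W : lmodType R[i]) (f : {linear V -> W}) k c v :
  f (lincomb k c v) = lincomb k c (f \o v).
Proof. by rewrite /lincomb linear_sum; apply: eq_bigr => i _; rewrite linearZ. Qed.

Lemma lincomb_mulmx d k (c : nat -> R[i]) (v : nat -> 'rV[R[i]]_d) :
  lincomb k c v = \row_(i < k) c i *m \matrix_(i < k) v i.
Proof.
rewrite mulmx_sum_row; apply: eq_bigr => i _.
by rewrite mxE rowK.
Qed.

Lemma has_dim_basis d : has_dim V d -> exists v : nat -> V, independent d v.
Proof.
move=> [f [g fK gK]].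
exists (fun i => g (if insub i is Some j then delta_mx 0 j else 0)) => c.
move=> /(congr1 f); rewrite linear_lincomb linear0 lincomb_mulmx => h i id.
rewrite (_ : \matrix_(i < d) _ = 1%:M) ?mulmx1 in h; last first.
  by apply/row_matrixP => j; rewrite rowK /= gK valK row1.
by have := congr1 (fun M : 'rV_d => M ord0 (Ordinal id)) h; rewrite !mxE.
Qed.

Lemma independent_row_free d k (f : {linear V -> 'rV[R[i]]_d}) (v : nat -> V) :
  bijective f -> independent k v -> row_free (\matrix_(i < k) f (v i)).
Proof.
move=> /bij_inj fi iv; apply: inj_row_free => u uM; apply/rowP => i.
pose c (j : nat) := if insub j is Some j' then u ord0 j' else 0.
have uc : u = \row_(i < k) c i by apply/rowP => j; rewrite mxE /c valK.
have : lincomb k c v = 0.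
  by apply: fi; rewrite linear_lincomb linear0 lincomb_mulmx -uc.
by move=> /iv/(_ i (ltn_ord i)); rewrite /c valK mxE.
Qed.

Lemma independent_le_dim d k (v : nat -> V) : has_dim V d -> independent k v ->
  (k <= d)%N.
Proof.
move=> [f fb] iv; have := independent_row_free fb iv.
by rewrite /row_free => /eqP <-; exact: rank_leq_col.
Qed.

Lemma independent_coords d (v : nat -> V) : has_dim V d -> independent d v ->
  exists phi : nat -> {linear V -> R[i]^o},
    forall w, w = lincomb d (fun i => phi i w) v.
Proof.
move=> [f fb] iv; have Mf := independent_row_free fb iv.
set M := \matrix_(i < d) _ in Mf.
exists (fun i => row_coord f (invmx M) i : {linear V -> R[i]^o}) => w.
apply: (bij_inj fb); rewrite linear_lincomb lincomb_mulmx.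
rewrite (_ : \row_(i < d) _ = f w *m invmx M); last first.
  by apply/rowP => i; rewrite mxE /= /row_coord valK.
by rewrite mulmxKV// -row_free_unit.
Qed.

End Coordinates.

(** * Coordinates over the strata *)

Section Strata.
Variables (R : realType) (X : topologicalType).
Hypotheses (cX : compact [set: X]) (hX : hausdorff_space X).
Variables (E : X -> completeNormedModType R[i]) (b : hbundle E).
Hypothesis fE : is_fbundle b.

Local Notation nrm a := (rnorm (a : R[i]^o)).
Local Notation cs := (continuous_section b).
Local Notation approximable := (approximable b).
Local Notation pt v := (point b (Tagged E v)).

Lemma section_through (x : X) (v : E x) : exists2 s, cs s & s x = v.
Proof.
have [s sc sx] := enough_sections cX hX b x (dfwith (fun y => 0 : E y) x v).
by exists s => //; rewrite sx dfwithin.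
Qed.

Definition dim_lt (n : nat) : set X :=
  [set x | exists2 k, (k < n)%N & has_dim (E x) k].

Lemma dim_lt0 : dim_lt 0 = set0.
Proof. by apply/seteqP; split=> // x []. Qed.

Lemma dim_ltS n : dim_lt n.+1 = dim_le E n.
Proof. by []. Qed.

(** The dimension is lower semicontinuous: sections through a basis of one fibre stay independent in
    nearby fibres. *)
Lemma dim_lt_closed n : subhomogeneous E -> closed (dim_lt n).
Proof.
move=> [D hD]; rewrite -[dim_lt n]setCK; apply: open_closedC; rewrite openE => x nx.
have [k _ hk] : dim_le E D x by rewrite hD.
have nk : (n <= k)%N by rewrite leqNgt; apply/negP => kn; apply: nx; exists k.
have [v iv] := has_dim_basis hk.
have /choice[s sP] (i : nat) : exists s, cs s /\ s x = v i.
  by have [s sc sx] := section_through (v i); exists s.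
have sA i : (i < k)%N -> approximable setT (s i).
  by move=> _; apply: approximable_cs; case: (sP i).
have ix : independent k (s ^~ x).
  move=> c; rewrite (@eq_lincomb _ _ _ _ c (s ^~ x) v); first exact: iv.
  by move=> i _; split => //; case: (sP i).
have := near_independent cX fE sA I ix.
apply: filterS => y /(_ I) iy [j jn hj].
by have := independent_le_dim hj iy; rewrite leqNgt (leq_trans jn).
Qed.

Lemma approximable_sub (A B : set X) s : A `<=` B -> approximable B s -> approximable A s.
Proof.
move=> AB sB x Ax e e0; have [t tc st] := sB x (AB x Ax) e e0; exists t => //.
by apply: filterS st => y h /AB.
Qed.

(** A basis of the model space V, taken from one fibre, is transported by psi. The resulting
    sections live over U only; they are approximable since near each point they are close to a
    global section with the same value there. *)
Lemma trivial_basis d (U : set X) : U `<=` stratum E d -> trivial_over b U ->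
  exists v : nat -> forall x, E x, (forall i, approximable U (v i)) /\
    forall x, U x -> independent d (v ^~ x).
Proof.
move=> Ud [V [phi [psi [pp _ psic]]]].
have [U0|/set0P[x0 Ux0]] := eqVneq U set0.
  by exists (fun _ _ => 0); split=> [i x|x]; rewrite U0.
have [v0 iv0] := has_dim_basis (Ud x0 Ux0).
pose w i : V := phi x0 (v0 i).
have iw : independent d w.
  move=> c; rewrite -(linear_lincomb (phi x0)) => h; apply: iv0.
  by apply: (can_inj (pp x0 Ux0).1); rewrite h linear0.
exists (fun i x => psi x (w i)); split=> [i x Ux e e0|x Ux c h].
  have [t tc tx] := section_through (psi x (w i)).
  have [|A [B [xA xB AB]]] := @near_sub _ _ _ b x (psi x (w i)) (t x) e.
    by rewrite tx subrr rnorm0.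
  exists t => //.
  have /subspace_continuousP := psic.
  move=> /(_ (x, w i) (conj Ux I) A xA) [[P Q] /= [xP wQ] PQ].
  have tB : \forall y \near x, B (pt (t y)) by exact: tc.
  apply: filterS2 xP tB => y Py By Uy; apply/ltW/AB => //.
  apply: (PQ (y, w i)) => //; split => //=; exact: nbhs_singleton.
apply: iw; have := congr1 (phi x) h; rewrite linear0 linear_lincomb.
rewrite (@eq_lincomb _ _ _ _ c _ w) => // i _; split => //=.
by rewrite (pp x Ux).2.
Qed.

(** Subtracting the combination with coefficients frozen at x gives a section that vanishes at x;
    near x its norm is small, and the frame bound passes this on to the coefficients. *)
Lemma frame_coefficients_continuous A k C e s (c : nat -> X -> R[i]) :
  (forall i, (i < k)%N -> approximable A (e i)) -> approximable A s ->
  (forall x, A x -> is_frame k C (e ^~ x)) ->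
  (forall x, A x -> s x = lincomb k (c ^~ x) (e ^~ x)) ->
  forall i, (i < k)%N -> rel_continuous A (c i).
Proof.
move=> eA sA fr sc i ik x Ax eps eps0.
pose g y := s y + lincomb k (fun i => - c i x) (e ^~ y).
have gA : approximable A g.
  apply: (approximable_add cX) => //.
  apply: (approximable_lincomb cX fE (c := fun i _ => - c i x)) => // j _.
  exact: rel_continuous_cst.
have gE y : A y -> g y = lincomb k (fun i => c i y - c i x) (e ^~ y).
  by move=> Ay; rewrite /g sc// lincombD.
have d0 : 0 < eps / (`|C| + 1) by rewrite divr_gt0// ltr_wpDl.
apply: filterS (approximable_norm fE gA Ax d0) => y h Ay.
have [_ /(_ (fun i => c i y - c i x) i ik)] := fr y Ay; rewrite -gE//.
move=> /le_trans; apply; have := h Ay.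
have -> : g x = 0.
  by rewrite (gE x Ax) /lincomb big1// => j _; rewrite subrr scale0r.
rewrite rnorm0 subr0 ger0_norm ?rnorm_ge0// => {}h.
have C1 : 0 < `|C| + 1 by rewrite ltr_wpDl.
apply: (@le_trans _ _ ((`|C| + 1) * rnorm (g y))).
  by rewrite ler_wpM2r ?rnorm_ge0//; have := ler_norm C; lra.
by rewrite mulrC -ler_pdivlMr.
Qed.

(** Each point is assigned one of the [O i] containing it, or [None] off K; the functions of a
    partition of unity with the same label are added. Those labelled [None] vanish on K. *)
Lemma finite_partition m (O : 'I_m -> set X) (K : set X) : closed K ->
  (forall i, open (O i)) -> K `<=` \bigcup_i O i ->
  exists h : 'I_m -> X -> R,
  [/\ forall i, continuous (h i), forall i y, 0 <= h i y <= 1,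
      forall y, K y -> \sum_i h i y = 1 &
      forall i y, ~ O i y -> \forall z \near y, h i z = 0].
Proof.
move=> cK oO KO.
have /choice[w wP] (x : X) : exists w : option 'I_m,
    if w is Some i then O i x else ~ K x.
  have [/KO[i _ Ox]|nK] := pselect (K x); first by exists (Some i).
  by exists None.
have Un (x : X) : nbhs x (if w x is Some i then O i else ~` K).
  have := wP x; case: (w x) => [i|] h; apply: open_nbhs_nbhs; split => //.
  exact: closed_openC.
have [n [c [h [hc h0 h1 hU]]]] := @partition_of_unity R X cX hX _ Un.
exists (fun i y => \sum_(t < n) if w (c t) == Some i then h t y else 0); split.
- move=> i; apply: (@continuous_fsum R X n R^o) => t.
  by case: (w (c t) == Some i); [exact: hc|move=> y; exact: cvg_cst].
- move=> i y; apply/andP; split.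
    by apply: sumr_ge0 => t _; case: ifP.
  by rewrite -(h1 y); apply: ler_sum => t _; case: ifP.
- move=> y Ky; rewrite exchange_big -(h1 y); apply: eq_bigr => t _ /=.
  case Ewt: (w (c t)) => [i|].
    rewrite (bigD1 i)//= eqxx big1 ?addr0// => j ji.
    by case: eqP => // -[ij]; rewrite ij eqxx in ji.
  rewrite big1//; symmetry; apply: (nbhs_singleton (hU t y _)).
  by rewrite Ewt; apply.
- move=> i y nO.
  have : \forall z \near y, forall t : 'I_n, w (c t) = Some i -> h t z = 0.
    apply: filter_forall => t; have [Ewt|ne] := eqVneq (w (c t)) (Some i).
      have : \forall z \near y, h t z = 0 by apply: hU; rewrite Ewt.
      by apply: filterS.
    by apply: nearW => z Ewt; rewrite Ewt eqxx in ne.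
  apply: filterS => z hz; rewrite big1// => t _.
  by case: eqP => // /hz.
Qed.

End Strata.

(** * Extension of frames by zero *)

Section StratumCoordinates.
Variables (R : realType) (X : topologicalType).
Hypotheses (cX : compact [set: X]) (hX : hausdorff_space X).
Variables (E : X -> completeNormedModType R[i]) (b : hbundle E).
Hypothesis fE : is_fbundle b.

Local Notation nrm a := (rnorm (a : R[i]^o)).
Local Notation cs := (continuous_section b).
Local Notation approximable := (approximable b).

Definition supp (q : X -> R) : set X := closure [set y | q y != 0].

Lemma suppPn q (x : X) : ~ supp q x <-> \forall y \near x, q y = 0.
Proof.
split=> [nx|q0 sx].
  have : nbhs x (~` supp q).
    apply: open_nbhs_nbhs; split => //; apply: closed_openC.
    exact: closed_closure.
  apply: filterS => y ny; apply/eqP; apply: contrapT => /negP qy; apply: ny.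
  exact: subset_closure.
by have [y [/= /eqP qy]] := sx _ q0.
Qed.

Lemma supp_eq0 q x : ~ supp q x -> q x = 0.
Proof. by move=> /suppPn/nbhs_singleton. Qed.

(** The product is locally zero off the support of q, so e may be arbitrary there. *)
Lemma approximable_cutoff (Z : set X) (q : X -> R) (e : forall x, E x) :
  continuous q -> (forall x, 0 <= q x <= 1) -> approximable (Z `&` supp q) e ->
  approximable Z (fun x => (q x)%:C *: e x).
Proof.
move=> qc q01 eA x Zx eps eps0.
have [sx|nsx] := pselect (supp q x); last first.
  exists (fun=> 0); first by move=> y; exact: (@section0 _ _ _ b y).
  move/suppPn: nsx; apply: filterS => y -> _.
  by rewrite scale0r subrr rnorm0 ltW.
have [t tc et] := eA x (conj Zx sx) eps eps0.
exists (fun y => (q y)%:C *: t y); first exact: (cs_realmul cX).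
apply: filterS et => y h Zy; have [sy|nsy] := pselect (supp q y); last first.
  by rewrite (supp_eq0 nsy) !scale0r subrr rnorm0 ltW.
have /andP[q0 q1] := q01 y; rewrite -scalerBr rnormZr//.
by apply: le_trans (h (conj Zy sy)); rewrite ler_piMl ?rnorm_ge0.
Qed.

Lemma rel_continuous_cutoff (Z : set X) (q : X -> R) (f : X -> R[i]^o) :
  continuous q -> (forall x, 0 <= q x <= 1) -> rel_continuous (Z `&` supp q) f ->
  rel_continuous Z (fun x => (q x)%:C *: f x).
Proof.
move=> qc q01 fA x Zx eps eps0.
have [sx|nsx] := pselect (supp q x); last first.
  rewrite (supp_eq0 nsx) scale0r; move/suppPn: nsx; apply: filterS => y -> _.
  by rewrite scale0r subrr rnorm0 ltW.
have e2 : 0 < eps / 2 by rewrite divr_gt0.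
have N0 : 0 < nrm (f x) + 1 by rewrite ltr_wpDl ?rnorm_ge0.
have d0 : 0 < eps / 2 / (nrm (f x) + 1) by rewrite divr_gt0.
have /cvgrPdist_lt/(_ _ d0) qx := qc x.
apply: filterS2 (fA x (conj Zx sx) _ e2) qx => y h1 h2 Zy.
have -> : (q y)%:C *: f y - (q x)%:C *: f x =
    (q y)%:C *: (f y - f x) + (q y - q x)%:C *: f x.
  by rewrite scalerBr rmorphB scalerBl addrA subrK.
have H1 : rnorm ((q y)%:C *: (f y - f x)) <= eps / 2.
  have /andP[q0 q1] := q01 y; rewrite rnormZr//.
  have [sy|nsy] := pselect (supp q y); last by rewrite (supp_eq0 nsy) mul0r ltW.
  by apply: le_trans (h1 (conj Zy sy)); rewrite ler_piMl ?rnorm_ge0.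
have H2 : rnorm ((q y - q x)%:C *: f x) <= eps / 2.
  rewrite rnormZ normc_def /= expr0n addr0 sqrtr_sqr distrC.
  have : `|q x - q y| * (nrm (f x) + 1) <= eps / 2 by rewrite -ler_pdivlMr// ltW.
  by have := normr_ge0 (q x - q y); have := rnorm_ge0 (f x); nra.
by apply: le_trans (rnormD _ _) _; lra.
Qed.

Lemma local_frame n (A U : set X) : closed A -> A `<=` U -> U `<=` stratum E n ->
  trivial_over b U -> exists (e : nat -> forall x, E x)
    (phi : nat -> forall x, {linear E x -> R[i]^o}),
  [/\ forall j, (j < n)%N -> approximable A (e j),
      forall x, A x -> is_frame n (3 ^+ n) (e ^~ x) &
      forall x v, A x -> v = lincomb n (fun j => phi j x v) (e ^~ x)].
Proof.
move=> cA AU Un tU.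
have [v [vU iv]] := trivial_basis cX hX Un tU.
have [||e [eA eP]] := @exists_frame _ _ cX hX _ _ fE A n v cA.
- by move=> i _; exact: approximable_sub AU (vU i).
- by move=> x /AU; exact: iv.
pose P x (f : nat -> {linear E x -> R[i]^o}) :=
  forall w, w = lincomb n (fun j => f j w) (e ^~ x).
(* The functionals are chosen fibre by fibre, with value zero where no coordinates exist; their
   continuity along sections follows later from the frame bound. *)
pose phi x : nat -> {linear E x -> R[i]^o} :=
  if pselect (exists f, P x f) is left h then projT1 (cid h) else fun=> \0.
exists e, (fun j x => phi x j); split => // [x /eP[]//|x w Ax].
have : exists f, P x f.
  apply: independent_coords; first exact/Un/AU.
  exact: is_frame_independent (eP x Ax).1.
by rewrite /phi; case: pselect => // h _; exact: (projT2 (cid h)).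
Qed.

(** I comes before Z and chi: the number of terms is fixed by the finite cover of the stratum,
    although the frames depend on how close to the lower strata chi reaches. *)
Lemma stratum_coordinates n : conditionally_finite_type b -> exists I : finType,
  forall (Z : set X) (chi : X -> R), closed Z -> continuous chi ->
    (forall x, 0 <= chi x <= 1) -> (Z `&` supp chi `<=` stratum E n) ->
  exists (e : I -> forall x, E x) (kap : I -> forall x, {linear E x -> R[i]^o}),
  [/\ forall p, approximable Z (e p), forall p x, Z x -> rnorm (e p x) <= 1,
      forall p s, cs s -> rel_continuous Z (fun x => kap p x (s x)),
      forall p x v, Z x -> nrm (kap p x v) <= 3 ^+ n * rnorm v &
      forall x v, Z x -> (chi x)%:C *: v = \sum_p kap p x v *: e p x].
Proof.
move=> /(_ n)[m [U [UO sU tU]]]; exists ('I_m * 'I_n)%type => Z chi cZ chic chi01 Zn.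
have /choice[G GP] (i : 'I_m) : exists G, open G /\ U i = stratum E n `&` G.
  by have [G] := UO i; exists G.
have cK : closed (Z `&` supp chi) by apply: closedI => //; exact: closed_closure.
have [||h [hc h01 h1 hO]] := @finite_partition R X cX hX m G _ cK.
- by move=> i; case: (GP i).
- move=> x /Zn; rewrite sU => -[i _]; rewrite (GP i).2 => -[_ Ox].
  by exists i.
(* A square root, because the cutoff is shared between the vectors [e] and the functionals [kap]:
   both extend by zero and the product restores [chi * h i]. *)
pose q i x : R := Num.sqrt (chi x * h i x).
have p0 i x : 0 <= chi x * h i x.
  by have /andP[? _] := chi01 x; have /andP[? _] := h01 i x; exact: mulr_ge0.
have qc i : continuous (q i).
  move=> x; apply: (@continuous_comp _ _ _ (fun x => chi x * h i x) Num.sqrt).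
    by apply: cvgM; [exact: chic|exact: hc].
  exact: sqrt_continuous.
have q01 i x : 0 <= q i x <= 1.
  rewrite sqrtr_ge0 -sqrtr1 ler_wsqrtr//.
  by have /andP[? ?] := chi01 x; have /andP[? ?] := h01 i x; nra.
have suppq i x : supp (q i) x -> supp chi x /\ G i x.
  move=> sx; split; apply: contrapT => nx; case: (suppPn (q i) x) => _; apply => //.
    by move/suppPn: nx; apply: filterS => y y0; rewrite /q y0 mul0r sqrtr0.
  by move: (hO i x nx); apply: filterS => y y0; rewrite /q y0 mulr0 sqrtr0.
(* Closed and contained in [U i]: frames exist over it with no loss towards the boundary of
   [U i]. *)
pose A i := Z `&` supp (q i).
have AU i : A i `<=` U i.
  move=> x [Zx /suppq[cx Ox]]; rewrite (GP i).2; split => //; exact: Zn.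
have cA i : closed (A i) by apply: closedI => //; exact: closed_closure.
have Un i : U i `<=` stratum E n by rewrite (GP i).2 => x [].
have /choice[ep epP] (i : 'I_m) : exists ep : (nat -> forall x, E x) *
    (nat -> forall x, {linear E x -> R[i]^o}),
  [/\ forall j, (j < n)%N -> approximable (A i) (ep.1 j),
      forall x, A i x -> is_frame n (3 ^+ n) (ep.1 ^~ x) &
      forall x v, A i x -> v = lincomb n (fun j => ep.2 j x v) (ep.1 ^~ x)].
  have [e [phi ?]] := local_frame (cA i) (@AU i) (@Un i) (tU i).
  by exists (e, phi).
pose e (p : 'I_m * 'I_n) x := (q p.1 x)%:C *: (ep p.1).1 p.2 x.
pose kap (p : 'I_m * 'I_n) x : {linear E x -> R[i]^o} :=
  ((q p.1 x)%:C \*: (ep p.1).2 p.2 x).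
exists e, kap; split.
- move=> [i j]; apply: approximable_cutoff => //.
  by have [eA _ _] := epP i; exact: eA.
- move=> [i j] x Zx; rewrite /e /=; have /andP[q0 q1] := q01 i x.
  have [sx|/supp_eq0->] := pselect (supp (q i) x); last by rewrite scale0r rnorm0.
  have [_ /(_ x (conj Zx sx))[fr _] _] := epP i.
  by rewrite rnormZr// mulr_ile1 ?rnorm_ge0// fr.
- move=> [i j] s sc; apply: (rel_continuous_cutoff (f := fun x => (ep i).2 j x (s x))) => //.
  have [eA fr co] := epP i.
  apply: (frame_coefficients_continuous cX fE eA _ fr (s := s) (c := fun j x => (ep i).2 j x (s x))) => //.
    exact: approximable_cs.
  by move=> x Ax; exact: co.
- move=> [i j] x v Zx; rewrite /kap /=; have /andP[q0 q1] := q01 i x.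
  have v0 : 0 <= 3 ^+ n * rnorm v by rewrite mulr_ge0 ?exprn_ge0 ?rnorm_ge0.
  have [sx|/supp_eq0->] := pselect (supp (q i) x); last by rewrite scale0r rnorm0.
  have [_ /(_ x (conj Zx sx))[_ fr] co] := epP i.
  rewrite rnormZr//; apply: le_trans (_ : nrm ((ep i).2 j x v) <= _).
    by rewrite ler_piMl ?rnorm_ge0.
  have := fr (fun j => (ep i).2 j x v) j (ltn_ord j).
  by rewrite -(co x v (conj Zx sx)).
- move=> x v Zx; rewrite -(pair_bigA _ (fun i j => kap (i, j) x v *: e (i, j) x)) /=.
  have -> : chi x = \sum_i q i x ^+ 2.
    under eq_bigr do rewrite sqr_sqrtr//.
    rewrite -mulr_sumr; have [sx|/supp_eq0->] := pselect (supp chi x).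
      by rewrite h1 ?mulr1.
    by rewrite mul0r.
  rewrite rmorph_sum scaler_suml; apply: eq_bigr => i _.
  have [sx|/supp_eq0 q0] := pselect (supp (q i) x); last first.
    rewrite q0 expr0n scale0r big1// => j _.
    by rewrite /e /= q0 !scale0r ?scaler0.
  have [_ _ /(_ x v (conj Zx sx)) {1}->] := epP i.
  rewrite /lincomb scaler_sumr; apply: eq_bigr => j _.
  rewrite /kap /e /= !scalerA; congr (_ *: _).
  by rewrite expr2 rmorphM -[_ *: _]/(_ * _) mulrAC.
Qed.

End StratumCoordinates.

(** * Tensor products *)

Section ProjectiveTensorFacts.
Variables (R : realType) (V W : normedModType R[i]).
Local Notation nrm a := (rnorm (a : R[i]^o)).

Lemma tensorDl (m m' : V) (n : W) : tensor (m + m') n = tensor m n + tensor m' n.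
Proof.
rewrite /tensor -linearD; congr to_completion; apply/val_inj/funext => B /=.
rewrite /tensor_sum !big_seq1 /=.
by rewrite -[RHS]/(B m n + B m' n) /alg_tensor linearDl.
Qed.

Lemma tensorDr (m : V) (n n' : W) : tensor m (n + n') = tensor m n + tensor m n'.
Proof.
rewrite /tensor -linearD; congr to_completion; apply/val_inj/funext => B /=.
rewrite /tensor_sum !big_seq1 /=.
by rewrite -[RHS]/(B m n + B m n') /alg_tensor linearDr.
Qed.

Lemma tensorZl a (m : V) (n : W) : tensor (a *: m) n = a *: tensor m n.
Proof.
rewrite /tensor -linearZ; congr to_completion; apply/val_inj/funext => B /=.
rewrite /tensor_sum !big_seq1 /=.
by rewrite -[RHS]/(a * B m n) /alg_tensor linearZl_LR.
Qed.

Lemma rnorm_tensor (m : V) (n : W) : rnorm (tensor m n) <= rnorm m * rnorm n.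
Proof.
rewrite rnorm_to_completion; apply: le_trans (proj_norm_le _) _.
by rewrite /proj_sum big_seq1.
Qed.

Lemma sum_tensorE (l : seq (V * W)) :
  \sum_(z <- l) tensor z.1 z.2 = to_completion (proj_seminorm V W) (atensor_of l).
Proof.
by rewrite atensor_of_sum linear_sum; apply: eq_bigr => -[m n] _.
Qed.

Section Slice.
Variables (phi : {linear V -> R[i]^o}) (d : nat) (f : {linear W -> 'rV[R[i]]_d}).

Definition slice_form (j : 'I_d) (m : V) (n : W) : R[i] := phi m * f n ord0 j.

Lemma slice_form_bilinear j : bilinear_for *%R *%R (slice_form j).
Proof.
split=> [n a m1 m2|m a n1 n2]; rewrite /slice_form linearP.
  have aux (u v w : R[i]) : (a * u + v) * w = a * (u * w) + v * w by ring.
  exact: aux.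
have aux (u v w : R[i]) : u * (a * v + w) = a * (u * v) + u * w by ring.
by rewrite !mxE; exact: aux.
Qed.
HB.instance Definition _ j := bilinear_isBilinear.Build R[i] V W R[i] *%R *%R
  (slice_form j) (slice_form_bilinear j).

(* The value of phi (x) id on a tensor is recovered from its values on the
   bilinear forms phi (x) psi, W being finite dimensional. *)
Lemma slice_well_defined (l s : seq (V * W)) : bijective f ->
  atensor_of l = atensor_of s ->
  \sum_(z <- l) phi z.1 *: z.2 = \sum_(z <- s) phi z.1 *: z.2.
Proof.
move=> /bij_inj fi ls; apply: fi; apply/rowP => j.
have sliceE (t : seq (V * W)) : f (\sum_(z <- t) phi z.1 *: z.2) ord0 j =
    tensor_sum t (slice_form j).
  rewrite linear_sum /tensor_sum summxE fct_sumE; apply: eq_bigr => z _.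
  by rewrite linearZ mxE.
by rewrite !sliceE; have /(congr1 val)/= -> := ls.
Qed.

End Slice.

(** The slice depends on the tensor and not on its representation, so it may be computed from a
    nearly optimal one; the dimension d leaves no trace in the constant. *)
Lemma rnorm_slice (phi : {linear V -> R[i]^o}) d (C : R) (l : seq (V * W)) :
  has_dim W d -> 0 <= C -> (forall v, nrm (phi v) <= C * rnorm v) ->
  rnorm (\sum_(z <- l) phi z.1 *: z.2) <= C * rnorm (\sum_(z <- l) tensor z.1 z.2).
Proof.
move=> [f fb] C0 phiC; rewrite sum_tensorE rnorm_to_completion /=.
apply/ler_addgt0Pl => e e0.
have C1 : 0 < C + 1 by rewrite ltr_wpDl.
have [s ls hs] := proj_norm_approx (atensor_of l) (divr_gt0 e0 C1).
rewrite (slice_well_defined phi fb ls); apply: le_trans (rnorm_sum _ _) _.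
apply: (@le_trans _ _ (C * proj_sum s)).
  rewrite /proj_sum mulr_sumr; apply: ler_sum => z _.
  rewrite rnormZ mulrA ler_wpM2r ?rnorm_ge0//; exact: phiC.
apply: le_trans (ler_wpM2l C0 (ltW hs)) _; rewrite mulrDr addrC lerD2r.
by rewrite mulrCA ler_piMr ?ltW// ltr_pdivrMr// mul1r ltrDl.
Qed.

End ProjectiveTensorFacts.

(** * Balanced tensor products of section modules *)

Section BalancedTensorFacts.
Variables (R : realType) (X : topologicalType) (cX : compact [set: X]).
Variables (E F : X -> completeNormedModType R[i]) (bE : hbundle E) (bF : hbundle F).

Local Notation M := (Gamma bE cX).
Local Notation N := (Gamma bF cX).
Local Notation P := (Gamma_tensor cX bE bF).
Local Notation tens := (@Gamma_tensor_of R X cX E F bE bF).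

Definition mul_section (E' : X -> completeNormedModType R[i]) (b : hbundle E')
    (f : X -> R[i]^o) (fc : continuous f) (s : Gamma b cX) : Gamma b cX :=
  GammaSection cX (@section_mul R X cX E' b f s fc).

Lemma tensDl (s s' : M) (t : N) : tens (s + s') t = tens s t + tens s' t.
Proof. by rewrite /Gamma_tensor_of /balanced_of tensorDl linearD. Qed.

Lemma tensDr (s : M) (t t' : N) : tens s (t + t') = tens s t + tens s t'.
Proof. by rewrite /Gamma_tensor_of /balanced_of tensorDr linearD. Qed.

Lemma tensZl a (s : M) (t : N) : tens (a *: s) t = a *: tens s t.
Proof. by rewrite /Gamma_tensor_of /balanced_of tensorZl linearZ. Qed.

Lemma tens0l (t : N) : tens 0 t = 0.
Proof. by rewrite -(scale0r 0) tensZl scale0r. Qed.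

Lemma tens0r (s : M) : tens s 0 = 0.
Proof. by apply: (@addrI _ (tens s 0)); rewrite addr0 -tensDr addr0. Qed.

Lemma tens_suml (I : Type) (r : seq I) (s : I -> M) (t : N) :
  tens (\sum_(i <- r) s i) t = \sum_(i <- r) tens (s i) t.
Proof. by apply: (big_morph (tens^~ t)) => [u v|]; [exact: tensDl|exact: tens0l]. Qed.

Lemma tens_sumr (I : Type) (r : seq I) (s : M) (t : I -> N) :
  tens s (\sum_(i <- r) t i) = \sum_(i <- r) tens s (t i).
Proof. by apply: (big_morph (tens s)) => [u v|]; [exact: tensDr|exact: tens0r]. Qed.

Lemma tens_balance (f : X -> R[i]^o) (fc : continuous f) (s : M) (t : N) :
  tens (mul_section fc s) t = tens s (mul_section fc t).
Proof.
apply/eqP; rewrite -subr_eq0 /Gamma_tensor_of /balanced_of -linearB; apply/eqP.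
apply/cspan_pi_eq0/sub_cspan; exists (mkcts fc : CX R X), s, t.
by congr (_ - _); congr tensor; apply: gammaP.
Qed.

Lemma rnorm_cspan_pi (V : normedModType R[i]) (S : set V) (v : V) :
  rnorm (cspan_pi S v) <= rnorm v.
Proof.
rewrite rnorm_sep; apply: le_trans (cspan_dist_le _ (cspan0 _)) _.
by rewrite subr0.
Qed.

Lemma rnorm_tens (s : M) (t : N) : rnorm (tens s t) <= rnorm s * rnorm t.
Proof. exact: le_trans (rnorm_cspan_pi _ _) (rnorm_tensor _ _). Qed.

Lemma rnorm_gamma_le (E' : X -> completeNormedModType R[i]) (b : hbundle E')
  (s : Gamma b cX) c : 0 <= c -> (forall x, rnorm (s x) <= c) -> rnorm s <= c.
Proof. exact: gamma_sup_le. Qed.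

Lemma rnorm_gamma_ge (E' : X -> completeNormedModType R[i]) (b : hbundle E')
  (s : Gamma b cX) x : rnorm (s x) <= rnorm s.
Proof. exact: gamma_sup_ge. Qed.

Lemma gamma_sumE (E' : X -> completeNormedModType R[i]) (b : hbundle E')
    (I : Type) (r : seq I) (s : I -> Gamma b cX) x :
  (\sum_(i <- r) s i) x = \sum_(i <- r) s i x.
Proof. exact: (linear_sum (@Gamma_eval R X cX E' b x : {linear _ -> _})). Qed.

Definition tens_sum (l : seq (M * N)) : P := \sum_(z <- l) tens z.1 z.2.

Definition fiber_sum (l : seq (M * N)) (x : X) : ptensor (E x) (F x) :=
  \sum_(z <- l) tensor (z.1 x) (z.2 x).

Lemma Gamma_tensor_eval_sum x l : Gamma_tensor_eval x (tens_sum l) = fiber_sum l x.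
Proof.
by rewrite linear_sum; apply: eq_bigr => z _; exact: Gamma_tensor_evalE.
Qed.

Definition mul_tens (f : X -> R[i]^o) (fc : continuous f) (l : seq (M * N)) : P :=
  \sum_(z <- l) tens (mul_section fc z.1) z.2.

End BalancedTensorFacts.

(** * Cutoff functions and scalar approximation *)

Section Cutoffs.
Variables (R : realType) (X : topologicalType).
Hypotheses (cX : compact [set: X]) (hX : hausdorff_space X).
Local Notation nrm a := (rnorm (a : R[i]^o)).

Lemma cutoff (Z W : set X) : closed Z -> open W -> Z `<=` W ->
  exists (psi : X -> R) (V : set X), [/\ continuous psi,
    forall x, 0 <= psi x <= 1, open V /\ Z `<=` V,
    forall x, V x -> psi x = 1 & forall x, ~ W x -> psi x = 0].
Proof.
move=> cZ oW ZW.
have [||f [fc f01 f0 f1]] := @urysohn_sep R X cX hX Z (~` W) cZ.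
- exact: open_closedC.
- by apply/seteqP; split=> x //= [/ZW].
exists (fun x => Num.min 1 (2 - 2 * f x)), [set x | f x < 2^-1]; split.
- move=> x; apply: (@continuous_min R X (fun=> 1) (fun x => 2 - 2 * f x) x).
    exact: cvg_cst.
  by apply: cvgB; [exact: cvg_cst|apply: cvgM; [exact: cvg_cst|exact: fc]].
- move=> x; have := f01 x => /andP[? ?]; rewrite le_min ge_min lexx ler01 /=.
  by rewrite andbT; lra.
- split; last by move=> x Zx; rewrite /= f0// invr_gt0.
  rewrite openE => x /= fx; rewrite /interior /=.
  by have := cvgr_lt (f x) (fc x) _ fx; apply.
- by move=> x /= fx; apply/min_idPl; lra.
- by move=> x nW; rewrite f1// mulr1 subrr; apply/min_idPr.
Qed.

Lemma scalar_approx (Z : set X) (g : X -> R[i]) (e : R) : closed Z ->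
  rel_continuous Z g -> 0 < e ->
  exists2 g' : X -> R[i]^o, continuous g' & forall x, Z x -> nrm (g x - g' x) <= e.
Proof.
move=> cZ gZ e0.
apply: (@approx_glue R X cX hX (fun=> R[i]^o) [set t : X -> R[i]^o | continuous t]
  g Z (fun=> e)).
- by move=> x; exact: cvg_cst.
- by move=> t u tc uc x; apply: cvgD; [exact: tc|exact: uc].
- move=> h t hc tc x; apply: cvgM; last exact: tc.
  exact: (realC_comp_continuous hc).
- move=> x; exists (fun=> g x); first by move=> y; exact: cvg_cst.
  have [Zx|nZx] := pselect (Z x); first exact: gZ.
  have : nbhs x (~` Z) by apply: open_nbhs_nbhs; split => //; exact: closed_openC.
  by apply: filterS => y.
Qed.

End Cutoffs.

(** * The norm estimate *)

Section LocalBound.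
Variables (R : realType) (X : topologicalType).
Hypotheses (cX : compact [set: X]) (hX : hausdorff_space X).
Variables (E F : X -> completeNormedModType R[i]) (bE : hbundle E) (bF : hbundle F).
Hypotheses (fE : is_fbundle bE) (fF : is_fbundle bF).
Hypotheses (shE : subhomogeneous E) (shF : subhomogeneous F).
Hypothesis ftE : conditionally_finite_type bE.

Local Notation nrm a := (rnorm (a : R[i]^o)).
Local Notation M := (Gamma bE cX).
Local Notation N := (Gamma bF cX).
Local Notation tens := (@Gamma_tensor_of R X cX E F bE bF).

(** C is chosen before the tensor l and V after it. Multiplying by functions f that vanish off V
    localises the norm near Y, while the normalisation on l is over all fibres. *)
Definition bounded_near (Y : set X) : Prop := exists2 C : R, 0 <= C &
  forall l : seq (M * N), (forall x, rnorm (fiber_sum l x) <= 1) ->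
  exists V : set X, [/\ open V, Y `<=` V &
    forall (f : X -> R[i]^o) (fc : continuous f), (forall x, nrm (f x) <= 1) ->
      (forall x, ~ V x -> f x = 0) -> rnorm (mul_tens fc l) <= C].

Lemma bounded_near0 : bounded_near set0.
Proof.
exists 0 => // l _; exists set0; split => //; first exact: open0.
move=> f fc _ f0; rewrite /mul_tens big1 ?rnorm0// => z _.
rewrite (_ : mul_section fc z.1 = 0) ?tens0l//.
by apply: gammaP => x; rewrite /= f0// scale0r.
Qed.

Lemma mulR_continuous (f g : X -> R[i]^o) : continuous f -> continuous g ->
  continuous ((fun x => (f x * g x : R[i])) : X -> R[i]^o).
Proof. by move=> fc gc x; apply: cvgM; [exact: fc|exact: gc]. Qed.

Lemma rnorm_mul_section (E' : X -> completeNormedModType R[i]) (b : hbundle E')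
    (f : X -> R[i]^o) (fc : continuous f) (s : Gamma b cX) (V : set X) c :
  0 <= c -> (forall x, nrm (f x) <= 1) -> (forall x, ~ V x -> f x = 0) ->
  (forall x, V x -> rnorm (s x) <= c) -> rnorm (mul_section fc s) <= c.
Proof.
move=> c0 f1 f0 sV; apply: rnorm_gamma_le => // x /=.
have [Vx|nVx] := pselect (V x); last by rewrite f0// scale0r rnorm0.
rewrite rnormZ -[c]mul1r; apply: ler_pM; rewrite ?rnorm_ge0 ?sV//.
  exact: (@rnorm_ge0 R R[i]^o).
exact: f1.
Qed.

(* Near the stratum of dimension n, the tensor is rewritten along continuous
   frames; the number of terms and their norms only depend on n. *)
Lemma bounded_nearS n : bounded_near (dim_lt E n) -> bounded_near (dim_lt E n.+1).
Proof.
move=> [C' C'0 IH]; have [I stI] := stratum_coordinates cX hX fE n ftE.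
pose kp : R := 3 ^+ n; have kp0 : 0 <= kp by rewrite exprn_ge0.
(* C' for the part near lower dimensions, 1 for the error of the expansion, and for each p the
   bounds 3 and kp + 2 on the two factors. *)
exists (C' + 1 + \sum_(p : I) 3 * (kp + 2)).
  by rewrite !addr_ge0// sumr_ge0// => p _; rewrite mulr_ge0// addr_ge0.
move=> l hl; have [V' [oV' YV' hV']] := IH l hl.
have cY : closed (dim_lt E n) by exact: (dim_lt_closed cX hX fE).
pose Z := dim_lt E n.+1.
have cZ : closed Z by exact: (dim_lt_closed cX hX fE).
have [psi1 [V1 [psi1c psi101 [oV1 YV1] psi1V psi10]]] := @cutoff R X cX hX _ _ cY oV' YV'.
(* As psi1 is 1 on a neighborhood of the lower strata, the support of chi meets Z only in dimension
   n. *)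
pose chi x := 1 - psi1 x.
have chic : continuous chi by move=> x; apply: cvgB; [exact: cvg_cst|exact: psi1c].
have chi01 x : 0 <= chi x <= 1 by have /andP[? ?] := psi101 x; rewrite /chi; lra.
have Zn : Z `&` supp chi `<=` stratum E n.
  move=> x [[k]]; rewrite ltnS leq_eqVlt => /orP[/eqP->//|kn] hk sx; exfalso.
  case: (suppPn chi x) => _; apply => //.
  have : nbhs x V1 by apply: open_nbhs_nbhs; split => //; apply: YV1; exists k.
  by apply: filterS => y V1y; rewrite /chi psi1V// subrr.
have [e [kap [eA e1 kapc kapb chiE]]] := stI Z chi cZ chic chi01 Zn.
pose B1 : R := \sum_(z <- l) rnorm z.1; pose B2 : R := \sum_(z <- l) rnorm z.2.
have B10 : 0 <= B1 by apply: sumr_ge0 => z _; exact: rnorm_ge0.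
have B20 : 0 <= B2 by apply: sumr_ge0 => z _; exact: rnorm_ge0.
have leB1 z : z \in l -> rnorm z.1 <= B1.
  move=> zl; rewrite /B1 (big_rem z)//= lerDl.
  by apply: sumr_ge0 => u _; exact: rnorm_ge0.
(* Tolerance for the error of expanding [z.1]: even doubled, and multiplied by the norms of the
   [z.2], it totals at most 1. *)
pose eta : R := (2 * (B2 + 1))^-1.
have eta0 : 0 < eta by rewrite invr_gt0 mulr_gt0// ltr_wpDl.
have etaB : 2 * eta * B2 <= 1.
  by rewrite /eta invfM mulrA mulfV// mul1r mulrC ler_pdivrMr ?ltr_wpDl// mul1r lerDl.
have eta1 : eta <= 1.
  by rewrite /eta invf_le1; [lra|rewrite mulr_gt0// ltr_wpDl].
(* Each p contributes at most eps (2 + kp B1): eps from the scalar g and eps (kp B1 + 1) from the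
   vector [et p]. The final 1 ensures Q >= 1. *)
pose Q : R := #|I|%:R * (2 + kp * B1) + 1.
have Q1 : 1 <= Q by rewrite lerDr mulr_ge0// addr_ge0// mulr_ge0.
have Q0 : 0 < Q by exact: lt_le_trans Q1.
pose eps : R := eta / Q.
have eps0 : 0 < eps by rewrite divr_gt0.
have epse : eps <= eta by rewrite ler_pdivrMr// ler_peMr// ltW.
have eps1 : eps <= 1 by exact: le_trans eta1.
have epsB : eps * B2 <= 1 by have := ler_wpM2r B20 epse; lra.
have /choice[et etP] (p : I) : exists t : M, forall x, Z x -> rnorm (e p x - t x) <= eps.
  have [t tc th] := approximable_global cX hX cZ (eA p) eps0.
  by exists (GammaSection cX tc).
have /choice[g gP] (q : I * (M * N)) : exists g : X -> R[i]^o, continuous g /\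
    forall x, Z x -> nrm (kap q.1 x (q.2.1 x) - g x) <= eps.
  have kc := kapc q.1 _ (@gamma_continuous _ _ _ _ _ q.2.1).
  by have [g gc gh] := scalar_approx cX hX cZ kc eps0; exists g.
have gc q : continuous (g q) by case: (gP q).
have gZ p (z : M * N) x : Z x -> nrm (kap p x (z.1 x) - g (p, z) x) <= eps.
  by move=> Zx; have [_ h] := gP (p, z); exact: h.
pose t p : N := \sum_(z <- l) mul_section (gc (p, z)) z.2.
have chiC := realC_comp_continuous chic.
pose r (z : M * N) : M := mul_section chiC z.1 - \sum_p mul_section (gc (p, z)) (et p).
have rE (z : M * N) x : r z x = (chi x)%:C *: z.1 x - \sum_p g (p, z) x *: et p x.
  by rewrite -[LHS]/(_ - (\sum_p mul_section (gc (p, z)) (et p)) x) gamma_sumE.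
have tE p x : t p x = \sum_(z <- l) g (p, z) x *: z.2 x by rewrite /t gamma_sumE.
have rZ (z : M * N) x : z \in l -> Z x -> rnorm (r z x) <= eta.
  move=> zl Zx; rewrite rE chiE// -sumrB; apply: le_trans (rnorm_sum _ _) _.
  apply: (@le_trans _ _ (\sum_(p : I) eps * (2 + kp * B1))).
    apply: ler_sum => p _.
    have -> : kap p x (z.1 x) *: e p x - g (p, z) x *: et p x =
        (kap p x (z.1 x) - g (p, z) x) *: e p x + g (p, z) x *: (e p x - et p x).
      by rewrite scalerBl scalerBr addrA subrK.
    apply: le_trans (rnormD _ _) _; rewrite !rnormZ.
    have h1 := gZ p z x Zx; have h2 := e1 p x Zx; have h3 := etP p x Zx.
    have h4 : nrm (g (p, z) x) <= kp * B1 + 1.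
      have := rnormD (g (p, z) x - kap p x (z.1 x)) (kap p x (z.1 x)); rewrite subrK.
      have := kapb p x (z.1 x) Zx; have := rnorm_gamma_ge z.1 x; have := leB1 z zl.
      rewrite -/kp rnormB => a1 a2 a3.
      by have := ler_wpM2l kp0 (le_trans a2 a1); lra.
    have n1 := rnorm_ge0 (kap p x (z.1 x) - g (p, z) x : R[i]^o).
    have n2 := rnorm_ge0 (e p x); have n3 := rnorm_ge0 (g (p, z) x : R[i]^o).
    have n4 := rnorm_ge0 (e p x - et p x).
    have a1 := ler_pM n1 n2 h1 h2; have a2 := ler_pM n3 n4 h4 h3.
    by rewrite /rnorm in a1 a2 *; lra.
  have etaE : eta = eps * Q by rewrite /eps divfK// gt_eqF.
  rewrite sumr_const -[_ *+ #|_|]mulr_natl etaE mulrCA ler_wpM2l ?(ltW eps0)//.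
  by rewrite /Q lerDl.
have etZ p x : Z x -> rnorm (et p x) <= 2.
  move=> Zx; have := e1 p x Zx; have := etP p x Zx.
  by have := rnormD (et p x - e p x) (e p x); rewrite subrK rnormB; lra.
(* Up to [eps * B2 <= 1] this is the slice, by a functional of norm at most kp, of a tensor of norm
   at most 1. *)
have tZ p x : Z x -> rnorm (t p x) <= kp + 1.
  move=> Zx; have [D hD] := shF.
  have [k _ hk] : dim_le F D x by rewrite hD.
  have := rnorm_slice [seq (z.1 x, z.2 x) | z : M * N <- l] hk kp0 (fun v => kapb p x v Zx).
  rewrite !big_map /= -/(fiber_sum l x) => h1.
  have h2 := ler_wpM2l kp0 (hl x); rewrite mulr1 in h2.
  set s := \sum_(z <- l) _ in h1.
  have h3 : rnorm (t p x - s) <= 1.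
    rewrite tE -sumrB; apply: le_trans (rnorm_sum _ _) _.
    apply: le_trans epsB; rewrite mulr_sumr; apply: ler_sum => z _.
    rewrite -scalerBl rnormZ; apply: ler_pM; rewrite ?rnorm_ge0//.
    - exact: (@rnorm_ge0 R R[i]^o).
    - by have := gZ p z x Zx; rewrite rnormB.
    - exact: rnorm_gamma_ge.
  by have := rnormD (t p x - s) s; rewrite subrK; lra.
(* The bounds 2, kp + 1 and eta on Z are relaxed so as to be strict; they then hold near Z by
   continuity of the norms. *)
pose V2 := [set x | (forall p, rnorm (et p x) < 3 /\ rnorm (t p x) < kp + 2) /\
  forall z, z \in l -> rnorm (r z x) < 2 * eta].
have ZV2 : Z `<=` V2°.
  move=> x Zx; rewrite /interior; apply: filterI.
    apply: filter_forall => p; apply: filterI.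
      have := cvgr_lt _ (cs_rnorm fE (@gamma_continuous _ _ _ _ _ (et p)) (x := x)).
      by apply; have := etZ p x Zx; lra.
    have := cvgr_lt _ (cs_rnorm fF (@gamma_continuous _ _ _ _ _ (t p)) (x := x)).
    by apply; have := tZ p x Zx; lra.
  apply: near_all => z zl.
  have := cvgr_lt _ (cs_rnorm fE (@gamma_continuous _ _ _ _ _ (r z)) (x := x)).
  by apply; have := rZ z x zl Zx; lra.
have [psi [V [psic psi01 [oV ZV] psiV psi0]]] :=
  @cutoff R X cX hX _ _ cZ (@open_interior _ V2) ZV2.
have psiC := realC_comp_continuous psic.
exists V; split => // f fc f1 f0.
have f0V2 x : ~ V2 x -> f x = 0.
  move=> nV2; apply: f0 => Vx; have := psiV x Vx.
  by rewrite psi0 => [/eqP|/interior_subset//]; rewrite eq_sym oner_eq0.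
have psi1C := realC_comp_continuous psi1c.
have fpc := mulR_continuous fc psi1C.
have dec : mul_tens fc l = mul_tens fpc l +
    \sum_(z <- l) tens (mul_section fc (r z)) z.2 +
    \sum_p tens (mul_section fc (et p)) (mul_section psiC (t p)).
  (* The scalars [g (p, z)] cross the tensor sign and collect into [t p]. Inserting psi changes
     nothing, f being zero off V and psi being 1 on V, and it is what bounds the second factor
     globally: [t p] is controlled on V2 only. *)
  have -> : \sum_p tens (mul_section fc (et p)) (mul_section psiC (t p)) =
      \sum_(z <- l) \sum_p tens (mul_section (gc (p, z)) (mul_section fc (et p))) z.2.
    rewrite exchange_big; apply: eq_bigr => p _; rewrite -tens_balance.
    rewrite (_ : mul_section psiC _ = mul_section fc (et p)); last first.
      apply: gammaP => x /=; have [Vx|nVx] := pselect (V x).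
        by rewrite psiV// scale1r.
      by rewrite f0// scale0r scaler0.
    by rewrite tens_sumr; apply: eq_bigr => z _; exact/esym/tens_balance.
  rewrite /mul_tens -!big_split; apply: eq_bigr => z _ /=.
  rewrite -tens_suml -!tensDl; congr tens; apply: gammaP => x.
  have Sx : (\sum_p mul_section (gc (p, z)) (mul_section fc (et p))) x =
      f x *: \sum_p g (p, z) x *: et p x.
    rewrite gamma_sumE scaler_sumr; apply: eq_bigr => p _ /=.
    by rewrite !scalerA mulrC.
  rewrite -[RHS]/((f x * (psi1 x)%:C) *: z.1 x + f x *: r z x +
    (\sum_p mul_section (gc (p, z)) (mul_section fc (et p))) x) Sx rE.
  rewrite scalerBr -addrA subrK scalerA -scalerDl -mulrDr -rmorphD /chi.
  by rewrite addrC subrK mulr1.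
rewrite dec; apply: le_trans (rnormD _ _) _.
apply: lerD; [apply: le_trans (rnormD _ _) _; apply: lerD|].
- apply: hV' => x; last by move=> /psi10 ->; rewrite mulr0.
  rewrite -[_ * _]/(f x *: ((psi1 x)%:C : R[i]^o)) rnormZ -[1]mulr1.
  have /andP[p0 p1] := psi101 x.
  apply: ler_pM; rewrite ?rnorm_ge0//; [exact: (@rnorm_ge0 R R[i]^o)|exact: f1|].
  by rewrite /rnorm ger0_norm ?lecR.
- apply: le_trans (rnorm_sum _ _) _; apply: le_trans etaB.
  rewrite mulr_sumr big_seq [leRHS]big_seq; apply: ler_sum => z zl.
  apply: le_trans (rnorm_tens _ _) _; rewrite ler_wpM2r ?rnorm_ge0//.
  apply: (@rnorm_mul_section E bE f fc (r z) V2) => //; first by rewrite mulr_ge0// ltW.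
  by move=> x [_ /(_ z zl)/ltW].
- apply: le_trans (rnorm_sum _ _) _; apply: ler_sum => p _.
  apply: le_trans (rnorm_tens _ _) _; apply: ler_pM; rewrite ?rnorm_ge0//.
    by apply: (@rnorm_mul_section E bE f fc (et p) V2) => // x [/(_ p)[/ltW]].
  apply: (@rnorm_mul_section F bF _ psiC (t p) V2) => //.
  + by rewrite addr_ge0.
  + by move=> x; have /andP[p0 p1] := psi01 x; rewrite /rnorm ger0_norm ?lecR.
  + by move=> x nV2; rewrite psi0// => /interior_subset.
  + by move=> x [/(_ p)[_ /ltW]].
Qed.

End LocalBound.

(** * Completeness of quotients *)

Section QuotientLimits.
Variables (R : realType) (V : completeNormedModType R[i]) (S : set V).

Lemma cspan_pi_lift (q : cspan_quot S) (e : R) : 0 < e ->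
  exists2 v, cspan_pi S v = q & rnorm v <= rnorm q + e.
Proof.
move=> e0; elim/sep_ind: q => v; rewrite -/(cspan_pi S v).
have [w Sw hw] := cspan_dist_approx S v e0.
exists (v - w); last by rewrite rnorm_sep ltW.
by rewrite linearB /= ((cspan_pi_eq0 S w).2 Sw) subr0.
Qed.

(** Successive differences are lifted at twice their bound and summed in V, which is complete; the 4
    is this 2 times the 2 of the geometric tail. *)
Lemma cspan_quot_limit (u : nat -> cspan_quot S) (M : R) : 0 < M ->
  (forall n, rnorm (u n - u n.+1) <= M / 2 ^+ n) ->
  exists q, forall n, rnorm (u n - q) <= 4 * (M / 2 ^+ n).
Proof.
move=> M0 uS.
have r0 n : 0 < M / 2 ^+ n by rewrite divr_gt0// exprn_gt0.
have /choice[d dP] (n : nat) : exists d, cspan_pi S d = u n.+1 - u n /\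
    rnorm d <= 2 * M / 2 ^+ n.
  have [d du dn] := cspan_pi_lift (u n.+1 - u n) (r0 n).
  by exists d; split=> //; have := uS n; rewrite rnormB -mulrA; lra.
have [w0 w0u _] := cspan_pi_lift (u 0%N) ltr01.
pose w n := w0 + \sum_(k < n) d k.
have wS n : w n.+1 = w n + d n by rewrite /w big_ord_recr /= addrA.
have wu n : cspan_pi S (w n) = u n.
  elim: n => [|n IH]; first by rewrite /w big_ord0 addr0.
  rewrite wS linearD /= IH (dP n).1.
  by rewrite addrC subrK.
have [||l hl] := @geometric_limit R V w (2 * M); first by rewrite mulr_gt0.
  by move=> n; rewrite wS rnormB addrC addKr; exact: (dP n).2.
exists (cspan_pi S l) => n; rewrite -wu -linearB.
by apply: le_trans (rnorm_cspan_pi _ _) _; have := hl n; rewrite -mulrA; lra.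
Qed.

End QuotientLimits.

(** * Injectivity and surjectivity *)

Section Bijectivity.
Variables (R : realType) (X : topologicalType).
Hypotheses (cX : compact [set: X]) (hX : hausdorff_space X).
Variables (E F : X -> completeNormedModType R[i]) (bE : hbundle E) (bF : hbundle F).
Hypotheses (fE : is_fbundle bE) (fF : is_fbundle bF).
Hypotheses (shE : subhomogeneous E) (shF : subhomogeneous F).
Hypothesis ftE : conditionally_finite_type bE.

Local Notation M := (Gamma bE cX).
Local Notation N := (Gamma bF cX).
Local Notation P := (Gamma_tensor cX bE bF).

Lemma tens_sum_le : exists2 C : R, 0 < C & forall (l : seq (M * N)) (a : R), 0 < a ->
  (forall x, rnorm (fiber_sum l x) <= a) -> rnorm (tens_sum l) <= C * a.
Proof.
have bn n : bounded_near cX bE bF (dim_lt E n).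
  elim: n => [|n IH]; first by rewrite dim_lt0; exact: bounded_near0.
  exact: (bounded_nearS hX fE fF shE shF ftE IH).
(* All fibres have dimension at most D, so at level D + 1 the open set is X itself and the constant
   function 1 is admissible. *)
have [D hD] := shE; have [C C0 hC] := bn D.+1.
exists (C + 1); first by rewrite ltr_wpDl.
move=> l a a0 la; pose l' := [seq ((a^-1)%:C *: z.1, z.2) | z : M * N <- l].
have ai0 : 0 <= a^-1 by rewrite invr_ge0 ltW.
have l'1 x : rnorm (fiber_sum l' x) <= 1.
  rewrite /fiber_sum big_map /=.
  rewrite (_ : \sum_(z <- l) _ = (a^-1)%:C *: fiber_sum l x); last first.
    by rewrite scaler_sumr; apply: eq_bigr => z _; rewrite -tensorZl.
  by rewrite rnormZr// mulrC ler_pdivrMr// mul1r.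
have [V [_ VX hV]] := hC _ l'1.
have one_c : continuous ((fun=> 1) : X -> R[i]^o) by move=> x; exact: cvg_cst.
have := hV _ one_c; have -> : mul_tens one_c l' = (a^-1)%:C *: tens_sum l.
  rewrite /mul_tens big_map scaler_sumr; apply: eq_bigr => z _ /=.
  by rewrite -tensZl; congr Gamma_tensor_of; apply: gammaP => x /=; rewrite scale1r.
rewrite rnormZr// mulrC => h.
have {}h : rnorm (tens_sum l) / a <= C.
  apply: h => x; first by rewrite /rnorm normr1.
  have Vx : V x by apply: VX; rewrite dim_ltS hD.
  by move=> /(_ Vx).
by move: h; rewrite ler_pdivrMr// => /le_trans; apply; rewrite ler_pM2r// lerDl.
Qed.

Variable G : hbundle (fun x => ptensor (E x) (F x)).
Hypothesis tG : is_tensor_bundle bE bF G.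

(** A finite tensor near an element of the kernel is small in every fibre, hence small by the norm
    estimate. *)
Lemma canonical_morphism_inj : injective (canonical_morphism cX tG).
Proof.
have [C C0 hC] := tens_sum_le.
move=> p q pq; apply/eqP; rewrite -subr_eq0; apply/eqP; set u := p - q.
have u0 x : Gamma_tensor_eval x u = 0.
  rewrite /u linearB; apply/eqP; rewrite subr_eq0; apply/eqP.
  by have := congr1 (fun s : Gamma G cX => s x) pq.
apply: rnorm_eq0; apply/eqP; rewrite eq_le rnorm_ge0 andbT.
apply/ler_addgt0Pl => e e0; rewrite addr0.
have C1 : 0 < C + 1 by rewrite addr_gt0.
have eC : 0 < e / (C + 1) by rewrite divr_gt0.
have [l ul] := balanced_dense u eC.
have lx x : rnorm (fiber_sum l x) <= e / (C + 1).
  rewrite -Gamma_tensor_eval_sum -[Gamma_tensor_eval x _]subr0 -(u0 x) -linearB.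
  by apply: le_trans (Gamma_tensor_eval_le _ _) _; rewrite rnormB.
have := hC l _ eC lx; have := rnormD (u - tens_sum l) (tens_sum l); rewrite subrK.
move=> h1 h2; apply: le_trans h1 _; apply: le_trans (lerD ul h2) _.
by rewrite le_eqVlt; apply/orP; left; apply/eqP; field; rewrite gt_eqF.
Qed.

Lemma fiber_sum_continuous (l : seq (M * N)) :
  continuous_section G (fun x => fiber_sum l x).
Proof.
rewrite (_ : (fun x => _) = fun x => Gamma_tensor_eval x (tens_sum l)).
  exact: Gamma_tensor_eval_continuous.
by apply/functional_extensionality_dep => x; rewrite Gamma_tensor_eval_sum.
Qed.

Lemma fiber_sum_dense_at (x : X) (q : ptensor (E x) (F x)) (e : R) : 0 < e ->
  exists l : seq (M * N), rnorm (q - fiber_sum l x) <= e.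
Proof.
move=> e0; have [u qu] := completion_dense q e0.
case: u qu => u' u'P; have /asboolP[s us] := u'P.
rewrite (_ : ATensor u'P = atensor_of s); last exact: val_inj.
rewrite -sum_tensorE => qs.
suff [l ls] : exists l : seq (M * N), fiber_sum l x = \sum_(z <- s) tensor z.1 z.2.
  by exists l; rewrite ls.
elim: s {us qs} => [|[v w] s [l ls]]; first by exists [::]; rewrite /fiber_sum !big_nil.
have [a ac ax] := section_through cX hX bE v.
have [c cc cx] := section_through cX hX bF w.
exists ((GammaSection cX ac, GammaSection cX cc) :: l).
by rewrite /fiber_sum !big_cons -/(fiber_sum l x) ls /= ax cx.
Qed.

(** The difference of s and a finite tensor is a continuous section of G, so a strict bound at x
    spreads to a neighborhood by upper semicontinuity; the local choices are then glued. *)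
Lemma fiber_sum_dense (s : Gamma G cX) (e : R) : 0 < e ->
  exists l : seq (M * N), forall x, rnorm (s x - fiber_sum l x) <= e.
Proof.
move=> e0.
pose L : set (forall x, ptensor (E x) (F x)) :=
  fun t => exists l : seq (M * N), t = fun x => fiber_sum l x.
have [] := @approx_glue R X cX hX (fun x => ptensor (E x) (F x)) L s setT (fun=> e).
- by exists [::]; apply/functional_extensionality_dep => x; rewrite /fiber_sum big_nil.
- move=> _ _ [l ->] [l' ->]; exists (l ++ l').
  by apply/functional_extensionality_dep => x; rewrite /fiber_sum big_cat.
- move=> h _ hc [l ->].
  exists [seq (mul_section (realC_comp_continuous hc) z.1, z.2) | z : M * N <- l].
  apply/functional_extensionality_dep => x; rewrite /fiber_sum big_map scaler_sumr.
  by apply: eq_bigr => z _; rewrite -tensorZl.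
- move=> x; have e2 : 0 < e / 2 by rewrite divr_gt0.
  have [l hl] := fiber_sum_dense_at (s x) e2.
  exists (fun x => fiber_sum l x); first by exists l.
  pose d : Gamma G cX := s - GammaSection cX (@fiber_sum_continuous l).
  have dx : rnorm (d x) < e by apply: le_lt_trans hl _; lra.
  have : \forall y \near x, bnorm (point G (Tagged (fun x => ptensor (E x) (F x)) (d y))) < e.
    exact: (@gamma_continuous _ _ _ _ _ d x _ (@bnorm_near R X _ G x _ e dx)).
  by apply: filterS => y; rewrite bnorm_pt => /ltW.
by move=> _ [l ->] hl; exists l => x; exact: hl.
Qed.

Lemma canonical_morphism_surj (s : Gamma G cX) : exists q, canonical_morphism cX tG q = s.
Proof.
have [C C0 hC] := tens_sum_le.
have r0 n : 0 < (2 ^+ n)^-1 :> R by rewrite invr_gt0 exprn_gt0.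
have /choice[u uP] (n : nat) : exists l : seq (M * N),
    forall x, rnorm (s x - fiber_sum l x) <= (2 ^+ n)^-1.
  exact: fiber_sum_dense.
(* The norm estimate concerns lists, so differences of approximants are written as lists too. *)
pose neg (l : seq (M * N)) := [seq (- z.1, z.2) | z : M * N <- l].
have negE l : tens_sum (neg l) = - tens_sum l.
  rewrite /tens_sum big_map -sumrN; apply: eq_bigr => z _.
  by rewrite -[RHS]scaleN1r -tensZl scaleN1r.
have catE l l' : tens_sum (l ++ neg l') = tens_sum l - tens_sum l'.
  by rewrite {1}/tens_sum big_cat -negE.
have [||q hq] := @cspan_quot_limit R _ _ (fun n => tens_sum (u n)) (2 * C).
- by rewrite mulr_gt0.
- move=> n; rewrite -catE [2 * C]mulrC -mulrA; apply: hC => [|x].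
    by rewrite mulr_gt0.
  rewrite -Gamma_tensor_eval_sum catE linearB /= !Gamma_tensor_eval_sum.
  apply: le_trans (rnorm_tri _ (s x) _) _.
  have h : (2 ^+ n.+1)^-1 <= (2 ^+ n)^-1 :> R.
    by rewrite lef_pV2 ?posrE ?exprn_gt0// ler_weXn2l// ler1n.
  rewrite mulr_natl mulr2n; apply: lerD; first by rewrite rnormB; exact: uP.
  exact: le_trans (uP n.+1 x) h.
exists q; apply: gammaP => x; apply/eqP; rewrite -subr_eq0; apply/eqP/rnorm_eq0/eqP.
rewrite eq_le rnorm_ge0 andbT; apply/ler_addgt0Pl => e e0; rewrite addr0.
(* 8 C from the limit in the quotient, 1 from the approximation of s. *)
have [n hn] := geometric_small (8 * C + 1) e0.
rewrite -[canonical_morphism _ _ _ x]/(Gamma_tensor_eval x q).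
have h1 : rnorm (Gamma_tensor_eval x q - fiber_sum (u n) x) <= 4 * (2 * C / 2 ^+ n).
  rewrite -Gamma_tensor_eval_sum -linearB; apply: le_trans (Gamma_tensor_eval_le _ _) _.
  by rewrite rnormB; exact: hq.
apply: le_trans (rnorm_tri _ (fiber_sum (u n) x) _) _.
apply: le_trans (ltW hn); rewrite mulrDl mul1r; apply: lerD.
  by apply: le_trans h1 _; rewrite !mulrA -natrM.
by rewrite rnormB; exact: uP.
Qed.

End Bijectivity.

Theorem theorem3p8 (R : realType) (X : topologicalType)
  (cX : compact [set: X]) (hX : hausdorff_space X)
  (E F : X -> completeNormedModType R[i]) (bE : hbundle E) (bF : hbundle F)
  (fE : is_fbundle bE) (fF : is_fbundle bF)
  (shE : subhomogeneous E) (shF : subhomogeneous F)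
  (ftE : conditionally_finite_type bE) (ftF : conditionally_finite_type bF)
  (gE : forall d, Gdelta (dim_le E d)) (gF : forall d, Gdelta (dim_le F d))
  (G : hbundle (fun x => ptensor (E x) (F x))) (tG : is_tensor_bundle bE bF G) :
  bijective (canonical_morphism cX tG).
Proof.
have [g gK] := choice (canonical_morphism_surj hX fE fF shE shF ftE tG).
have inj := @canonical_morphism_inj R X cX hX E F bE bF fE fF shE shF ftE G tG.
by exists g => // q; apply: inj.
Qed.
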